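(* Let $H$ be a Hopf algebra over a field $k$ with a bijective antipode, $\mathcal{C}={}_H^H\mathcal{YD}$, and let $B$ be a finite-dimensional Hopf algebra in $\mathcal{C}$ such that $\Phi_{B,M}=\Phi_{M,B}^{-1}$ for all $M\in\mathcal{C}$. Suppose moreover that all group-likes $I\to B$ factor through coalgebra morphisms to the (left/right) center $Z_{\bullet}(B)$ of $B$, and all group-likes $I\to B^*$ factor through coalgebra morphisms to the (left/right) center $Z_\bullet(B^* )$ of $B^*$, i.e. $G(B)=\operatorname{Co-Alg}(I,Z_\bullet(B))$ and $G(B^* )=\operatorname{Co-Alg}(I,Z_\bullet(B^* ))$. Then the map $$\Pi:\operatorname{Aut}(\mathcal{C};B)\to\operatorname{BQ}(\mathcal{C};B),\qquad \Pi(\alpha)=[\operatorname{End}(B_{\alpha^{-1}})]$$ is injective. Consequently, if $B$ is commutative and cocommutative, $\operatorname{Aut}(\mathcal{C};B)$ can be embedded into the Brauer-Long group $\operatorname{BD}(\mathcal{C};B)$.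
   Context: **The category $\mathcal{C}$.** $\mathcal{C}={}_H^H\mathcal{YD}$ is the category of left-left Yetter-Drinfel'd $H$-modules: left $H$-modules and left $H$-comodules $M$ with $h_{(1)}m_{[-1]}\otimes h_{(2)}\cdot m_{[0]}=(h_{(1)}\cdot m)_{[-1]}h_{(2)}\otimes(h_{(1)}\cdot m)_{[0]}$; morphisms are the $H$-linear and $H$-colinear maps. It is braided monoidal (diagonal structures, unit $I=k$) with $\Phi_{M,N}(m\otimes n)=n_{[0]}\otimes S_H^{-1}(n_{[-1]})\cdot m$. $\operatorname{Aut}(\mathcal{C};B)$ is the group of Hopf algebra automorphisms of $B$ in $\mathcal{C}$. The structure of $B$ is $\nabla,\eta,\Delta,\varepsilon,S$. An object's name also denotes its identity morphism. $B$ is commutative if $\nabla\Phi_{B,B}=\nabla$ and cocommutative if $\Phi_{B,B}\Delta=\Delta$. $B^*$ is the dual Hopf algebra of $B$ in $\mathcal{C}$. **Yetter-Drinfel'd modules over $B$ in $\mathcal{C}$.** Objects of ${}_B^B\mathcal{YD}(\mathcal{C})$ are $M\in\mathcal{C}$ with a left $B$-action $\mu_M$ and left $B$-coaction $\lambda_M$ in $\mathcal{C}$ such that $$(\nabla\otimes M)(B\otimes\Phi_{M,B})(\lambda_M\mu_M\otimes B)(B\otimes\Phi_{B,M})(\Delta\otimes M)=(\nabla\otimes\mu_M)(B\otimes\Phi_{B,B}\otimes M)(\Delta\otimes\lambda_M).$$ Morphisms are $B$-linear and $B$-colinear morphisms in $\mathcal{C}$. The tensor product $\bar\otimes$ has the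 (co)diagonal structures (formed with $\Phi$), and the braiding is $\Psi_{M,N}=(N\otimes\mu_M)(\Phi_{N,B}^{-1}\otimes M)(S^{-1}\otimes N\otimes M)(\lambda_N\otimes M)\Phi_{N,M}^{-1}$. For $B$ commutative and cocommutative this category coincides with that of $B$-dimodules in $\mathcal{C}$, and its Brauer group is then called the Brauer-Long group $\operatorname{BD}(\mathcal{C};B)$. **Quantum Brauer group.** $\operatorname{BQ}(\mathcal{C};B)$ is the Brauer group of ${}_B^B\mathcal{YD}(\mathcal{C})$. The algebra $A\bar\otimes A'$ has multiplication $(\nabla_A\otimes\nabla_{A'})(A\otimes\Psi_{A',A}\otimes A')$, and $\overline{A}$ has multiplication $\nabla_A\Psi_{A,A}$. A nonzero finite-dimensional algebra $A$ in ${}_B^B\mathcal{YD}(\mathcal{C})$ is Azumaya if $\overline F:A\bar\otimes\overline A\to\operatorname{End}(A)$, $\overline F(a\otimes b)(c)=\nabla(a\otimes\nabla\Psi(b\otimes c))$, and $\overline G:\overline A\bar\otimes A\to\overline{\operatorname{End}(A)}$, $\overline G(a\otimes b)(c)=\nabla(\nabla\Psi(c\otimes a)\otimes b)$, are isomorphisms. Azumaya algebras $A,A'$ are equivalent if $A\bar\otimes\operatorname{End}(M)\cong A'\bar\otimes\operatorname{End}(N)$ as algebras in ${}_B^B\mathcal{YD}(\mathcal{C})$ for some nonzero finite-dimensional $M,N$ in that category. The product is induced by $\bar\otimes$, the unit is the class of the $\operatorname{End}(M)$, and $[A]^{-1}=[\overline A]$. For $M$ with $B$-action (corresponding algebra map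 $\theta:B\to\operatorname{End}(M)$) and $B$-coaction, $E=\operatorname{End}(M)$ has the $B$-action $\nabla_E(\nabla_E\otimes E)(\theta\otimes E\otimes\theta)(B\otimes\Phi_{B,E})(B\otimes S\otimes E)(\Delta\otimes E)$ and the $B$-coaction $\lambda_E$ determined by $(B\otimes ev)(\lambda_E\otimes M)=(\nabla\Phi_{B,B}\otimes M)(B\otimes\lambda_M ev)(S^{-1}\otimes E\otimes M)(\Phi_{E,B}\otimes M)(E\otimes\lambda_M)$, where $ev:E\otimes M\to M$ is evaluation. **$B_\alpha$.** For $\alpha\in\operatorname{Aut}(\mathcal{C};B)$, $B_\alpha=B$ as an object of $\mathcal{C}$, with $B$-action $\nabla\Phi_{B,B}(S^{-1}\otimes\nabla(\alpha\otimes B))(\Delta\otimes B)$ and $B$-coaction $\lambda_{B_\alpha}=(S\otimes B)\Phi_{B,B}^{-1}\Delta$. The algebra $E_\alpha=\operatorname{End}(B_\alpha)$, with the $B$-action $\nabla_{E_\alpha}(\nabla_{E_\alpha}\otimes E_\alpha)(\theta_\alpha\otimes E_\alpha\otimes\theta_\alpha)(B\otimes\Phi_{B,E_\alpha})(B\otimes S\otimes E_\alpha)(\Delta\otimes E_\alpha)$, where $\theta_\alpha:B\to E_\alpha$ is the algebra map corresponding to the $B$-action on $B_\alpha$, and with the $B$-coaction $\lambda_{E_\alpha}$ determined by $(B\otimes ev)(\lambda_{E_\alpha}\otimes B_\alpha)=(\nabla\Phi_{B,B}\otimes B_\alpha)(B\otimes\lambda_{B_\alpha}ev)(S^{-1}\otimes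 E_\alpha\otimes B_\alpha)(\Phi_{E_\alpha,B}\otimes B_\alpha)(E_\alpha\otimes\lambda_{B_\alpha})$, where $ev:E_\alpha\otimes B_\alpha\to B_\alpha$ is evaluation, is an algebra in ${}_B^B\mathcal{YD}(\mathcal{C})$. **Group-likes and centers.** $G(X)$ is the set of coalgebra morphisms $I\to X$ for $X=B,B^*$. The right center of an algebra $A$ is the universal object with a morphism $i:Z\to A$ satisfying $\nabla_A(i\otimes A)=\nabla_A\Phi_{A,A}(i\otimes A)$; the left center is defined symmetrically. A morphism $g:I\to A$ factors through the left center iff it factors through the right one, i.e. iff $\nabla_A(g\otimes A)=\nabla_A(A\otimes g)$. *)

(* Defs.v *)
From HB Require Import structures.
From mathcomp Require Import all_boot all_order all_algebra.
From mathcomp Require Import boolp.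
Set Implicit Arguments. Unset Strict Implicit. Unset Printing Implicit Defensive.
Import GRing.Theory.
Local Open Scope ring_scope.
Local Open Scope quotient_scope.

Lemma lin_ext (k : fieldType) (U V : lmodType k) (f g : {linear U -> V}) :
  f =1 g -> f = g.
Proof.
case: f g => f [[a] [b]] [g [[a'] [b']]] /= /funext fg.
by case: _ / fg in a' b' *; rewrite (Prop_irrelevance a a') (Prop_irrelevance b b').
Qed.

Section MkLin.
Variables (k : fieldType) (U V : lmodType k) (f : U -> V).
Hypothesis fL : linear f.
Let fL' : U -> V := f.
HB.instance Definition _ := GRing.isLinear.Build k U V *:%R fL' fL.
Definition mk_lin : {linear U -> V} := fL'.
Lemma mk_linE u : mk_lin u = f u. Proof. by []. Qed.
End MkLin.

Section LinearMaps.
Variable k : fieldType.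
Implicit Types U V W : lmodType k.

Definition lid U : {linear U -> U} := @idfun U.
Definition lcomp U V W (g : {linear V -> W}) (f : {linear U -> V}) :
  {linear U -> W} := g \o f.

(* A linear map satisfying P, or 0 if there is none. Only used where P has a
   unique solution; in particular linv f is the inverse of f when f is
   bijective. *)
Definition the_lin U V (P : {linear U -> V} -> Prop) : {linear U -> V} :=
  if pselect (exists f, P f) is left h then projT1 (cid h) else \0.

Definition linv U V (f : {linear U -> V}) : {linear V -> U} :=
  the_lin (fun g => cancel f g /\ cancel g f).

Definition lhom U V : Type := {linear U -> V}.

Section HomLmod.
Variables U V : lmodType k.
HB.instance Definition _ := gen_eqMixin (lhom U V).
HB.instance Definition _ := gen_choiceMixin (lhom U V).

Implicit Types f g : lhom U V.
Definition hom_add f g : lhom U V := f \+ g.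
Definition hom_opp f : lhom U V := \- f.
Definition hom_scale (a : k) f : lhom U V := a \*: f.
Definition hom_zero : lhom U V := \0.

Fact hom_addA : associative hom_add.
Proof. by move=> f g h; apply: lin_ext => u; apply: addrA. Qed.
Fact hom_addC : commutative hom_add.
Proof. by move=> f g; apply: lin_ext => u; apply: addrC. Qed.
Fact hom_add0 : left_id hom_zero hom_add.
Proof. by move=> f; apply: lin_ext => u; apply: add0r. Qed.
Fact hom_addN : left_inverse hom_zero hom_opp hom_add.
Proof. by move=> f; apply: lin_ext => u; apply: addNr. Qed.
HB.instance Definition _ :=
  GRing.isZmodule.Build (lhom U V) hom_addA hom_addC hom_add0 hom_addN.

Fact hom_scaleA a b f : hom_scale a (hom_scale b f) = hom_scale (a * b) f.
Proof. by apply: lin_ext => u; apply: scalerA. Qed.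
Fact hom_scale1 : left_id 1 hom_scale.
Proof. by move=> f; apply: lin_ext => u; apply: scale1r. Qed.
Fact hom_scaleDr : right_distributive hom_scale +%R.
Proof. by move=> a f g; apply: lin_ext => u; apply: scalerDr. Qed.
Fact hom_scaleDl f : {morph hom_scale^~ f : a b / a + b}.
Proof. by move=> a b; apply: lin_ext => u; apply: scalerDl. Qed.
HB.instance Definition _ := GRing.Zmodule_isLmodule.Build k (lhom U V)
  hom_scaleA hom_scale1 hom_scaleDr hom_scaleDl.
End HomLmod.

Definition LHom U V : lmodType k := lhom U V.

(* U ⊗ V is the set of finite formal sums of pairs (u, v), two sums being
   identified when every bilinear map takes the same value on them. *)
Section Tensor.
Variables U V : lmodType k.
Implicit Types (s t : seq (U * V)) (u : U) (v : V).

Definition bilin W (b : U -> V -> W) : Prop :=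
  (forall v, linear (b^~ v)) /\ (forall u, linear (b u)).

Definition bsum W (b : U -> V -> W) s : W := \sum_(p <- s) b p.1 p.2.

Definition tens_eq s t : bool :=
  `[< forall (W : lmodType k) (b : U -> V -> W), bilin b -> bsum b s = bsum b t >].

Fact tens_eq_refl : reflexive tens_eq.
Proof. by move=> s; apply/asboolP. Qed.
Fact tens_eq_sym : symmetric tens_eq.
Proof. by move=> s t; apply/asboolP/asboolP => st W b /st. Qed.
Fact tens_eq_trans : transitive tens_eq.
Proof.
by move=> t s r /asboolP st /asboolP tr; apply/asboolP => W b hb; rewrite st ?tr.
Qed.
Canonical tens_equiv := EquivRel tens_eq tens_eq_refl tens_eq_sym tens_eq_trans.
Definition tens_type := {eq_quot tens_equiv}.
HB.instance Definition _ := Choice.on tens_type.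
HB.instance Definition _ := EqQuotient.on tens_type.

Definition tens_class s : tens_type := \pi_tens_type s.

Lemma tens_classP s t :
  (forall (W : lmodType k) (b : U -> V -> W), bilin b -> bsum b s = bsum b t) ->
  tens_class s = tens_class t.
Proof. by move=> st; apply/eqmodP/asboolP. Qed.

Definition bsum_tens W (b : U -> V -> W) (x : tens_type) : W := bsum b (repr x).

Lemma bsum_tensE W (b : U -> V -> W) s : bilin b -> bsum_tens b (tens_class s) = bsum b s.
Proof.
move=> hb; have: tens_eq (repr (tens_class s)) s by apply/eqmodP; rewrite reprK.
by move/asboolP; apply.
Qed.

Lemma tens_classK (x : tens_type) : tens_class (repr x) = x.
Proof. exact: reprK. Qed.

Lemma bsum_cat W (b : U -> V -> W) s t : bsum b (s ++ t) = bsum b s + bsum b t.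
Proof. exact: big_cat. Qed.

Definition sscale (a : k) s := [seq (a *: p.1, p.2) | p <- s].
Lemma bsum_scale W (b : U -> V -> W) a s : bilin b -> bsum b (sscale a s) = a *: bsum b s.
Proof.
case=> hb _; rewrite /bsum big_map scaler_sumr; apply: eq_bigr => p _ /=.
exact: (linearZZ (mk_lin (hb p.2))).
Qed.

Definition tens_add (x y : tens_type) := tens_class (repr x ++ repr y).
Definition tens_scale (a : k) (x : tens_type) := tens_class (sscale a (repr x)).
Definition tens_opp := tens_scale (-1).
Definition tens_zero := tens_class [::].

Lemma tens_ext (x y : tens_type) :
  (forall (W : lmodType k) (b : U -> V -> W), bilin b -> bsum_tens b x = bsum_tens b y) -> x = y.
Proof. by move=> xy; rewrite -[x]tens_classK -[y]tens_classK; apply: tens_classP. Qed.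

Lemma bsum_tensD W (b : U -> V -> W) x y :
  bilin b -> bsum_tens b (tens_add x y) = bsum_tens b x + bsum_tens b y.
Proof. by move=> hb; rewrite bsum_tensE // bsum_cat. Qed.
Lemma bsum_tensZ W (b : U -> V -> W) a x :
  bilin b -> bsum_tens b (tens_scale a x) = a *: bsum_tens b x.
Proof. by move=> hb; rewrite bsum_tensE // bsum_scale. Qed.
Lemma bsum_tens0 W (b : U -> V -> W) : bilin b -> bsum_tens b tens_zero = 0.
Proof. by move=> hb; rewrite bsum_tensE // /bsum big_nil. Qed.

Fact tens_addA : associative tens_add.
Proof. by move=> x y z; apply: tens_ext => W b hb; rewrite !bsum_tensD // addrA. Qed.
Fact tens_addC : commutative tens_add.
Proof. by move=> x y; apply: tens_ext => W b hb; rewrite !bsum_tensD // addrC. Qed.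
Fact tens_add0 : left_id tens_zero tens_add.
Proof. by move=> x; apply: tens_ext => W b hb; rewrite bsum_tensD // bsum_tens0 // add0r. Qed.
Fact tens_addN : left_inverse tens_zero tens_opp tens_add.
Proof.
move=> x; apply: tens_ext => W b hb.
by rewrite bsum_tensD // bsum_tensZ // bsum_tens0 // scaleN1r addNr.
Qed.
HB.instance Definition _ :=
  GRing.isZmodule.Build tens_type tens_addA tens_addC tens_add0 tens_addN.

Fact tens_scaleA a b x : tens_scale a (tens_scale b x) = tens_scale (a * b) x.
Proof. by apply: tens_ext => W c hc; rewrite !bsum_tensZ // scalerA. Qed.
Fact tens_scale1 : left_id 1 tens_scale.
Proof. by move=> x; apply: tens_ext => W c hc; rewrite !bsum_tensZ // scale1r. Qed.
Fact tens_scaleDr : right_distributive tens_scale +%R.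
Proof.
by move=> a x y; apply: tens_ext => W c hc; rewrite !(bsum_tensZ, bsum_tensD) // scalerDr.
Qed.
Fact tens_scaleDl x : {morph tens_scale^~ x : a b / a + b}.
Proof.
by move=> a b; apply: tens_ext => W c hc; rewrite !(bsum_tensZ, bsum_tensD) // scalerDl.
Qed.
HB.instance Definition _ := GRing.Zmodule_isLmodule.Build k tens_type
  tens_scaleA tens_scale1 tens_scaleDr tens_scaleDl.

Definition tensor : lmodType k := tens_type.
Definition tens u v : tensor := tens_class [:: (u, v)].

Fact bsum_tens_linear W (b : U -> V -> W) (hb : bilin b) :
  linear (bsum_tens b : tensor -> W).
Proof.
by move=> a x y; rewrite [LHS]bsum_tensD // bsum_tensZ.
Qed.

(* The universal property: b factors uniquely through tens. *)
Fact tlift_key : unit. Proof. by []. Qed.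
Definition tlift W (b : U -> V -> W) (hb : bilin b) : {linear tensor -> W} :=
  locked_with tlift_key (mk_lin (bsum_tens_linear hb)).

Lemma tliftE W (b : U -> V -> W) (hb : bilin b) u v : tlift hb (tens u v) = b u v.
Proof. by rewrite /tlift unlock [LHS]bsum_tensE // /bsum big_seq1. Qed.

Lemma tens_bilin : bilin tens.
Proof.
split=> [v a u u'|u a v v'];
 apply: tens_ext => W b hb; rewrite bsum_tensD // bsum_tensZ //;
 rewrite !bsum_tensE // /bsum !big_seq1 /=; case: hb => h1 h2.
- exact: h1.
- exact: h2.
Qed.

Lemma bsumE s : bsum tens s = tens_class s.
Proof.
apply: tens_ext => W b hb; rewrite bsum_tensE //.
elim: s => [|p s IHs]; first by rewrite /bsum !big_nil -[RHS](bsum_tens0 hb).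
rewrite /bsum !big_cons -/(bsum tens s) -/(bsum b s) -IHs [LHS]bsum_tensD //.
by rewrite bsum_tensE // /bsum big_seq1.
Qed.

Lemma tensor_sum (x : tensor) : exists s, x = \sum_(p <- s) tens p.1 p.2.
Proof. by exists (repr x); rewrite -/(bsum tens _) bsumE [RHS]tens_classK. Qed.

Lemma tensor_lin_ext W (f g : {linear tensor -> W}) :
  (forall u v, f (tens u v) = g (tens u v)) -> f = g.
Proof.
move=> fg; apply: lin_ext => x; have [s ->] := tensor_sum x.
by rewrite !linear_sum; apply: eq_bigr.
Qed.
End Tensor.
End LinearMaps.

Declare Scope tens_scope.
Delimit Scope tens_scope with T.
Notation "U ⊗ V" := (tensor U V) (at level 40, left associativity) : tens_scope.
Notation "g ∘ f" := (lcomp g f) (at level 50, left associativity) : tens_scope.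
Local Open Scope tens_scope.

Section TensorMaps.
Variable k : fieldType.
Implicit Types U V W : lmodType k.

Lemma tensl U V (v : V) : linear (fun u : U => tens u v).
Proof. exact: (tens_bilin U V).1. Qed.
Lemma tensr U V (u : U) : linear (fun v : V => tens u v).
Proof. exact: (tens_bilin U V).2. Qed.

Fact tmap_bilin U V U' V' (f : {linear U -> U'}) (g : {linear V -> V'}) :
  bilin (fun u v => tens (f u) (g v)).
Proof. by split=> [v a u u'|u a v v'] /=; rewrite linearP (tensl, tensr). Qed.
Definition tmap U V U' V' (f : {linear U -> U'}) (g : {linear V -> V'}) :
  {linear U ⊗ V -> U' ⊗ V'} := tlift (tmap_bilin f g).

Fact swap_bilin U V : bilin (fun (u : U) (v : V) => tens v u).
Proof. by split=> [v a u u'|u a v v'] /=; rewrite (tensl, tensr). Qed.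
Definition swap U V : {linear U ⊗ V -> V ⊗ U} := tlift (@swap_bilin U V).

Fact asc_bilin1 U V W (w : W) : bilin (fun (u : U) (v : V) => tens u (tens v w)).
Proof. by split=> [v a u u'|u a v v'] /=; rewrite !(tensl, tensr). Qed.
Fact asc_bilin U V W : bilin (fun (x : U ⊗ V) (w : W) => tlift (asc_bilin1 U V w) x).
Proof.
split=> [w a x y|x a w w']; first exact: linearP.
suff -> : tlift (asc_bilin1 U V (a *: w + w')) =
          (a \*: tlift (asc_bilin1 U V w)) \+ tlift (asc_bilin1 U V w') by [].
by apply: tensor_lin_ext => u v; rewrite /= !tliftE !tensr.
Qed.
Definition asc U V W : {linear (U ⊗ V) ⊗ W -> U ⊗ (V ⊗ W)} :=
  tlift (@asc_bilin U V W).

Fact ascV_bilin1 U V W (u : U) : bilin (fun (v : V) (w : W) => tens (tens u v) w).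
Proof. by split=> [w a v v'|v a w w'] /=; rewrite !(tensl, tensr). Qed.
Fact ascV_bilin U V W : bilin (fun (u : U) (x : V ⊗ W) => tlift (ascV_bilin1 V W u) x).
Proof.
split=> [x a u u'|u a x y]; last exact: linearP.
suff -> : tlift (ascV_bilin1 V W (a *: u + u')) =
          (a \*: tlift (ascV_bilin1 V W u)) \+ tlift (ascV_bilin1 V W u') by [].
by apply: tensor_lin_ext => v w; rewrite /= !tliftE !tensl.
Qed.
Definition ascV U V W : {linear U ⊗ (V ⊗ W) -> (U ⊗ V) ⊗ W} :=
  tlift (@ascV_bilin U V W).

Fact lun_bilin U : bilin (fun (a : k^o) (u : U) => (a : k) *: u).
Proof.
by split=> [u a b c|b a u u'] /=; rewrite ?scalerDl ?scalerDr ?scalerA // mulrC.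
Qed.
Definition lun U : {linear k^o ⊗ U -> U} := tlift (@lun_bilin U).
Definition lunV U : {linear U -> k^o ⊗ U} := mk_lin (@tensr k^o U 1).
Definition run U : {linear U ⊗ k^o -> U} := lun U ∘ swap U k^o.
Definition runV U : {linear U -> U ⊗ k^o} := swap k^o U ∘ lunV U.

Fact point_linear U (u : U) : linear (fun a : k^o => (a : k) *: u).
Proof. by move=> a b c /=; rewrite scalerDl scalerA. Qed.
Definition point U (u : U) : {linear k^o -> U} := mk_lin (point_linear u).

Fact ev_bilin V W : bilin (fun (f : LHom V W) (v : V) => (f : {linear V -> W}) v).
Proof. by split=> [v a f g|f a u u'] //=; exact: (linearP (f : {linear V -> W})). Qed.
Definition ev V W : {linear LHom V W ⊗ V -> W} := tlift (@ev_bilin V W).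

Section Curry.
Variables (U V W : lmodType k) (f : {linear U ⊗ V -> W}).
Fact curry_linear1 u : linear (fun v => f (tens u v)).
Proof. by move=> a v v'; rewrite tensr linearP. Qed.
Definition curry_fun u : LHom V W := mk_lin (curry_linear1 u).
Fact curry_linear : linear curry_fun.
Proof. by move=> a u u'; apply: lin_ext => v; rewrite /= tensl linearP. Qed.
Definition curry : {linear U -> LHom V W} := mk_lin curry_linear.
End Curry.

(* (arot f) is id ⊗ f and (amid f) is id ⊗ f ⊗ id, up to the associativity
   constraints, for f : V ⊗ W -> W' ⊗ V'. *)
Definition arot U V W V' W' (f : {linear V ⊗ W -> W' ⊗ V'}) :
  {linear (U ⊗ V) ⊗ W -> (U ⊗ W') ⊗ V'} :=
  ascV U W' V' ∘ tmap (lid U) f ∘ asc U V W.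
Definition amid U V W X V' W' (f : {linear V ⊗ W -> W' ⊗ V'}) :
  {linear (U ⊗ V) ⊗ (W ⊗ X) -> (U ⊗ W') ⊗ (V' ⊗ X)} :=
  ascV U W' (V' ⊗ X)
  ∘ tmap (lid U) (asc W' V' X ∘ tmap f (lid X) ∘ ascV V W X)
  ∘ asc U V (W ⊗ X).

Definition fin_dim U : Prop :=
  exists n (e : 'I_n -> U), forall u, exists c : 'I_n -> k, u = \sum_i c i *: e i.
Definition nonzero U : Prop := exists u : U, u != 0.
End TensorMaps.

Notation "f ⊠ g" := (tmap f g) (at level 40, left associativity) : tens_scope.

Section Composition.
Variable k : fieldType.
Implicit Types U V W X : lmodType k.

Lemma lcompA U V W X (h : {linear W -> X}) (g : {linear V -> W}) (f : {linear U -> V}) :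
  h ∘ (g ∘ f) = h ∘ g ∘ f.
Proof. exact: lin_ext. Qed.
Lemma lcompK1 U : lid U ∘ lid U = lid U.
Proof. exact: lin_ext. Qed.
Lemma tmap_comp U V W U' V' W' (g : {linear V -> W}) (f : {linear U -> V})
    (g' : {linear V' -> W'}) (f' : {linear U' -> V'}) :
  (g ∘ f) ⊠ (g' ∘ f') = (g ⊠ g') ∘ (f ⊠ f').
Proof. by apply: tensor_lin_ext => u u'; rewrite /= !tliftE. Qed.
End Composition.

Section HopfAlgebra.
Variable k : fieldType.

Fact mulm_bilin (A : algType k) : bilin (fun x y : A => x * y).
Proof.
split=> [y a x x'|x a y y'] /=; first by rewrite mulrDl scalerAl.
by rewrite mulrDr scalerAr.
Qed.
Definition mulm (A : algType k) : {linear A ⊗ A -> A} := tlift (@mulm_bilin A).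

Record hopfAlg := HopfAlg {
  hopf_car :> algType k;
  comul : {linear hopf_car -> hopf_car ⊗ hopf_car};
  counit : {linear hopf_car -> k^o};
  antipode : {linear hopf_car -> hopf_car};
  comulA : (comul ⊠ lid _) ∘ comul = ascV _ _ _ ∘ (lid _ ⊠ comul) ∘ comul;
  comul_counitl : lun _ ∘ (counit ⊠ lid _) ∘ comul = lid _;
  comul_counitr : run _ ∘ (lid _ ⊠ counit) ∘ comul = lid _;
  comulM : comul ∘ mulm hopf_car
    = (mulm hopf_car ⊠ mulm hopf_car) ∘ amid _ _ (swap _ _) ∘ (comul ⊠ comul);
  comul1 : comul 1 = tens 1 1;
  counitM : forall x y : hopf_car, counit (x * y) = counit x * counit y :> k;
  counit1 : counit 1 = 1 :> k;
  antipodel : mulm hopf_car ∘ (antipode ⊠ lid _) ∘ comul = point 1 ∘ counit;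
  antipoder : mulm hopf_car ∘ (lid _ ⊠ antipode) ∘ comul = point 1 ∘ counit
}.
End HopfAlgebra.

Section YetterDrinfeld.
Variables (k : fieldType) (H : hopfAlg k).

(* Structures are given by raw data (a space with structure maps, all of
   them linear) and a separate predicate states the axioms. *)
Record ydata := YData {
  yd_car :> lmodType k;
  yd_act : {linear H ⊗ yd_car -> yd_car};
  yd_coact : {linear yd_car -> H ⊗ yd_car}
}.

Definition is_yd (M : ydata) : Prop :=
  [/\ yd_act M ∘ (mulm H ⊠ lid M) = yd_act M ∘ (lid H ⊠ yd_act M) ∘ asc H H M,
      forall m : M, yd_act M (tens 1 m) = m,
      (comul H ⊠ lid M) ∘ yd_coact M
        = ascV H H M ∘ (lid H ⊠ yd_coact M) ∘ yd_coact M,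
      lun M ∘ (counit H ⊠ lid M) ∘ yd_coact M = lid M
    & (mulm H ⊠ yd_act M) ∘ amid H M (swap H H) ∘ (comul H ⊠ yd_coact M)
        = (mulm H ⊠ lid M) ∘ arot H (swap M H)
          ∘ ((yd_coact M ∘ yd_act M) ⊠ lid H)
          ∘ arot H (swap H M) ∘ (comul H ⊠ lid M)].

Definition yd_mor (M N : ydata) (f : {linear M -> N}) : Prop :=
  f ∘ yd_act M = yd_act N ∘ (lid H ⊠ f) /\ yd_coact N ∘ f = (lid H ⊠ f) ∘ yd_coact M.

Definition yd_unit : ydata :=
  @YData k^o (lun k^o ∘ (counit H ⊠ lid k^o)) ((point 1 ⊠ lid k^o) ∘ lunV k^o).

Definition yd_tens (M N : ydata) : ydata :=
  @YData (M ⊗ N)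
    ((yd_act M ⊠ yd_act N) ∘ amid H N (swap H M) ∘ (comul H ⊠ lid (M ⊗ N)))
    ((mulm H ⊠ lid (M ⊗ N)) ∘ amid H N (swap M H) ∘ (yd_coact M ⊠ yd_coact N)).

(* braid M N is Φ_{M,N}, m ⊗ n |-> n_[0] ⊗ S^-1(n_[-1]) m, and braidV M N is
   its inverse N ⊗ M -> M ⊗ N. *)
Definition braid (M N : ydata) : {linear M ⊗ N -> N ⊗ M} :=
  (lid N ⊠ yd_act M) ∘ asc N H M
  ∘ ((swap H N ∘ (linv (antipode H) ⊠ lid N) ∘ yd_coact N) ⊠ lid M) ∘ swap M N.

Definition braidV (M N : ydata) : {linear N ⊗ M -> M ⊗ N} := linv (braid M N).

(* The internal hom: (h f)(m) = h_1 f(S(h_2) m), and the coaction is the one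
   with f_[-1] ⊗ f_[0](m) = f(m_[0])_[-1] S^-1(m_[-1]) ⊗ f(m_[0])_[0]; it
   exists, and is unique, when M is finite-dimensional. These make
   evaluation a morphism. *)
Definition yd_hom (M N : ydata) : ydata :=
  let E := LHom M N in
  @YData E
    (curry (yd_act N ∘ (lid H ⊠ ev M N) ∘ asc H E M
            ∘ (lid (H ⊗ E) ⊠ (yd_act M ∘ (antipode H ⊠ lid M)))
            ∘ asc (H ⊗ E) H M
            ∘ ((arot H (swap H E) ∘ (comul H ⊠ lid E)) ⊠ lid M)))
    (the_lin (fun lam : {linear E -> H ⊗ E} =>
       (lid H ⊠ ev M N) ∘ asc H E M ∘ (lam ⊠ lid M)
       = ((mulm H ∘ swap H H) ⊠ lid N) ∘ ascV H H N
         ∘ (linv (antipode H) ⊠ (yd_coact N ∘ ev M N)) ∘ asc H E M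
         ∘ (swap E H ⊠ lid M) ∘ ascV E H M ∘ (lid E ⊠ yd_coact M))).

Record calg := CAlg {
  calg_yd :> ydata;
  cmul : {linear calg_yd ⊗ calg_yd -> calg_yd};
  cone : {linear k^o -> calg_yd}
}.

Definition is_calg (A : calg) : Prop :=
  [/\ is_yd A, yd_mor (M := yd_tens A A) (cmul A), yd_mor (M := yd_unit) (cone A),
      cmul A ∘ (cmul A ⊠ lid A) = cmul A ∘ (lid A ⊠ cmul A) ∘ asc A A A
    & cmul A ∘ (cone A ⊠ lid A) = lun A /\ cmul A ∘ (lid A ⊠ cone A) = run A].

Record chopf := CHopf {
  chopf_alg :> calg;
  ccomul : {linear chopf_alg -> chopf_alg ⊗ chopf_alg};
  ccounit : {linear chopf_alg -> k^o};
  cS : {linear chopf_alg -> chopf_alg}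
}.

Definition is_ccoalg (B : chopf) : Prop :=
  [/\ yd_mor (N := yd_tens B B) (ccomul B), yd_mor (N := yd_unit) (ccounit B),
      (ccomul B ⊠ lid B) ∘ ccomul B = ascV B B B ∘ (lid B ⊠ ccomul B) ∘ ccomul B,
      lun B ∘ (ccounit B ⊠ lid B) ∘ ccomul B = lid B
    & run B ∘ (lid B ⊠ ccounit B) ∘ ccomul B = lid B].

Definition is_cbialg (B : chopf) : Prop :=
  [/\ ccomul B ∘ cmul B
        = (cmul B ⊠ cmul B) ∘ amid B B (braid B B) ∘ (ccomul B ⊠ ccomul B),
      ccomul B ∘ cone B = (cone B ⊠ cone B) ∘ lunV k^o,
      ccounit B ∘ cmul B = lun k^o ∘ (ccounit B ⊠ ccounit B)
    & ccounit B ∘ cone B = lid k^o].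

Definition is_chopf (B : chopf) : Prop :=
  [/\ is_calg B, is_ccoalg B, is_cbialg B, yd_mor (cS B)
    & cmul B ∘ (cS B ⊠ lid B) ∘ ccomul B = cone B ∘ ccounit B /\
      cmul B ∘ (lid B ⊠ cS B) ∘ ccomul B = cone B ∘ ccounit B].

Definition ccommutative (B : chopf) : Prop := cmul B ∘ braid B B = cmul B.
Definition ccocommutative (B : chopf) : Prop := braid B B ∘ ccomul B = ccomul B.

(* The dual Hopf algebra: its multiplication and comultiplication are the
   transposes of ccomul and cmul for the nested pairing
   (f ⊗ g, x ⊗ y) |-> f(y) g(x). *)
Definition nested_ev (B : ydata) :
  {linear (yd_hom B yd_unit ⊗ yd_hom B yd_unit) ⊗ (B ⊗ B) -> k^o} :=
  let D := yd_hom B yd_unit in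
  ev B k^o ∘ (lid D ⊠ (lun B ∘ (ev B k^o ⊠ lid B) ∘ ascV D B B)) ∘ asc D D (B ⊗ B).

Definition cdual (B : chopf) : chopf :=
  let D := yd_hom B yd_unit in
  @CHopf
    (@CAlg D (curry (nested_ev B ∘ (lid (D ⊗ D) ⊠ ccomul B)))
             (curry (lun k^o ∘ (lid k^o ⊠ ccounit B))))
    (the_lin (fun d : {linear D -> D ⊗ D} =>
       nested_ev B ∘ (d ⊠ lid (B ⊗ B)) = ev B k^o ∘ (lid D ⊠ cmul B)))
    (ev B k^o ∘ (lid D ⊠ cone B) ∘ runV D)
    (curry (ev B k^o ∘ (lid D ⊠ cS B))).

Definition grouplike (X : chopf) (g : {linear k^o -> X}) : Prop :=
  [/\ yd_mor (M := yd_unit) g, ccomul X ∘ g = (g ⊠ g) ∘ lunV k^o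
    & ccounit X ∘ g = lid k^o].

(* The center is an object of the category only, not a coalgebra: a coalgebra
   morphism from the unit object to it is a morphism g' such that i ∘ g' is
   group-like. *)
Inductive side := LeftSide | RightSide.

Definition centralizes (s : side) (A : calg) (Z : ydata) (i : {linear Z -> A}) : Prop :=
  match s with
  | RightSide => cmul A ∘ (i ⊠ lid A) = cmul A ∘ braid A A ∘ (i ⊠ lid A)
  | LeftSide => cmul A ∘ (lid A ⊠ i) = cmul A ∘ braid A A ∘ (lid A ⊠ i)
  end.

Definition is_center (s : side) (A : calg) (Z : ydata) (i : {linear Z -> A}) : Prop :=
  [/\ is_yd Z, yd_mor i, centralizes s i
    & forall (W : ydata) (j : {linear W -> A}),
        is_yd W -> yd_mor j -> centralizes s j ->
        exists! l : {linear W -> Z}, yd_mor l /\ j = i ∘ l].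

Definition grouplikes_in_center (s : side) (X : chopf) : Prop :=
  exists (Z : ydata) (i : {linear Z -> X}), is_center s i /\
    forall g : {linear k^o -> X}, grouplike g ->
      exists2 g' : {linear k^o -> Z}, yd_mor (M := yd_unit) g' & g = i ∘ g'.
End YetterDrinfeld.

Section YetterDrinfeldOverB.
Variables (k : fieldType) (H : hopfAlg k) (B : chopf H).
Local Notation ydata := (ydata H).
(* The inverse of the antipode, which is bijective when B is finite-dimensional. *)
Local Notation SV := (linv (cS B)).

Record bdata := BData {
  bd_yd :> ydata;
  bact : {linear B ⊗ bd_yd -> bd_yd};
  bcoact : {linear bd_yd -> B ⊗ bd_yd}
}.

Definition is_byd (M : bdata) : Prop :=
  [/\ is_yd M,
      yd_mor (M := yd_tens B M) (bact M) /\ yd_mor (N := yd_tens B M) (bcoact M),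
      bact M ∘ (cmul B ⊠ lid M) = bact M ∘ (lid B ⊠ bact M) ∘ asc B B M
        /\ bact M ∘ (cone B ⊠ lid M) = lun M,
      (ccomul B ⊠ lid M) ∘ bcoact M = ascV B B M ∘ (lid B ⊠ bcoact M) ∘ bcoact M
        /\ lun M ∘ (ccounit B ⊠ lid M) ∘ bcoact M = lid M
    & (cmul B ⊠ lid M) ∘ arot B (braid M B) ∘ ((bcoact M ∘ bact M) ⊠ lid B)
        ∘ arot B (braid B M) ∘ (ccomul B ⊠ lid M)
      = (cmul B ⊠ bact M) ∘ amid B M (braid B B) ∘ (ccomul B ⊠ bcoact M)].

Definition byd_mor (M N : bdata) (f : {linear M -> N}) : Prop :=
  [/\ yd_mor f, f ∘ bact M = bact N ∘ (lid B ⊠ f)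
    & bcoact N ∘ f = (lid B ⊠ f) ∘ bcoact M].

Definition byd_unit : bdata :=
  @BData (yd_unit H) (lun k^o ∘ (ccounit B ⊠ lid k^o)) ((cone B ⊠ lid k^o) ∘ lunV k^o).

Definition byd_tens (M N : bdata) : bdata :=
  @BData (yd_tens M N)
    ((bact M ⊠ bact N) ∘ amid B N (braid B M) ∘ (ccomul B ⊠ lid (M ⊗ N)))
    ((cmul B ⊠ lid (M ⊗ N)) ∘ amid B N (braid M B) ∘ (bcoact M ⊠ bcoact N)).

(* Ψ_{M,N} *)
Definition byd_braid (M N : bdata) : {linear M ⊗ N -> N ⊗ M} :=
  (lid N ⊠ bact M) ∘ asc N B M ∘ (braidV N B ⊠ lid M)
  ∘ ((SV ⊠ lid N) ⊠ lid M) ∘ (bcoact N ⊠ lid M) ∘ braidV N M.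

Record balg := BAlg {
  balg_bd :> bdata;
  bmul : {linear balg_bd ⊗ balg_bd -> balg_bd};
  bone : {linear k^o -> balg_bd}
}.

Definition is_balg (A : balg) : Prop :=
  [/\ is_byd A, byd_mor (M := byd_tens A A) (bmul A),
      byd_mor (M := byd_unit) (bone A),
      bmul A ∘ (bmul A ⊠ lid A) = bmul A ∘ (lid A ⊠ bmul A) ∘ asc A A A
    & bmul A ∘ (bone A ⊠ lid A) = lun A /\ bmul A ∘ (lid A ⊠ bone A) = run A].

Definition balg_iso (A A' : balg) : Prop :=
  exists f : {linear A -> A'},
    [/\ bijective f, byd_mor f, f ∘ bmul A = bmul A' ∘ (f ⊠ f) & f ∘ bone A = bone A'].

Definition balg_tens (A A' : balg) : balg :=
  @BAlg (byd_tens A A')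
    ((bmul A ⊠ bmul A') ∘ amid A A' (byd_braid A' A))
    ((bone A ⊠ bone A') ∘ lunV k^o).

Definition balg_opp (A : balg) : balg :=
  @BAlg A (bmul A ∘ byd_braid A A) (bone A).

(* End(M), also for M carrying a B-action and a B-coaction that are not
   compatible. The coaction is the linear map with the prescribed pairing
   with ev, which is unique, and exists when M is finite-dimensional. *)
Definition endo_mul (M : ydata) : {linear yd_hom M M ⊗ yd_hom M M -> yd_hom M M} :=
  let E := yd_hom M M in curry (ev M M ∘ (lid E ⊠ ev M M) ∘ asc E E M).

Definition balg_end (M : bdata) : balg :=
  let E := yd_hom M M in
  let theta : {linear B -> E} := curry (bact M) in
  @BAlg
    (@BData E
      (endo_mul M ∘ (endo_mul M ⊠ lid E) ∘ ((theta ⊠ lid E) ⊠ theta)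
       ∘ arot B (braid B E) ∘ ((lid B ⊠ cS B) ⊠ lid E) ∘ (ccomul B ⊠ lid E))
      (the_lin (fun lam : {linear E -> B ⊗ E} =>
         (lid B ⊠ ev M M) ∘ asc B E M ∘ (lam ⊠ lid M)
         = ((cmul B ∘ braid B B) ⊠ lid M) ∘ ascV B B M
           ∘ (lid B ⊠ (bcoact M ∘ ev M M)) ∘ asc B E M
           ∘ ((SV ⊠ lid E) ⊠ lid M) ∘ (braid E B ⊠ lid M)
           ∘ ascV E B M ∘ (lid E ⊠ bcoact M))))
    (endo_mul M) (curry (lun M)).

(* a ⊗ b |-> (c |-> a Ψ(b ⊗ c)) and a ⊗ b |-> (c |-> Ψ(c ⊗ a) b), products in A *)
Definition azumayaF (A : balg) : {linear A ⊗ A -> LHom A A} :=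
  curry (bmul A ∘ (lid A ⊠ (bmul A ∘ byd_braid A A)) ∘ asc A A A).
Definition azumayaG (A : balg) : {linear A ⊗ A -> LHom A A} :=
  curry (bmul A ∘ ((bmul A ∘ byd_braid A A) ⊠ lid A)
         ∘ ascV A A A ∘ swap (A ⊗ A) A).

(* The isomorphism conditions amount to bijectivity. In azumayaG the argument c
   is moved by the plain flip, as in the formula above. *)
Definition azumaya (A : balg) : Prop :=
  [/\ is_balg A, fin_dim A, nonzero A, bijective (azumayaF A) & bijective (azumayaG A)].

Definition brauer_equiv (A A' : balg) : Prop :=
  exists M N : bdata,
    [/\ [/\ is_byd M, fin_dim M & nonzero M], [/\ is_byd N, fin_dim N & nonzero N]
      & balg_iso (balg_tens A (balg_end M)) (balg_tens A' (balg_end N))].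

Definition brauer_class (A : balg) : balg -> Prop :=
  fun A' => azumaya A' /\ brauer_equiv A A'.

Definition BQ : Type :=
  {X : balg -> Prop | exists2 A, azumaya A & X = brauer_class A}.

Fact BQ_class_proof (A : balg) :
  azumaya A -> exists2 A', azumaya A' & brauer_class A = brauer_class A'.
Proof. by exists A. Qed.
Definition BQ_class (A : balg) (hA : azumaya A) : BQ :=
  exist _ (brauer_class A) (BQ_class_proof hA).

(* Z is the product of X and Y, i.e. the class of A ⊗ A' for representatives A
   of X and A' of Y. *)
Definition BQ_prod (X Y Z : BQ) : Prop :=
  exists A A' : balg, [/\ sval X A, sval Y A' & sval Z (balg_tens A A')].

(* When B is commutative and cocommutative the modules above are the
   B-dimodules, and BQ is the Brauer-Long group. *)
Definition BD (_ : ccommutative B) (_ : ccocommutative B) : Type := BQ.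

Record hopf_aut := HopfAut {
  aut_fun :> {linear B -> B};
  aut_bij : bijective aut_fun;
  aut_mor : yd_mor aut_fun;
  aut_mul : aut_fun ∘ cmul B = cmul B ∘ (aut_fun ⊠ aut_fun);
  aut_one : aut_fun ∘ cone B = cone B;
  aut_comul : ccomul B ∘ aut_fun = (aut_fun ⊠ aut_fun) ∘ ccomul B;
  aut_counit : ccounit B ∘ aut_fun = ccounit B
}.

Fact aut_comp_bij (f g : hopf_aut) : bijective (f ∘ g).
Proof. exact: bij_comp (aut_bij f) (aut_bij g). Qed.

Fact aut_comp_mor (f g : hopf_aut) : yd_mor (f ∘ g).
Proof.
case: (aut_mor f) (aut_mor g) => fa fc [ga gc].
split; first by rewrite -lcompA ga lcompA fa -lcompA -tmap_comp lcompK1.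
by rewrite lcompA fc -lcompA gc lcompA -tmap_comp lcompK1.
Qed.

Fact aut_comp_mul (f g : hopf_aut) :
  f ∘ g ∘ cmul B = cmul B ∘ ((f ∘ g) ⊠ (f ∘ g)).
Proof. by rewrite tmap_comp -lcompA aut_mul !lcompA aut_mul. Qed.

Fact aut_comp_one (f g : hopf_aut) : f ∘ g ∘ cone B = cone B.
Proof. by rewrite -lcompA !aut_one. Qed.

Fact aut_comp_comul (f g : hopf_aut) :
  ccomul B ∘ (f ∘ g) = ((f ∘ g) ⊠ (f ∘ g)) ∘ ccomul B.
Proof. by rewrite tmap_comp lcompA aut_comul -!lcompA aut_comul. Qed.

Fact aut_comp_counit (f g : hopf_aut) : ccounit B ∘ (f ∘ g) = ccounit B.
Proof. by rewrite lcompA !aut_counit. Qed.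

Definition aut_comp (f g : hopf_aut) : hopf_aut :=
  HopfAut (aut_comp_bij f g) (aut_comp_mor f g) (aut_comp_mul f g)
    (aut_comp_one f g) (aut_comp_comul f g) (aut_comp_counit f g).

(* The object B_alpha. *)
Definition b_twist (alpha : {linear B -> B}) : bdata :=
  @BData B
    (cmul B ∘ braid B B ∘ (SV ⊠ (cmul B ∘ (alpha ⊠ lid B))) ∘ asc B B B
     ∘ (ccomul B ⊠ lid B))
    ((cS B ⊠ lid B) ∘ braidV B B ∘ ccomul B).
End YetterDrinfeldOverB.

(* Main.v *)
Require Import Defs.
From mathcomp Require Import all_boot all_order all_algebra.
From mathcomp Require Import boolp.
Set Implicit Arguments. Unset Strict Implicit. Unset Printing Implicit Defensive.
Import GRing.Theory.
Local Open Scope ring_scope.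
Local Open Scope tens_scope.

(* Applying the symmetry hypothesis to two Yetter-Drinfeld structures on H shows
   that B has trivial action and coaction, so B is an ordinary finite-dimensional
   Hopf algebra, and its braidings are flips. The algebra End(M) of a B-module
   and comodule M carries the inner action f |-> th(b_1) f th(S b_2) and the inner
   coaction f |-> U (1 ⊗ f) U^-1, where th : B -> End(M) and U in B ⊗ End(M) are
   the structures of M; for M = B_alpha the pair (th, U) satisfies the
   Yetter-Drinfeld condition twisted by alpha.

   For such inner structures the maps F and G differ from a ⊗ b |-> (c |-> a c b)
   by bijections, which gives the Azumaya property, and the braided tensor product
   of algebras with twists alpha and beta is isomorphic to the plain one, with the
   inner structures of a pair with twist beta alpha. Two pairs on the same matrix
   algebra with the same inner structures differ by a character and a group-like
   element of B; as these are central, the twists agree. Hence the class of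
   End(B_alpha) determines alpha.

   When B is commutative and cocommutative, x ⊗ y |-> x y_1 ⊗ y_2 identifies
   B_alpha ⊗ B_beta with B_(beta alpha) ⊗ N for a module N with untwisted
   structures, so that Pi is multiplicative. *)

(** * Sweedler notation *)

(** The objects M, N that witness a Brauer equivalence are arbitrary: H need not act or coact
    trivially on them. A braiding with B is nevertheless a flip, because the triviality of B leaves
    only the unit and counit laws of M in it.

    A Yetter-Drinfel'd module over B has the identity as its twist, so tensoring E_alpha with End(M)
    leaves alpha unchanged. On one matrix algebra, th' = th * chi (convolution) and U' = U (g ⊗ 1)
    turn the two twisted conditions into chi(b_1) g alpha(b_2) = beta(b_1) g chi(b_2), an identity
    in B alone, from which centrality removes g and chi.

    The bijections behind F and G rest on an analogue of the Drinfel'd element, with U as R-matrix,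
    whose inverse involves alpha^-1. The antipode of B is inverted by means of an integral, obtained
    as a trace over dual bases. The inverse in Pi(alpha) compensates for the reversed order beta
    alpha of the twists in a product. *)

Section Sweedler.
Variable k : fieldType.
Implicit Types U V W X : lmodType k.

(** A sum over the chosen representative of [t], defined for any [F]. It depends on the
    representative unless [F] is bilinear, which is why the lemmas that rewrite [t] itself ask for
    bilinearity. *)
Definition sw U V W (t : U ⊗ V) (F : U -> V -> W) : W := bsum_tens F t.

Lemma sw_tens U V W (F : U -> V -> W) u v : bilin F -> sw (tens u v) F = F u v.
Proof. by move=> hF; rewrite /sw bsum_tensE // /bsum big_seq1. Qed.

Lemma lin_swl U V W X (F : U -> V -> W) (t : X -> U ⊗ V) :
  bilin F -> linear t -> linear (fun x => sw (t x) F).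
Proof. by move=> hF ht a x y; rewrite ht; exact: (bsum_tens_linear hF). Qed.

Lemma lin_swr U V W X (F : X -> U -> V -> W) (t : U ⊗ V) :
  (forall u v, linear (fun x => F x u v)) -> linear (fun x => sw t (F x)).
Proof.
move=> hF a x y; rewrite /sw /bsum_tens /bsum scaler_sumr -big_split /=.
by apply: eq_bigr => p _; exact: hF.
Qed.

Lemma sw_lin U V W X (f : {linear W -> X}) (t : U ⊗ V) (F : U -> V -> W) :
  f (sw t F) = sw t (fun u v => f (F u v)).
Proof. exact: linear_sum. Qed.

Lemma sw_linear U V W X (f : W -> X) (t : U ⊗ V) (F : U -> V -> W) :
  linear f -> f (sw t F) = sw t (fun u v => f (F u v)).
Proof. by move=> hf; exact: (sw_lin (mk_lin hf)). Qed.

Arguments sw_linear [U V W X] f [t F].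

Lemma eq_sw U V W (t : U ⊗ V) (F G : U -> V -> W) :
  (forall u v, F u v = G u v) -> sw t F = sw t G.
Proof. by move=> FG; apply: eq_bigr => p _; exact: FG. Qed.

Lemma sw_id U V (t : U ⊗ V) : sw t (fun u v => tens u v) = t.
Proof. by rewrite -[RHS]tens_classK -bsumE. Qed.

Lemma lin_sw U V W (f : {linear U ⊗ V -> W}) t : f t = sw t (fun u v => f (tens u v)).
Proof. by rewrite -sw_lin sw_id. Qed.

Lemma sw_sw U V U' V' W (t : U ⊗ V) (T : U -> V -> U' ⊗ V') (F : U' -> V' -> W) :
  bilin F -> sw (sw t T) F = sw t (fun u v => sw (T u v) F).
Proof. by move=> hF; rewrite (sw_linear (fun s => sw s F)) //; apply: lin_swl. Qed.

Lemma sw_exch U V U' V' W (t : U ⊗ V) (s : U' ⊗ V') (F : U -> V -> U' -> V' -> W) :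
  sw t (fun u v => sw s (fun x y => F u v x y)) = sw s (fun x y => sw t (fun u v => F u v x y)).
Proof. exact: exchange_big. Qed.

Lemma sw_tmap U V U' V' W (f : {linear U -> U'}) (g : {linear V -> V'}) t (F : U' -> V' -> W) :
  bilin F -> sw (tmap f g t) F = sw t (fun u v => F (f u) (g v)).
Proof.
move=> hF; rewrite lin_sw sw_sw //; apply: eq_sw => u v.
by rewrite tliftE sw_tens.
Qed.

Lemma swD U V W (t : U ⊗ V) (F G : U -> V -> W) :
  sw t F + sw t G = sw t (fun u v => F u v + G u v).
Proof. by rewrite /sw /bsum_tens /bsum big_split. Qed.

Lemma swZ U V W (t : U ⊗ V) (F : U -> V -> W) a :
  a *: sw t F = sw t (fun u v => a *: F u v).
Proof. by rewrite /sw /bsum_tens /bsum scaler_sumr. Qed.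

Lemma tens_lin_ext U V W (f g : U ⊗ V -> W) :
  linear f -> linear g -> (forall u v, f (tens u v) = g (tens u v)) -> f =1 g.
Proof.
move=> hf hg fg t; rewrite -(sw_id t) (sw_linear _ hf) (sw_linear _ hg).
exact: eq_sw.
Qed.

Lemma linZ U V (f : U -> V) a u : linear f -> f (a *: u) = a *: f u.
Proof. by move=> hf; exact: (linearZZ (mk_lin hf)). Qed.
Lemma lin0 U V (f : U -> V) : linear f -> f 0 = 0.
Proof. by move=> hf; exact: (linear0 (mk_lin hf)). Qed.
Lemma linsum U V (f : U -> V) n (F : 'I_n -> U) :
  linear f -> f (\sum_i F i) = \sum_i f (F i).
Proof. by move=> hf; exact: (linear_sum (mk_lin hf)). Qed.

Lemma lin_id U : linear (fun u : U => u). Proof. by []. Qed.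
Lemma lin_lf U V X (g : {linear U -> V}) (f : X -> U) :
  linear f -> linear (fun x => g (f x)).
Proof. by move=> hf a x y; rewrite hf linearP. Qed.
Lemma lin_comp U V X (g : U -> V) (f : X -> U) :
  linear g -> linear f -> linear (fun x => g (f x)).
Proof. by move=> hg hf a x y; rewrite hf hg. Qed.
Lemma lin_opl U V W X (op : U -> V -> W) (f : X -> U) v :
  bilin op -> linear f -> linear (fun x => op (f x) v).
Proof. by case=> h _ hf a x y; rewrite hf; exact: h. Qed.
Lemma lin_opr U V W X (op : U -> V -> W) (f : X -> V) u :
  bilin op -> linear f -> linear (fun x => op u (f x)).
Proof. by case=> _ h hf a x y; rewrite hf; exact: h. Qed.
Lemma lin_scalel U X (f : X -> k^o) (v : U) :
  linear f -> linear (fun x => (f x : k) *: v).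
Proof. by move=> hf a x y; rewrite hf scalerDl scalerA. Qed.
Lemma lin_scaler U X (f : X -> U) (c : k) :
  linear f -> linear (fun x => c *: f x).
Proof. by move=> hf a x y; rewrite hf scalerDr !scalerA mulrC. Qed.
Lemma lin_app U V X (f : X -> LHom U V) (v : U) :
  linear f -> linear (fun x => (f x : {linear U -> V}) v).
Proof. by move=> hf a x y; rewrite hf. Qed.

Definition trilin U V X W (F : U -> V -> X -> W) : Prop :=
  [/\ forall v x, linear (fun u => F u v x), forall u x, linear (fun v => F u v x)
    & forall u v, linear (F u v)].

Lemma lin_tri1 U V X W (Y : lmodType k) (F : U -> V -> X -> W) (f : Y -> U) b c :
  trilin F -> linear f -> linear (fun y => F (f y) b c).
Proof. by case=> h _ _ hf a x y; rewrite hf; exact: h. Qed.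
Lemma lin_tri2 U V X W (Y : lmodType k) (F : U -> V -> X -> W) (f : Y -> V) a c :
  trilin F -> linear f -> linear (fun y => F a (f y) c).
Proof. by case=> _ h _ hf l x y; rewrite hf; exact: h. Qed.
Lemma lin_tri3 U V X W (Y : lmodType k) (F : U -> V -> X -> W) (f : Y -> X) a b :
  trilin F -> linear f -> linear (fun y => F a b (f y)).
Proof. by case=> _ _ h hf l x y; rewrite hf; exact: h. Qed.

End Sweedler.
Arguments sw_linear [k U V W X] f [t F].
Arguments linZ [k U V] f [a u].
Arguments linsum [k U V] f [n F].

Notation "\∑ ( a , b <- t ) E" := (sw t (fun a b => E))
  (at level 41, a name, b name, E at level 41, right associativity,
   format "'[' \∑ ( a ,  b  <-  t ) '/  '  E ']'").

Section PlainAlgebra.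
Variable k : fieldType.

(** The product is data on a fixed space rather than a canonical structure: spaces of endomorphisms,
    tensor products and carriers of objects of the category all receive products here, and
    [via_azumaya] pulls one back to a carrier. *)
Record palg (V : lmodType k) := PAlg {
  pmul : V -> V -> V;
  pone : V;
  pmul_bilin : bilin pmul;
  pmulA : associative pmul;
  pmul1l : left_id pone pmul;
  pmul1r : right_id pone pmul
}.
End PlainAlgebra.

(* The variable must occur exactly once in the expression. *)
Ltac mlin :=
  cbv beta;
  lazymatch goal with
  | |- bilin _ => apply: conj => ?; mlin
  | |- trilin _ => apply: And3 => ? ?; mlin
  | |- forall _, _ => move=> ?; mlin
  | |- linear (fun x => x) => exact (@lin_id _ _)
  | |- linear (fun x => @sw _ _ _ _ (@?t x) (@?F x)) =>
      lazymatch F with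
      | fun _ => ?F' => refine (@lin_swl _ _ _ _ _ F' t _ _); mlin
      | _ => lazymatch t with fun _ => ?t' => refine (@lin_swr _ _ _ _ _ F t' _); mlin end
      end
  | h : trilin ?F |- linear (fun x => ?F (@?f x) (@?g x) (@?l x)) =>
      lazymatch g with
      | fun _ => ?b =>
        lazymatch l with
        | fun _ => ?c => refine (@lin_tri1 _ _ _ _ _ _ F f b c h _)
        | _ => lazymatch f with fun _ => ?a => refine (@lin_tri3 _ _ _ _ _ _ F l a b h _) end
        end
      | _ => lazymatch f with fun _ => ?a =>
          lazymatch l with fun _ => ?c => refine (@lin_tri2 _ _ _ _ _ _ F g a c h _) end end
      end; mlin
  | |- linear (fun x => (@?f x) *: (@?g x)) =>
      lazymatch f with
      | fun _ => ?c => refine (@lin_scaler _ _ _ g c _); mlin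
      | _ => lazymatch g with fun _ => ?v => refine (@lin_scalel _ _ _ f v _); mlin end
      end
  | |- linear (fun x => GRing.Linear.sort (@?g x) (@?f x)) =>
      lazymatch g with
      | fun _ => ?h => refine (@lin_lf _ _ _ _ h f _); mlin
      | _ => lazymatch f with fun _ => ?v => refine (@lin_app _ _ _ _ g v _); mlin end
      end
  | |- linear (fun x => ?op (@?f x) (@?g x)) =>
      first [
        let h := lazymatch op with
          | @tens ?k ?U ?V => constr:(@tens_bilin k U V)
          | pmul ?A => constr:(pmul_bilin A)
          | _ => constr:(ltac:(solve [eauto 2 with nocore]) : bilin op)
          end in
        lazymatch g with
        | fun _ => ?v => refine (@lin_opl _ _ _ _ _ op f v h _)
        | _ => lazymatch f with fun _ => ?u => refine (@lin_opr _ _ _ _ _ op g u h _) end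
        end
      | lazymatch f with
        | fun _ => ?u =>
            let h := constr:(ltac:(solve [eauto 2 with nocore]) : linear (op u)) in
            refine (@lin_comp _ _ _ _ (op u) g h _)
        end ]; mlin
  | |- linear (fun x => ?g (@?f x)) =>
      let h := constr:(ltac:(solve [eauto 2 with nocore]) : linear g) in refine (@lin_comp _ _ _ _ g f h _); mlin
  | |- linear (fun x => ?f x) => exact (linearP f) || assumption
  | |- linear (?op ?u) =>
      first [exact (linearP _) | assumption | change (linear (fun x => op u x)); mlin]
  | |- linear ?f => exact (linearP f) || assumption
  end.

#[export] Hint Extern 0 (linear _) => solve [mlin] : core.
#[export] Hint Extern 0 (bilin _) => solve [mlin] : core.
#[export] Hint Extern 0 (trilin _) => solve [mlin] : core.

(** * Hopf algebras *)

Section TensorAlgebra.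
Variables (k : fieldType) (V W : lmodType k) (A : palg V) (B : palg W).

Definition tpmul (s t : V ⊗ W) : V ⊗ W :=
  \∑(a, b <- s) \∑(c, d <- t) tens (pmul A a c) (pmul B b d).
Lemma tpmul_bilin : bilin tpmul. Proof. rewrite /tpmul; mlin. Qed.
Lemma tpmulE a b c d : tpmul (tens a b) (tens c d) = tens (pmul A a c) (pmul B b d).
Proof. rewrite /tpmul !sw_tens //. Qed.

Lemma tpmulA : associative tpmul.
Proof.
have h := tpmul_bilin => s t u.
apply: (tens_lin_ext (f := fun s => tpmul s (tpmul t u))
                     (g := fun s => tpmul (tpmul s t) u)); [mlin|mlin|move=> a b].
apply: (tens_lin_ext (f := fun t => tpmul (tens a b) (tpmul t u))
                     (g := fun t => tpmul (tpmul (tens a b) t) u)); [mlin|mlin|move=> c d].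
apply: (tens_lin_ext (f := fun u => tpmul (tens a b) (tpmul (tens c d) u))
                     (g := fun u => tpmul (tpmul (tens a b) (tens c d)) u)); [mlin|mlin|move=> x y].
by rewrite !tpmulE !pmulA.
Qed.
Lemma tpmul1l : left_id (tens (pone A) (pone B)) tpmul.
Proof.
have h := tpmul_bilin.
by apply: tens_lin_ext; [mlin|mlin|move=> x y]; rewrite tpmulE !pmul1l.
Qed.
Lemma tpmul1r : right_id (tens (pone A) (pone B)) tpmul.
Proof.
have h := tpmul_bilin.
by apply: tens_lin_ext; [mlin|mlin|move=> x y]; rewrite tpmulE !pmul1r.
Qed.
Definition tpalg : palg (V ⊗ W) := PAlg tpmul_bilin tpmulA tpmul1l tpmul1r.
End TensorAlgebra.

Section Hopf.
Variable k : fieldType.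

(** Sweedler form of an ordinary Hopf algebra. Its instances are H ([Hphopf]) and, once the
    structures over H are known to be trivial, B ([hopf_of_exists]). *)
Record phopf (V : lmodType k) := PHopf {
  ph_alg :> palg V;
  pD : {linear V -> V ⊗ V};
  pe : {linear V -> k^o};
  pS : {linear V -> V};
  pD_coassoc : forall x, (pD ⊠ lid V) (pD x) = ascV V V V ((lid V ⊠ pD) (pD x));
  pD_counl : forall x, \∑(a, b <- pD x) (pe a : k) *: b = x;
  pD_counr : forall x, \∑(a, b <- pD x) (pe b : k) *: a = x;
  pDM : forall x y, pD (pmul ph_alg x y) =
    \∑(a, b <- pD x) \∑(c, d <- pD y) tens (pmul ph_alg a c) (pmul ph_alg b d);
  pD1 : pD (pone ph_alg) = tens (pone ph_alg) (pone ph_alg);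
  peM : forall x y, pe (pmul ph_alg x y) = (pe x : k) * (pe y : k) :> k;
  pe1 : pe (pone ph_alg) = 1 :> k;
  pSl : forall x, \∑(a, b <- pD x) pmul ph_alg (pS a) b = (pe x : k) *: pone ph_alg;
  pSr : forall x, \∑(a, b <- pD x) pmul ph_alg a (pS b) = (pe x : k) *: pone ph_alg
}.

Variables (V : lmodType k) (h : phopf V).
Implicit Types W : lmodType k.
Local Notation Δ := (pD h).
Local Notation ε := (pe h).
Local Notation S := (pS h).
Local Notation "x ∙ y" := (pmul h x y) (at level 39, left associativity).
Local Notation e1 := (pone h).

Lemma coassoc W (F : V -> V -> V -> W) x : trilin F ->
  \∑(a, b <- Δ x) \∑(c, d <- Δ a) F c d b = \∑(a, b <- Δ x) \∑(c, d <- Δ b) F a c d.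
Proof.
case=> F1 F2 F3.
have h12 c : bilin (fun a b => F a b c) by split=> ?.
have hT : bilin (fun (s : V ⊗ V) b => \∑(c, d <- s) F c d b).
  by split=> [v|u]; [apply: lin_swl | apply: lin_swr => ? ?].
transitivity (sw ((Δ ⊠ lid V) (Δ x)) (fun s b => \∑(c, d <- s) F c d b)).
  by rewrite sw_tmap.
rewrite pD_coassoc [(_ ⊠ _) _]lin_sw [ascV _ _ _ _]sw_lin sw_sw //.
apply: eq_sw => a b; rewrite tliftE /=.
rewrite [ascV _ _ _ _]tliftE [tlift _ _]lin_sw sw_sw //.
apply: eq_sw => c d; rewrite tliftE sw_tens // sw_tens //.
Qed.

Lemma counl W (f : V -> W) x : linear f -> \∑(a, b <- Δ x) (ε a : k) *: f b = f x.
Proof.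
move=> hf; rewrite -[in RHS](pD_counl h x) (sw_linear _ hf); apply: eq_sw => a b.
by rewrite linZ.
Qed.
Lemma counr W (f : V -> W) x : linear f -> \∑(a, b <- Δ x) (ε b : k) *: f a = f x.
Proof.
move=> hf; rewrite -[in RHS](pD_counr h x) (sw_linear _ hf); apply: eq_sw => a b.
by rewrite linZ.
Qed.
Lemma antl W (f : V -> W) x : linear f ->
  \∑(a, b <- Δ x) f (S a ∙ b) = (ε x : k) *: f e1.
Proof.
by move=> hf; rewrite -(sw_linear _ hf) pSl linZ.
Qed.
Lemma antr W (f : V -> W) x : linear f ->
  \∑(a, b <- Δ x) f (a ∙ S b) = (ε x : k) *: f e1.
Proof.
by move=> hf; rewrite -(sw_linear _ hf) pSr linZ.
Qed.
Lemma comul_pmul W (F : V -> V -> W) x y : bilin F ->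
  \∑(a, b <- Δ (x ∙ y)) F a b = \∑(a, b <- Δ x) \∑(c, d <- Δ y) F (a ∙ c) (b ∙ d).
Proof.
move=> hF; rewrite pDM sw_sw //; apply: eq_sw => a b; rewrite sw_sw //.
by apply: eq_sw => c d; rewrite sw_tens.
Qed.

(** In the convolution algebra of maps V -> W, a left inverse [f] and a right inverse [g] of [p]
    both equal f * p * g. *)
Lemma conv_uniq W (A : palg W) (f g p : V -> W) : linear f -> linear g -> linear p ->
  (forall x, \∑(a, b <- Δ x) pmul A (f a) (p b) = (ε x : k) *: pone A) ->
  (forall x, \∑(a, b <- Δ x) pmul A (p a) (g b) = (ε x : k) *: pone A) -> f =1 g.
Proof.
move=> hf hg hp fp pg x.
transitivity (\∑(a, b <- Δ x) \∑(c, d <- Δ b) pmul A (f a) (pmul A (p c) (g d))).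
  rewrite -[LHS](counr x (f := f)) //; apply: eq_sw => a b.
  rewrite -(sw_linear (pmul A (f a))) // pg (linZ (pmul A _)) ?pmul1r //.
rewrite -(coassoc (F := fun a c d => pmul A (f a) (pmul A (p c) (g d)))) //.
rewrite -[RHS](counl x (f := g)) //; apply: eq_sw => a b.
under eq_sw => c d do rewrite pmulA.
rewrite -(sw_linear (fun y => pmul A y (g b))) // fp (linZ (fun y => pmul A y _)) ?pmul1l //.
Qed.

Lemma antip1 : S e1 = e1.
Proof.
have := pSl h e1; rewrite pD1 sw_tens //.
by rewrite pmul1r pe1 scale1r.
Qed.

Lemma eps_antip x : ε (S x) = ε x.
Proof.
have hl : forall x, ε (S x) = \∑(a, b <- Δ x) (ε b : k) *: ε (S a).
  by move=> y; rewrite counr.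
have := congr1 ε (pSl h x); rewrite sw_lin linearZ /= pe1 [RHS]mulr1 => <-.
by rewrite hl; apply: eq_sw => a b; rewrite peM mulrC.
Qed.

(* S(xy) = S(x1 y1) x2 y2 S(y3) S(x3) = S(y) S(x) *)
Lemma antipM x y : S (x ∙ y) = S y ∙ S x.
Proof.
transitivity (\∑(a, b <- Δ x) \∑(a1, a2 <- Δ a) \∑(c, d <- Δ y) \∑(c1, c2 <- Δ c)
                S (a1 ∙ c1) ∙ (a2 ∙ c2 ∙ (S d ∙ S b))); last first.
  rewrite -[in RHS](counl x (f := fun x => S y ∙ S x)) //.
  apply: eq_sw => a b; rewrite sw_exch.
  rewrite -[in RHS](counl y (f := fun y => S y ∙ S b)) // swZ; apply: eq_sw => c d.
  under eq_sw => a1 a2 do under eq_sw => c1 c2 do rewrite pmulA.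
  rewrite -(comul_pmul (F := fun p q => S p ∙ q ∙ (S d ∙ S b))) // (antl _ (f := fun z => z ∙ (S d ∙ S b))) //.
  by rewrite peM pmul1l scalerA.
rewrite (coassoc (F := fun a1 a2 b => \∑(c, d <- Δ y) \∑(c1, c2 <- Δ c)
                S (a1 ∙ c1) ∙ (a2 ∙ c2 ∙ (S d ∙ S b)))) //.
rewrite -[in LHS](counr x (f := fun x => S (x ∙ y))) //.
apply: eq_sw => a b.
under [RHS]eq_sw => a2 b2.
  rewrite (coassoc (F := fun c1 c2 d => S (a ∙ c1) ∙ (a2 ∙ c2 ∙ (S d ∙ S b2)))) //.
  over.
rewrite sw_exch -[in LHS](counr y (f := fun y => S (a ∙ y))) // swZ; apply: eq_sw => c d; rewrite sw_exch.
transitivity (\∑(d1, d2 <- Δ d) \∑(b1, b2 <- Δ b) S (a ∙ c) ∙ (b1 ∙ (d1 ∙ S d2) ∙ S b2)).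
  rewrite sw_exch; under eq_sw => b1 b2.
    rewrite (antr _ (f := fun z => S (a ∙ c) ∙ (b1 ∙ z ∙ S b2))) // pmul1r; over.
  by rewrite -swZ (antr _ (f := fun z => S (a ∙ c) ∙ z)) // pmul1r !scalerA mulrC.
by apply: eq_sw => d1 d2; apply: eq_sw => b1 b2; rewrite !pmulA.
Qed.

(** Both sides come from convolution inverses of Δ among the maps V -> V ⊗ V. *)
Lemma comul_antip W (F : V -> V -> W) x : bilin F ->
  \∑(a, b <- Δ (S x)) F a b = \∑(a, b <- Δ x) F (S b) (S a).
Proof.
move=> hF.
suff -> : Δ (S x) = \∑(a, b <- Δ x) tens (S b) (S a).
  by rewrite sw_sw //; apply: eq_sw => a b; rewrite sw_tens.
move: x; apply: (conv_uniq (A := tpalg h h) (p := Δ)); [mlin|mlin|mlin| |] => x.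
  transitivity (\∑(a, b <- Δ x) Δ (S a ∙ b)).
    apply: eq_sw => a b; rewrite /= pDM /tpmul.
    by apply: eq_sw => c d.
  by rewrite antl ?pD1.
transitivity (\∑(a, b <- Δ x) \∑(c, d <- Δ a) \∑(p, q <- Δ b) tens (c ∙ S q) (d ∙ S p)).
  apply: eq_sw => a b; rewrite /= /tpmul; apply: eq_sw => c d; rewrite sw_sw //.
  by apply: eq_sw => p q; rewrite sw_tens.
rewrite (coassoc (F := fun c d b => \∑(p, q <- Δ b) tens (c ∙ S q) (d ∙ S p))) //.
under eq_sw => a b.
  rewrite -(coassoc (F := fun d p q => tens (a ∙ S q) (d ∙ S p))) //.
  under eq_sw => c d do (rewrite (antr _ (f := fun z => tens (a ∙ S d) z)) //).
  rewrite (counl _ (f := fun d => tens (a ∙ S d) e1)) //.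
  over.
by rewrite (antr _ (f := fun z => tens z e1)).
Qed.

Section InverseAntipode.
Variable T : {linear V -> V}.
Hypotheses (ST : cancel S T) (TS : cancel T S).

Lemma aiM x y : T (x ∙ y) = T y ∙ T x.
Proof. by apply: (can_inj ST); rewrite antipM !TS. Qed.
Lemma ai1 : T e1 = e1. Proof. by rewrite -[in LHS]antip1 ST. Qed.
Lemma eps_ai x : ε (T x) = ε x. Proof. by rewrite -eps_antip TS. Qed.
Lemma comul_ai W (F : V -> V -> W) x : bilin F ->
  \∑(a, b <- Δ (T x)) F a b = \∑(a, b <- Δ x) F (T b) (T a).
Proof.
move=> hF; rewrite -[in RHS](TS x) comul_antip //.
by apply: eq_sw => a b; rewrite !ST.
Qed.
(** [T] is the antipode for the opposite comultiplication, whence the reversed order of the two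
    legs. *)
Lemma ail W (f : V -> W) x : linear f ->
  \∑(a, b <- Δ x) f (T b ∙ a) = (ε x : k) *: f e1.
Proof.
move=> hf; rewrite -[in LHS](TS x) comul_antip //.
under eq_sw => a b do rewrite !ST.
by rewrite antr // eps_ai.
Qed.
Lemma air W (f : V -> W) x : linear f ->
  \∑(a, b <- Δ x) f (b ∙ T a) = (ε x : k) *: f e1.
Proof.
move=> hf; rewrite -[in LHS](TS x) comul_antip //.
under eq_sw => a b do rewrite !ST.
by rewrite antl // eps_ai.
Qed.
End InverseAntipode.
End Hopf.
Arguments coassoc [k V] h [W] F [x].

Section FiniteDimension.
Variable k : fieldType.
Implicit Types U V W M N : lmodType k.

Lemma the_linE U V (P : {linear U -> V} -> Prop) f :
  P f -> (forall g, P g -> g = f) -> the_lin P = f.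
Proof.
move=> Pf uniq; rewrite /the_lin; case: pselect => [ex|]; last by case; exists f.
by apply: uniq; exact: projT2 (cid ex).
Qed.

Lemma linvP U V (f : {linear U -> V}) : bijective f -> cancel f (linv f) /\ cancel (linv f) f.
Proof.
case=> g fg gf.
have gl : linear g.
  by move=> a x y; apply: (can_inj fg); rewrite gf linearP !gf.
rewrite /linv /the_lin; case: pselect => [ex|]; first exact: projT2 (cid ex).
by case; exists (mk_lin gl).
Qed.
Lemma linvE U V (f : {linear U -> V}) (g : {linear V -> U}) :
  cancel f g -> cancel g f -> linv f = g.
Proof.
move=> fg gf; apply: the_linE => // g' [fg' gf']; apply: lin_ext => v.
by apply: (can_inj fg); rewrite gf' gf.
Qed.

Definition dual_basis U n (e : 'I_n -> U) (c : 'I_n -> {linear U -> k^o}) : Prop :=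
  (forall u, u = \sum_i (c i u : k) *: e i) /\ (forall i j, c i (e j) = (i == j)%:R :> k).

(** A spanning family of least length is free, since a relation with a nonzero coefficient would
    allow one vector to be dropped. Coordinates are then unique, hence linear. *)
Lemma fin_dim_dual_basis U : fin_dim U ->
  exists n (e : 'I_n -> U) (c : 'I_n -> {linear U -> k^o}), dual_basis e c.
Proof.
move=> fU; pose P n := `[< exists e : 'I_n -> U, forall u, exists c : 'I_n -> k, u = \sum_i c i *: e i >].
have exP : exists n, P n by case: fU => n he; exists n; apply/asboolP.
case: (ex_minnP exP) => n /asboolP[e he] nmin {exP}.
have free (c : 'I_n -> k) : \sum_i c i *: e i = 0 -> forall i, c i = 0.
  move=> c0 i; apply/eqP; apply: contraT => ci.
  case: n e he nmin c c0 i ci => [|n] e he nmin c c0 i ci; first by case: i ci.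
  have: P n; last by move/nmin; rewrite ltnn.
  apply/asboolP; exists (fun j => e (lift i j)) => u; have [d ->] := he u.
  exists (fun j => d (lift i j) - d i * (c i)^-1 * c (lift i j)).
  move: c0; rewrite !(bigD1_ord i) //= => /eqP; rewrite addr_eq0 => /eqP c0.
  under [RHS]eq_bigr do rewrite scalerBl -scalerA.
  rewrite sumrB -scaler_sumr addrC; congr (_ + _).
  have -> : \sum_(j < n) c (lift i j) *: e (lift i j) = - (c i *: e i) by rewrite c0 opprK.
  by rewrite scalerN opprK scalerA -mulrA mulVf // mulr1.
have uniq (c d : 'I_n -> k) : \sum_i c i *: e i = \sum_i d i *: e i -> c =1 d.
  move=> cd i; apply/eqP; rewrite -subr_eq0; apply/eqP; apply: (free (fun i => c i - d i)).
  under eq_bigr do rewrite scalerBl.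
  by rewrite sumrB cd subrr.
pose c u := projT1 (cid (he u)); have cP u : u = \sum_i c u i *: e i := projT2 (cid (he u)).
have cl i : linear (fun u => c u i : k^o).
  move=> a u v; apply: (uniq _ (fun i => a * c u i + c v i)).
  rewrite -cP; under eq_bigr do rewrite scalerDl -scalerA.
  by rewrite big_split -scaler_sumr -!cP.
exists n, e, (fun i => mk_lin (cl i)); split=> [u|i j]; first exact: cP.
rewrite mk_linE; apply: (uniq _ (fun i => (i == j)%:R)).
rewrite -cP (bigD1 j) //= eqxx scale1r big1 ?addr0 // => l /negPf ->.
by rewrite scale0r.
Qed.

Section DualBasis.
Variables (U : lmodType k) (n : nat) (e : 'I_n -> U) (c : 'I_n -> {linear U -> k^o}).
Hypothesis ec : dual_basis e c.

Lemma db_exp W (f : U -> W) u : linear f -> \sum_i (c i u : k) *: f (e i) = f u.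
Proof.
by move=> hf; rewrite [in RHS](ec.1 u) linsum //; apply: eq_bigr => i _; rewrite linZ.
Qed.

(** A row in the kernel of the matrix of [f] would give a vector killed by [f]; so the matrix is
    invertible. *)
Lemma db_inj_bij (f : {linear U -> U}) : injective f -> bijective f.
Proof.
move=> finj; pose A : 'M[k]_n := \matrix_(i, j) (c j (f (e i)) : k).
have vec (v : 'rV_n) : f (\sum_i v 0 i *: e i) = \sum_j (v *m A) 0 j *: e j.
  rewrite linsum // [LHS](_ : _ = \sum_i \sum_j (v 0 i * A i j) *: e j).
    rewrite exchange_big; apply: eq_bigr => j _ /=.
    by rewrite mxE scaler_suml.
  apply: eq_bigr => i _; rewrite linearZ /= [in LHS](ec.1 (f (e i))) scaler_sumr.
  by apply: eq_bigr => j _; rewrite mxE scalerA.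
have coord (d : 'I_n -> k) j : c j (\sum_i d i *: e i) = d j :> k.
  rewrite linsum // (bigD1 j) //= linearZ /= ec.2 eqxx /= big1 => [|i /negPf ij].
    by rewrite addr0; exact: mulr1.
  by rewrite linearZ /= ec.2 eq_sym ij; exact: mulr0.
have Au : A \in unitmx.
  rewrite -row_free_unit -kermx_eq0; apply/eqP/row_matrixP => i; rewrite row0.
  set v := row i _; have vA : v *m A = 0 by rewrite -row_mul mulmx_ker row0.
  have : \sum_i v 0 i *: e i = 0.
    apply: finj; rewrite vec vA linear0; apply: big1 => j _.
    by rewrite mxE scale0r.
  move=> v0; apply/rowP => j; rewrite -(coord (fun i => v 0 i) j) v0 linear0.
  by rewrite mxE.
pose co u : 'rV_n := \row_i (c i u : k).
have coE u : \sum_i co u 0 i *: e i = u.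
  by rewrite [RHS](ec.1 u); apply: eq_bigr => i _; rewrite mxE.
have fg u : f (\sum_i (co u *m invmx A) 0 i *: e i) = u.
  by rewrite vec mulmxKV // coE.
by exists (fun u => \sum_i (co u *m invmx A) 0 i *: e i) => // u; apply: finj; rewrite fg.
Qed.

End DualBasis.
End FiniteDimension.

(** * Bijectivity of the antipode *)

Section AntipodeBijective.
Variables (k : fieldType) (V : lmodType k) (h : phopf V).
Variables (n : nat) (e : 'I_n -> V) (c : 'I_n -> {linear V -> k^o}).
Hypothesis ec : dual_basis e c.
Local Notation Δ := (pD h).
Local Notation ε := (pe h).
Local Notation S := (pS h).
Local Notation "x ∙ y" := (pmul h x y) (at level 39, left associativity).
Local Notation e1 := (pone h).

(** The identity Σ_i Δ(e_i) ⊗ c_i = Σ_{i,j} e_i ⊗ e_j ⊗ (c_i * c_j) for the canonical element, where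
    the star is convolution; both sides send z to Δ(z). *)
Lemma dual_basis_comul W (T : V -> V -> V ⊗ W) : bilin T ->
  \sum_i \∑(p, q <- Δ (e i)) \∑(z, w <- T p q) (c i z : k) *: w =
  \sum_i \sum_j \∑(z, w <- T (e i) (e j)) \∑(p, q <- Δ z) (c i p : k) *: ((c j q : k) *: w).
Proof.
move=> hT.
pose G i p q := \∑(z, w <- T p q) (c i z : k) *: w.
have hG i : bilin (G i) by rewrite /G; mlin.
have expand i p q : G i p q = \sum_j \sum_l (c j p : k) *: ((c l q : k) *: G i (e j) (e l)).
  rewrite -(db_exp ec (f := fun p => G i p q)) //.
  apply: eq_bigr => j _; rewrite -scaler_sumr; congr (_ *: _).
  by rewrite -(db_exp ec (f := fun q => G i (e j) q)).
transitivity (\sum_i \sum_j \sum_l \∑(p, q <- Δ (e i)) (c j p : k) *: ((c l q : k) *: G i (e j) (e l))).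
  apply: eq_bigr => i _; under [LHS]eq_sw => p q do rewrite -/(G i p q) expand.
  rewrite /sw /bsum_tens /bsum exchange_big; apply: eq_bigr => j _.
  by rewrite exchange_big.
rewrite exchange_big; apply: eq_bigr => j _; rewrite exchange_big; apply: eq_bigr => l _.
transitivity (\sum_i \∑(z, w <- T (e j) (e l)) (c i z : k) *: \∑(p, q <- Δ (e i)) (c j p : k) *: ((c l q : k) *: w)).
  apply: eq_bigr => i _; rewrite /G.
  transitivity (\∑(p, q <- Δ (e i)) \∑(z, w <- T (e j) (e l)) (c j p : k) *: ((c l q : k) *: ((c i z : k) *: w))).
    by apply: eq_sw => p q; rewrite !swZ.
  rewrite sw_exch; apply: eq_sw => z w; rewrite swZ; apply: eq_sw => p q.
  by rewrite !scalerA; congr (_ *: _); rewrite mulrC mulrA.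
transitivity (\∑(z, w <- T (e j) (e l)) \sum_i (c i z : k) *: \∑(p, q <- Δ (e i)) (c j p : k) *: ((c l q : k) *: w)).
  by rewrite /sw /bsum_tens /bsum exchange_big.
apply: eq_sw => z w.
by rewrite (db_exp ec (f := fun z => \∑(p, q <- Δ z) (c j p : k) *: ((c l q : k) *: w))).
Qed.

Definition fconv (f g : V -> k^o) x : k^o := \∑(a, b <- Δ x) (f a : k) *: g b.

(** The trace projection of the dual onto its integrals, x -> Σ_i (c_i * f)(x S²(e_i)). Only
    positive powers of S occur, so it can serve to prove that S is bijective. *)
Definition left_integral (f : V -> k^o) : V -> k^o :=
  fun x => \sum_i fconv (c i) f (x ∙ S (S (e i))).

Lemma fconv_lin f g : linear f -> linear g -> linear (fconv f g).
Proof. by move=> hf hg; rewrite /fconv; mlin. Qed.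

Lemma left_integral_lin f : linear f -> linear (left_integral f).
Proof.
move=> hf a x y; rewrite /left_integral scaler_sumr -big_split; apply: eq_bigr => i _ /=.
have hc := fconv_lin (linearP (c i)) hf.
have hl : linear (fun x => fconv (c i) f (x ∙ S (S (e i)))) by mlin.
exact: hl.
Qed.

(** The first leg of Δ(x S(b_1)) ends with an antipode factor that cancels against b_2. For an
    invariant functional [G] the right-hand side becomes Σ G(x S(b_1)) b_2, the expression by which
    injectivity of S is tested. *)
Lemma integral_shift (G : V -> k^o) x b : linear G ->
  \∑(p, q <- Δ x) (G (q ∙ S b) : k) *: p =
  \∑(b1, b2 <- Δ b) \∑(p, q <- Δ (x ∙ S b1)) (G q : k) *: (p ∙ b2).
Proof.
move=> hG.
transitivity (\∑(p, q <- Δ x) \∑(b1, b2 <- Δ b) \∑(b3, b4 <- Δ b2) (G (q ∙ S b1) : k) *: (p ∙ (S b3 ∙ b4))).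
  apply: eq_sw => p q.
  rewrite -[LHS](counr h b (f := fun b => (G (q ∙ S b) : k) *: p)) //.
  apply: eq_sw => b1 b2.
  by rewrite (antl _ _ (f := fun z => (G (q ∙ S b1) : k) *: (p ∙ z))) // pmul1r.
rewrite sw_exch.
under eq_sw => b1 b2 do rewrite sw_exch.
rewrite -(coassoc h (fun b1 b3 b4 => \∑(p, q <- Δ x) (G (q ∙ S b1) : k) *: (p ∙ (S b3 ∙ b4)))) //.
apply: eq_sw => b1 b2; rewrite -(comul_antip h (F := fun b3 b1 => \∑(p, q <- Δ x) (G (q ∙ b1) : k) *: (p ∙ (b3 ∙ b2)))) //.
rewrite comul_pmul // sw_exch; apply: eq_sw => p q; apply: eq_sw => r s.
by rewrite pmulA.
Qed.

(** After [integral_shift], [dual_basis_comul] trades the comultiplication of e_i for a convolution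
    of dual basis functionals. Summing over one index then produces a factor y_1 S(y_2), which
    collapses. *)
Lemma left_integralP f x : linear f ->
  \∑(p, q <- Δ x) (left_integral f q : k) *: p = (left_integral f x : k) *: e1.
Proof.
move=> hf; rewrite /left_integral.
transitivity (\sum_i \∑(p, q <- Δ (e i)) \∑(y1, y2 <- Δ (x ∙ S (S q))) \∑(z, w <- Δ y2)
    (c i z : k) *: ((f w : k) *: (y1 ∙ S p))).
  rewrite (_ : sw _ _ = \sum_i \∑(p, q <- Δ x) (fconv (c i) f (q ∙ S (S (e i))) : k) *: p); last first.
    rewrite /sw /bsum_tens /bsum exchange_big; apply: eq_bigr => p _.
    by rewrite scaler_suml.
  apply: eq_bigr => i _; rewrite integral_shift; last exact: (fconv_lin (linearP (c i)) hf).
  rewrite (comul_antip h (F := fun b1 b2 => \∑(p, q <- Δ (x ∙ S b1)) (fconv (c i) f q : k) *: (p ∙ b2))); last first.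
    have := fconv_lin (linearP (c i)) hf; mlin.
  apply: eq_sw => p q; apply: eq_sw => y1 y2.
  rewrite /fconv (sw_linear (fun z : k^o => (z : k) *: (y1 ∙ S p))) //.
  by apply: eq_sw => z w; rewrite scalerA.
pose T p q := \∑(y1, y2 <- Δ (x ∙ S (S q))) \∑(z, w <- Δ y2) tens z ((f w : k) *: (y1 ∙ S p)).
transitivity (\sum_i \∑(p, q <- Δ (e i)) \∑(z, w <- T p q) (c i z : k) *: w).
  apply: eq_bigr => i _; apply: eq_sw => p q; rewrite /T sw_sw //.
  apply: eq_sw => y1 y2; rewrite sw_sw //.
  by apply: eq_sw => z w; rewrite sw_tens.
rewrite dual_basis_comul; last by rewrite /T; mlin.
rewrite exchange_big /= scaler_suml; apply: eq_bigr => j _.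
set y := x ∙ S (S (e j)).
transitivity (\sum_i \∑(y1, y2 <- Δ y) \∑(z, w <- Δ y2) \∑(p, q <- Δ z)
   (c i p : k) *: ((c j q : k) *: ((f w : k) *: (y1 ∙ S (e i))))).
  apply: eq_bigr => i _; rewrite /T sw_sw //.
  apply: eq_sw => y1 y2; rewrite sw_sw //.
  by apply: eq_sw => z w; rewrite sw_tens.
transitivity (\∑(y1, y2 <- Δ y) \∑(z, w <- Δ y2) \∑(p, q <- Δ z)
   (c j q : k) *: ((f w : k) *: (y1 ∙ S p))).
  rewrite /sw /bsum_tens /bsum exchange_big; apply: eq_bigr => a _.
  rewrite exchange_big; apply: eq_bigr => b _; rewrite exchange_big; apply: eq_bigr => d _.
  by rewrite (db_exp ec (f := fun p => _ *: (_ *: (_ ∙ S p)))).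
under eq_sw => y1 y2.
  rewrite (coassoc h (fun p q w => (c j q : k) *: ((f w : k) *: (y1 ∙ S p)))) //.
  over.
rewrite -(coassoc h (fun y1 p z => \∑(q, w <- Δ z) (c j q : k) *: ((f w : k) *: (y1 ∙ S p)))) //.
transitivity (\∑(a, b <- Δ y) (ε a : k) *: ((fconv (c j) f b : k) *: e1)).
  apply: eq_sw => a b.
  rewrite (antr _ _ (f := fun u => \∑(q, w <- Δ b) (c j q : k) *: ((f w : k) *: u))) //.
  congr (_ *: _); rewrite /fconv (sw_linear (fun z : k^o => (z : k) *: e1)) //.
  by apply: eq_sw => z w; rewrite scalerA.
have hfc := fconv_lin (linearP (c j)) hf.
by rewrite (counl h _ (f := fun b => (fconv (c j) f b : k) *: e1)).
Qed.

(** The integrals built from the c_j, evaluated at S(e_j) and summed over j, give ε(1) = 1: by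
    [dual_basis_comul] the sum is Σ_i c_i(S(S(e_i1) e_i2)), and S(e_i1) e_i2 = ε(e_i) 1. So they
    cannot all vanish. *)
Lemma left_integral_neq0 : exists2 f : V -> k^o, linear f & exists x, left_integral f x != 0.
Proof.
have [//|no] := pselect (exists2 f : V -> k^o, linear f & exists x, left_integral f x != 0).
have int0 f x : linear f -> left_integral f x = 0.
  by move=> hf; apply/eqP; apply: contraT => nz; case: no; exists f => //; exists x.
have : (1 : k) = 0; last by move/eqP; rewrite oner_eq0.
rewrite -(pe1 h).
(* [fconv (c j) ε] is [c j], written in the form in which [dual_basis_comul] produces it. *)
transitivity (\sum_j left_integral (fconv (c j) ε) (e1 ∙ S (e j))); last first.
  by apply: big1 => j _; apply: int0; apply: fconv_lin; mlin.
pose T p q := \∑(z, w <- Δ (S (S p ∙ q))) tens z (ε w).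
transitivity (\sum_i \∑(p, q <- Δ (e i)) \∑(z, w <- T p q) (c i z : k) *: w).
  rewrite -(db_exp ec (f := ε)) //.
  transitivity (\sum_i (ε (e i) : k) *: c i e1).
    by apply: eq_bigr => i _; rewrite [LHS]mulrC.
  apply: eq_bigr => i _.
  transitivity (\∑(p, q <- Δ (e i)) c i (S (S p ∙ q))).
    by rewrite (antl h _ (f := fun z => c i (S z))) ?antip1.
  apply: (eq_sw (W := k^o)) => p q; rewrite /T sw_sw //.
  rewrite -[LHS](counr h _ (f := c i)) //.
  apply: eq_sw => z w; rewrite sw_tens //.
  by rewrite [LHS]mulrC.
rewrite dual_basis_comul; last by rewrite /T; mlin.
rewrite exchange_big; apply: eq_bigr => j _; rewrite /left_integral; apply: eq_bigr => i _.
rewrite /T sw_sw // pmul1l -antipM; set y := S _.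
transitivity (\∑(z, w <- Δ y) \∑(p, q <- Δ z) (c i p : k) *: ((c j q : k) *: ε w)).
  by apply: (eq_sw (W := k^o)) => z w; rewrite sw_tens.
rewrite (coassoc h (fun p q w => (c i p : k) *: ((c j q : k) *: ε w))) //.
by apply: (eq_sw (W := k^o)) => a b; rewrite /fconv swZ.
Qed.

(** Let S(d) = 0 and let l be a nonzero integral. Then Σ l(y S(d_1)) d_2 = 0 for all y by
    [integral_shift], while l(x) d = Σ l(x S²(d_2) S(d_1)) d_3 is assembled from such sums. As l(x)
    is nonzero for some x, d = 0. *)
Lemma antip_bij : bijective S.
Proof.
apply: (db_inj_bij ec) => a b ab; apply/eqP; rewrite -subr_eq0; apply/eqP.
have {ab} : S (a - b) = 0 by rewrite linearB ab subrr.
set d := a - b => Sd0.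
have [f hf [x nz]] := left_integral_neq0; set l := left_integral f in nz.
have hl : linear l by exact: left_integral_lin.
have lP y : \∑(p, q <- Δ y) (l q : k) *: p = (l y : k) *: e1 by exact: left_integralP.
have zero y : \∑(b1, b2 <- Δ d) (l (y ∙ S b1) : k) *: b2 = 0.
  transitivity (\∑(b1, b2 <- Δ d) \∑(p, q <- Δ (y ∙ S b1)) (l q : k) *: (p ∙ b2)).
    apply: eq_sw => b1 b2; transitivity (((l (y ∙ S b1) : k) *: e1) ∙ b2).
      by rewrite (linZ (fun z => z ∙ b2)) ?pmul1l.
    rewrite -lP (sw_linear (fun z => z ∙ b2)) //.
    by apply: eq_sw => p q; rewrite (linZ (fun z => z ∙ b2)).
  rewrite -integral_shift // Sd0; apply: big1 => p _.
  by rewrite (lin0 (f := pmul h p.2)) ?lin0 ?scale0r.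
have : (l x : k) *: d = 0; last first.
  by move/eqP; rewrite scaler_eq0 => /orP[/eqP l0|/eqP //]; rewrite l0 eqxx in nz.
transitivity (\∑(b1, z <- Δ d) \∑(b2, b3 <- Δ z) (l (x ∙ S (S b2) ∙ S b1) : k) *: b3).
  rewrite -(coassoc h (fun b1 b2 b3 => (l (x ∙ S (S b2) ∙ S b1) : k) *: b3)) //.
  rewrite -[LHS](counl h d (f := fun d => (l x : k) *: d)) //.
  apply: eq_sw => a' b'; under [RHS]eq_sw => p q do rewrite -pmulA -antipM.
  by rewrite (antr h _ (f := fun z => (l (x ∙ S z) : k) *: b')) // antip1 pmul1r.
(* The dual basis decouples d_2 ⊗ d_3 from d_1, so that [zero] applies with y = x S²(b_2). *)
transitivity (\∑(b1, z <- Δ d) \sum_i (c i z : k) *: \∑(b2, b3 <- Δ (e i)) (l (x ∙ S (S b2) ∙ S b1) : k) *: b3).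
  by apply: eq_sw => b1 z; rewrite (db_exp ec (f := fun z => \∑(b2, b3 <- Δ z) (l (x ∙ S (S b2) ∙ S b1) : k) *: b3)).
transitivity (\sum_i \∑(b2, b3 <- Δ (e i)) (c i (\∑(b1, z <- Δ d) (l (x ∙ S (S b2) ∙ S b1) : k) *: z) : k) *: b3).
  rewrite /sw /bsum_tens /bsum exchange_big; apply: eq_bigr => i _.
  under eq_bigr do rewrite scaler_sumr.
  rewrite exchange_big; apply: eq_bigr => p _ /=.
  rewrite linear_sum scaler_suml; apply: eq_bigr => q _.
  by rewrite scalerA [c i (_ *: _)]linearZ /= mulrC.
by apply: big1 => i _; apply: big1 => p _; rewrite zero linear0 scale0r.
Qed.
End AntipodeBijective.

(** * Twisted Yetter-Drinfeld data *)

Section Datum.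
Variables (k : fieldType) (V : lmodType k) (h : phopf V) (T : {linear V -> V}).
Hypotheses (ST : cancel (pS h) T) (TS : cancel T (pS h)).
Implicit Types X Y : lmodType k.
Local Notation Δ := (pD h).
Local Notation ε := (pe h).
Local Notation S := (pS h).
Local Notation "x ∙ y" := (pmul h x y) (at level 39, left associativity).
Local Notation e1 := (pone h).

Record hopf_mor (al : {linear V -> V}) : Prop := HopfMor {
  hmM : forall x y, al (x ∙ y) = al x ∙ al y;
  hm1 : al e1 = e1;
  hm_comul : forall X (F : V -> V -> X) x, bilin F ->
    \∑(a, b <- Δ (al x)) F a b = \∑(a, b <- Δ x) F (al a) (al b);
  hm_eps : forall x, ε (al x) = ε x
}.

(** Both sides are convolution inverses of [al]. *)
Lemma hm_antip al x : hopf_mor al -> al (S x) = S (al x).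
Proof.
case=> M1 M2 M3 M4.
move: x; apply: (conv_uniq (h := h) (A := h) (p := al)); [mlin|mlin|mlin| |] => x.
  by under eq_sw do rewrite -M1; rewrite antl ?M2.
by rewrite -(M3 _ (fun a b => a ∙ S b)) ?pSr ?M4.
Qed.

Variables (W : lmodType k) (A : palg W).
Local Notation "f ∗ g" := (pmul A f g) (at level 39, left associativity).
Local Notation "s ⋆ t" := (tpmul h A s t) (at level 39, left associativity).
Let R := tpalg h A.

(* [U] is the coaction of a module seen in [B ⊗ End(M)] and [th] the action;
   [dU1]-[dU2] say that it is a coaction, and [dU3] is the Yetter-Drinfeld
   condition twisted by [al]. *)
Record datum (al : {linear V -> V}) (th : {linear V -> W}) (U : V ⊗ W) : Prop := Datum {
  d_th1 : th e1 = pone A;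
  d_thM : forall x y, th (x ∙ y) = th x ∗ th y;
  dU1 : forall X (F : V -> V -> W -> X), trilin F ->
    \∑(x, p <- U) \∑(a, b <- Δ x) F a b p = \∑(x, p <- U) \∑(y, q <- U) F x y (q ∗ p);
  dU2 : \∑(x, p <- U) (ε x : k) *: p = pone A;
  dU3 : forall X (F : V -> W -> X) b, bilin F ->
    \∑(x, p <- U) \∑(b1, b2 <- Δ b) F (x ∙ al b2) (p ∗ th b1) =
    \∑(x, p <- U) \∑(b1, b2 <- Δ b) F (b1 ∙ x) (th b2 ∗ p)
}.

Variables (th : {linear V -> W}) (U : V ⊗ W).

Definition iact (b : V) (f : W) : W := \∑(b1, b2 <- Δ b) th b1 ∗ f ∗ th (S b2).
Lemma iact_bilin : bilin iact. Proof. rewrite /iact; mlin. Qed.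
(** [T] and not S: [dU1] multiplies the second legs in reversed order, so the products with [U]
    produce x_2 T(x_1) and T(x_2) x_1. *)
Definition Uinv : V ⊗ W := \∑(x, p <- U) tens (T x) p.
Definition icoact (f : W) : V ⊗ W := U ⋆ tens e1 f ⋆ Uinv.
Lemma icoact_lin : linear icoact.
Proof. by have hb := tpmul_bilin h A; rewrite /icoact; mlin. Qed.

Variable al : {linear V -> V}.
Hypothesis d : datum al th U.

Lemma d_counU X (f : W -> X) : linear f -> \∑(x, p <- U) (ε x : k) *: f p = f (pone A).
Proof.
move=> hf; rewrite -(dU2 d) (sw_linear _ hf); apply: eq_sw => x p.
by rewrite linZ.
Qed.

Lemma tpmul_sw s t X (F : V -> W -> X) : bilin F ->
  \∑(x, p <- s ⋆ t) F x p = \∑(x, p <- s) \∑(y, q <- t) F (x ∙ y) (p ∗ q).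
Proof.
move=> hF; rewrite /tpmul sw_sw //; apply: eq_sw => x p; rewrite sw_sw //.
by apply: eq_sw => y q; rewrite sw_tens.
Qed.

Lemma dU1r X (F : V -> V -> W -> X) : trilin F ->
  \∑(x, p <- U) \∑(y, q <- U) F y x (p ∗ q) = \∑(x, p <- U) \∑(a, b <- Δ x) F a b p.
Proof. by move=> hF; rewrite (dU1 d) // sw_exch. Qed.

Lemma sw_Uinv X (F : V -> W -> X) : bilin F -> \∑(x, p <- Uinv) F x p = \∑(x, p <- U) F (T x) p.
Proof.
move=> hF; rewrite /Uinv sw_sw //; apply: eq_sw => x p.
by rewrite sw_tens.
Qed.

Lemma UUinv : U ⋆ Uinv = pone R.
Proof.
rewrite -(sw_id (U ⋆ Uinv)) tpmul_sw //.
under eq_sw => x p do (rewrite sw_Uinv //).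
rewrite (dU1r (F := fun y x r => tens (x ∙ T y) r)) //.
under eq_sw => x p do (rewrite (air ST TS _ (f := fun z => tens z p)) //).
by rewrite d_counU.
Qed.

Lemma UinvU : Uinv ⋆ U = pone R.
Proof.
rewrite -(sw_id (Uinv ⋆ U)) tpmul_sw // sw_Uinv // (dU1r (F := fun y x r => tens (T x ∙ y) r)) //.
under eq_sw => x p do (rewrite (ail ST TS _ (f := fun z => tens z p)) //).
by rewrite d_counU.
Qed.

Lemma UinvK s : Uinv ⋆ U ⋆ s = s. Proof. by rewrite UinvU; exact: (pmul1l R). Qed.
Lemma UK s : U ⋆ Uinv ⋆ s = s. Proof. by rewrite UUinv; exact: (pmul1l R). Qed.
Lemma tmA s t u : s ⋆ (t ⋆ u) = s ⋆ t ⋆ u. Proof. exact: (pmulA R). Qed.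
Lemma tm1r s : s ⋆ tens e1 (pone A) = s. Proof. exact: (pmul1r R). Qed.
Lemma coactU f : icoact f ⋆ U = U ⋆ tens e1 f.
Proof. by rewrite /icoact -!tmA UinvU tm1r. Qed.

Lemma coactM f g : icoact (f ∗ g) = icoact f ⋆ icoact g.
Proof.
rewrite {2}/icoact !tmA coactU /icoact -(tmA _ (tens e1 f) (tens e1 g)).
by rewrite tpmulE pmul1l.
Qed.
Lemma coact1 : icoact (pone A) = tens e1 (pone A).
Proof. by rewrite /icoact tm1r UUinv. Qed.

Lemma coactE f : icoact f = \∑(x, p <- U) \∑(y, q <- U) tens (x ∙ T y) (p ∗ f ∗ q).
Proof.
rewrite /icoact -[LHS]sw_id tpmul_sw // tpmul_sw //.
apply: eq_sw => x p; rewrite sw_tens //.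
by rewrite sw_Uinv // pmul1r.
Qed.

Lemma sw_coact X (F : V -> W -> X) f : bilin F ->
  \∑(x, p <- icoact f) F x p = \∑(x, p <- U) \∑(y, q <- U) F (x ∙ T y) (p ∗ f ∗ q).
Proof.
move=> hF; rewrite coactE sw_sw //; apply: eq_sw => x p; rewrite sw_sw //.
by apply: eq_sw => y q; rewrite sw_tens.
Qed.

Lemma sw_coactU X (F : V -> W -> X) f : bilin F ->
  \∑(x, p <- icoact f) \∑(y, q <- U) F (x ∙ y) (p ∗ q) = \∑(x, p <- U) F x (p ∗ f).
Proof.
move=> hF; rewrite -tpmul_sw // coactU tpmul_sw //; apply: eq_sw => x p.
by rewrite sw_tens ?pmul1r.
Qed.

(** [dU1] splits both copies of [U]; as [T] reverses the legs of the second copy, the two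
    conjugations come out nested. *)
Lemma coact_coassoc X (F : V -> V -> W -> X) f : trilin F ->
  \∑(x, p <- icoact f) \∑(a, b <- Δ x) F a b p =
  \∑(x, p <- icoact f) \∑(y, q <- icoact p) F x y q.
Proof.
move=> hF; have hcl := icoact_lin.
rewrite sw_coact //.
transitivity (\∑(x, p <- U) \∑(y, q <- U) \∑(x1, x2 <- Δ x) \∑(y1, y2 <- Δ y)
   F (x1 ∙ T y2) (x2 ∙ T y1) (p ∗ f ∗ q)).
  apply: eq_sw => x p; apply: eq_sw => y q; rewrite comul_pmul //.
  by apply: eq_sw => x1 x2; rewrite (comul_ai ST TS).
under eq_sw => x p do rewrite sw_exch.
rewrite (dU1 d (F := fun x1 x2 p => \∑(y, q <- U) \∑(y1, y2 <- Δ y)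
   F (x1 ∙ T y2) (x2 ∙ T y1) (p ∗ f ∗ q))) //.
transitivity (\∑(x, p <- U) \∑(x', p' <- U) \∑(y, q <- U) \∑(y', q' <- U)
   F (x ∙ T y) (x' ∙ T y') (p' ∗ (p ∗ f ∗ q) ∗ q')).
  apply: eq_sw => x p; apply: eq_sw => x' p'.
  rewrite (dU1 d (F := fun y1 y2 q => F (x ∙ T y2) (x' ∙ T y1) (p' ∗ p ∗ f ∗ q))).
    rewrite sw_exch; apply: eq_sw => y q; apply: eq_sw => y' q'.
    by rewrite !pmulA.
  by mlin.
rewrite sw_coact //.
apply: eq_sw => x p; rewrite sw_exch; apply: eq_sw => y q.
by rewrite sw_coact.
Qed.

Lemma coact_coun X (F : W -> X) f : linear F -> \∑(x, p <- icoact f) (ε x : k) *: F p = F f.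
Proof.
move=> hF; rewrite sw_coact //.
transitivity (\∑(x, p <- U) (ε x : k) *: \∑(y, q <- U) (ε y : k) *: F (p ∗ f ∗ q)).
  apply: eq_sw => x p; rewrite swZ; apply: eq_sw => y q.
  by rewrite peM (eps_ai TS) scalerA.
under eq_sw => x p do (rewrite (d_counU (f := fun q => F (p ∗ f ∗ q))) //).
by rewrite (d_counU (f := fun p => F (p ∗ f ∗ pone A))) // pmul1l pmul1r.
Qed.

Lemma th_antl X (F : W -> X) b : linear F ->
  \∑(b1, b2 <- Δ b) F (th (S b1) ∗ th b2) = (ε b : k) *: F (pone A).
Proof.
move=> hF; under eq_sw => b1 b2 do rewrite -(d_thM d).
by rewrite (antl h _ (f := fun z => F (th z))) ?(d_th1 d).
Qed.
Lemma th_antr X (F : W -> X) b : linear F ->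
  \∑(b1, b2 <- Δ b) F (th b1 ∗ th (S b2)) = (ε b : k) *: F (pone A).
Proof.
move=> hF; under eq_sw => b1 b2 do rewrite -(d_thM d).
by rewrite (antr h _ (f := fun z => F (th z))) ?(d_th1 d).
Qed.

Lemma act_th f b : \∑(b1, b2 <- Δ b) iact b1 f ∗ th b2 = th b ∗ f.
Proof.
transitivity (\∑(b1, b' <- Δ b) \∑(b2, b3 <- Δ b') th b1 ∗ f ∗ (th (S b2) ∗ th b3)).
  rewrite -(coassoc h (fun b1 b2 b3 => th b1 ∗ f ∗ (th (S b2) ∗ th b3))) //.
  apply: eq_sw => b1 b2; rewrite /iact (sw_linear (fun z => z ∗ th b2)) //.
  by apply: eq_sw => b3 b4; rewrite !pmulA.
under eq_sw => b1 b' do (rewrite (th_antl (F := fun z => th b1 ∗ f ∗ z)) //).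
by rewrite (counr h _ (f := fun b => th b ∗ f ∗ pone A)) ?pmul1r.
Qed.

(** Right convolution with [th] is undone by right convolution with th ∘ S. Together with [act_th]
    this keeps the antipode out of proofs about [iact]. *)
Lemma th_cancel (f g : V -> W) : linear f -> linear g ->
  (forall b, \∑(b1, b2 <- Δ b) f b1 ∗ th b2 = \∑(b1, b2 <- Δ b) g b1 ∗ th b2) -> f =1 g.
Proof.
have key f' : linear f' ->
    forall b, f' b = \∑(b1, b2 <- Δ b) (\∑(c1, c2 <- Δ b1) f' c1 ∗ th c2) ∗ th (S b2).
  move=> hf b.
  transitivity (\∑(b1, b' <- Δ b) \∑(b2, b3 <- Δ b') f' b1 ∗ (th b2 ∗ th (S b3))).
    under eq_sw => b1 b' do (rewrite (th_antr (F := fun z => f' b1 ∗ z)) //).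
    by rewrite (counr h _ (f := fun b => f' b ∗ pone A)) ?pmul1r.
  rewrite -(coassoc h (fun b1 b2 b3 => f' b1 ∗ (th b2 ∗ th (S b3)))) //.
  apply: eq_sw => b1 b2; rewrite (sw_linear (fun z => z ∗ th (S b2))) //.
  by apply: eq_sw => b3 b4; rewrite !pmulA.
move=> hf hg fg b; rewrite (key f) // (key g) //; apply: eq_sw => b1 b2.
by rewrite fg.
Qed.

Lemma act1 f : iact e1 f = f.
Proof.
by rewrite /iact pD1 sw_tens // antip1 (d_th1 d) pmul1l pmul1r.
Qed.

Lemma actM b c f : iact (b ∙ c) f = iact b (iact c f).
Proof.
rewrite {1}/iact comul_pmul // {1}/iact; apply: eq_sw => b1 b2.
rewrite /iact (sw_linear (fun z => th b1 ∗ z ∗ th (S b2))) //.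
by apply: eq_sw => c1 c2; rewrite antipM !(d_thM d) !pmulA.
Qed.

(** Moving th across f by [act_th] turns th(b_1) f g th(S b_2) into (b_1·f) th(b_2) g th(S b_3). *)
Lemma act_mul b f g : iact b (f ∗ g) = \∑(b1, b2 <- Δ b) iact b1 f ∗ iact b2 g.
Proof.
have ha := iact_bilin.
rewrite {3}/iact.
transitivity (\∑(b', b3 <- Δ b) \∑(b1, b2 <- Δ b') iact b1 f ∗ th b2 ∗ g ∗ th (S b3)).
  rewrite {1}/iact; apply: eq_sw => b' b3.
  by rewrite -(sw_linear (fun z => z ∗ g ∗ th (S b3))) // act_th !pmulA.
rewrite (coassoc h (fun b1 b2 b3 => iact b1 f ∗ th b2 ∗ g ∗ th (S b3))) //.
apply: eq_sw => b1 b'; rewrite (sw_linear (pmul A (iact b1 f))) //.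
by apply: eq_sw => b2 b3; rewrite !pmulA.
Qed.

Lemma act_one b : iact b (pone A) = (ε b : k) *: pone A.
Proof.
by rewrite -(th_antr (F := fun z => z)) //; apply: eq_sw => b1 b2; rewrite pmul1r.
Qed.

Lemma dU3R b : \∑(b1, b2 <- Δ b) tens b1 (th b2) ⋆ U = \∑(b1, b2 <- Δ b) U ⋆ tens (al b2) (th b1).
Proof.
transitivity (\∑(x, p <- U) \∑(b1, b2 <- Δ b) tens (b1 ∙ x) (th b2 ∗ p)).
  rewrite sw_exch; apply: eq_sw => b1 b2; rewrite /tpmul sw_tens //.
rewrite -(dU3 d) // sw_exch; apply: eq_sw => b1 b2; rewrite /tpmul; apply: eq_sw => x p.
by rewrite sw_tens.
Qed.

Lemma th_cancelR (f g : V -> V ⊗ W) : linear f -> linear g ->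
  (forall b, \∑(b1, b2 <- Δ b) f b1 ⋆ tens e1 (th b2) = \∑(b1, b2 <- Δ b) g b1 ⋆ tens e1 (th b2)) ->
  f =1 g.
Proof.
have hb := tpmul_bilin h A.
have key f' : linear f' ->
    forall b, f' b = \∑(b1, b2 <- Δ b) (\∑(c1, c2 <- Δ b1) f' c1 ⋆ tens e1 (th c2)) ⋆ tens e1 (th (S b2)).
  move=> hf b.
  transitivity (\∑(b1, b' <- Δ b) \∑(b2, b3 <- Δ b') f' b1 ⋆ tens e1 (th b2 ∗ th (S b3))).
    under eq_sw => b1 b' do (rewrite (th_antr (F := fun z => f' b1 ⋆ tens e1 z)) //).
    by rewrite (counr h _ (f := fun b => f' b ⋆ tens e1 (pone A))) ?tm1r.
  rewrite -(coassoc h (fun b1 b2 b3 => f' b1 ⋆ tens e1 (th b2 ∗ th (S b3)))) //.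
  apply: eq_sw => b1 b2; rewrite (sw_linear (fun z => z ⋆ tens e1 (th (S b2)))) //.
  by apply: eq_sw => b3 b4; rewrite -tmA tpmulE pmul1l.
move=> hf hg fg b; rewrite (key f) // (key g) //; apply: eq_sw => b1 b2.
by rewrite fg.
Qed.

(** The twist cancels here, which is why twisted data still give algebras in the untwisted category:
    after multiplication by th, [dU3R] introduces al(b) next to [U], and the same rule read
    backwards removes it. Both sides become Σ (b_1 ⊗ th(b_2)) ⋆ icoact f. *)
Lemma act_yd b f :
  \∑(b1, b2 <- Δ b) icoact (iact b1 f) ⋆ tens b2 (pone A) =
  \∑(b1, b2 <- Δ b) \∑(x, p <- icoact f) tens (b1 ∙ x) (iact b2 p).
Proof.
have hb := tpmul_bilin h A; have ha := iact_bilin; have hc := icoact_lin.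
move: b; apply: th_cancelR => // b.
transitivity (\∑(b1, b2 <- Δ b) tens b1 (th b2) ⋆ icoact f).
  transitivity (\∑(b1, b' <- Δ b) \∑(b2, b3 <- Δ b') icoact (iact b1 f) ⋆ tens b2 (th b3)).
    rewrite -(coassoc h (fun b1 b2 b3 => icoact (iact b1 f) ⋆ tens b2 (th b3))) //.
    apply: eq_sw => b1 b2; rewrite (sw_linear (fun z => z ⋆ tens e1 (th b2))) //.
    by apply: eq_sw => b3 b4; rewrite -tmA tpmulE pmul1r pmul1l.
  transitivity (\∑(b1, b' <- Δ b) \∑(b2, b3 <- Δ b') U ⋆ tens (al b3) (iact b1 f ∗ th b2) ⋆ Uinv).
    apply: eq_sw => b1 b'.
    transitivity (icoact (iact b1 f) ⋆ (\∑(b2, b3 <- Δ b') tens b2 (th b3) ⋆ U) ⋆ Uinv).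
      rewrite -[RHS]tmA (sw_linear (fun z => icoact (iact b1 f) ⋆ (z ⋆ Uinv))) //.
      by apply: eq_sw => b2 b3; rewrite -(tmA _ U) UUinv tm1r.
    rewrite dU3R -[LHS]tmA (sw_linear (fun z => icoact (iact b1 f) ⋆ (z ⋆ Uinv))) //.
    apply: eq_sw => b2 b3; rewrite !tmA coactU -(tmA U) tpmulE pmul1l.
    by [].
  rewrite -(coassoc h (fun b1 b2 b3 => U ⋆ tens (al b3) (iact b1 f ∗ th b2) ⋆ Uinv)) //.
  transitivity (\∑(b1, b2 <- Δ b) U ⋆ tens (al b2) (th b1) ⋆ (tens e1 f ⋆ Uinv)).
    apply: eq_sw => b1 b2.
    rewrite -(sw_linear (fun z => U ⋆ tens (al b2) z ⋆ Uinv)) //.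
    by rewrite act_th [in RHS]tmA -[in RHS](tmA U) tpmulE pmul1r.
  rewrite -(sw_linear (fun z => z ⋆ (tens e1 f ⋆ Uinv))) //.
  rewrite -dU3R (sw_linear (fun z => z ⋆ (tens e1 f ⋆ Uinv))) //.
  by apply: eq_sw => b1 b2; rewrite /icoact !tmA.
symmetry.
transitivity (\∑(b1, b' <- Δ b) \∑(b2, b3 <- Δ b') \∑(x, p <- icoact f) tens (b1 ∙ x) (iact b2 p ∗ th b3)).
  rewrite -(coassoc h (fun b1 b2 b3 => \∑(x, p <- icoact f) tens (b1 ∙ x) (iact b2 p ∗ th b3))) //.
  apply: eq_sw => b1 b2; rewrite (sw_linear (fun z => z ⋆ tens e1 (th b2))) //.
  apply: eq_sw => b3 b4; rewrite (sw_linear (fun z => z ⋆ tens e1 (th b2))) //.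
  by apply: eq_sw => x p; rewrite tpmulE pmul1r.
apply: eq_sw => b1 b'; rewrite sw_exch.
rewrite /tpmul sw_tens //.
apply: eq_sw => x p; rewrite -(sw_linear (fun z => tens (b1 ∙ x) z)) //.
by rewrite act_th.
Qed.

(** [act_yd] solved for the coaction of b·f, by multiplying the first leg by S(b_3). *)
Lemma sw_coact_act X (F : V -> W -> X) b f : bilin F ->
  \∑(y, g <- icoact (iact b f)) F y g =
  \∑(b', b3 <- Δ b) \∑(b1, b2 <- Δ b') \∑(y, g <- icoact f) F (b1 ∙ y ∙ S b3) (iact b2 g).
Proof.
move=> hF.
have hb := tpmul_bilin h A; have ha := iact_bilin; have hc := icoact_lin.
have -> : icoact (iact b f) = \∑(b', b3 <- Δ b) \∑(b1, b2 <- Δ b') \∑(y, g <- icoact f)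
    tens (b1 ∙ y ∙ S b3) (iact b2 g).
  transitivity (\∑(b1, b' <- Δ b) \∑(b2, b3 <- Δ b')
      icoact (iact b1 f) ⋆ tens (b2 ∙ S b3) (pone A)).
    under eq_sw => b1 b'.
      rewrite (antr h _ (f := fun z => icoact (iact b1 f) ⋆ tens z (pone A))) // tm1r; over.
    by rewrite (counr h _ (f := fun b => icoact (iact b f))).
  rewrite -(coassoc h (fun b1 b2 b3 => icoact (iact b1 f) ⋆ tens (b2 ∙ S b3) (pone A))) //.
  apply: eq_sw => b' b3.
  transitivity ((\∑(b1, b2 <- Δ b') icoact (iact b1 f) ⋆ tens b2 (pone A)) ⋆ tens (S b3) (pone A)).
    rewrite (sw_linear (fun z => z ⋆ tens (S b3) (pone A))) //.
    by apply: eq_sw => b1 b2; rewrite -tmA tpmulE pmul1r.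
  rewrite act_yd (sw_linear (fun z => z ⋆ tens (S b3) (pone A))) //.
  apply: eq_sw => b1 b2; rewrite (sw_linear (fun z => z ⋆ tens (S b3) (pone A))) //.
  by apply: eq_sw => y g; rewrite tpmulE pmul1r.
rewrite sw_sw //; apply: eq_sw => b' b3; rewrite sw_sw //; apply: eq_sw => b1 b2.
by rewrite sw_sw //; apply: eq_sw => y g; rewrite sw_tens.
Qed.

Lemma coact_uniq f t : t ⋆ U = U ⋆ tens e1 f -> icoact f = t.
Proof. by move=> E; rewrite /icoact -E -tmA UUinv tm1r. Qed.

End Datum.

(** * Azumaya property of inner structures *)

Section Azumaya.
Variables (k : fieldType) (V : lmodType k) (h : phopf V) (T : {linear V -> V}).
Hypotheses (ST : cancel (pS h) T) (TS : cancel T (pS h)).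
Implicit Types X Y : lmodType k.
Local Notation Δ := (pD h).
Local Notation ε := (pe h).
Local Notation S := (pS h).
Local Notation "x ∙ y" := (pmul h x y) (at level 39, left associativity).
Local Notation e1 := (pone h).
Variables (W : lmodType k) (A : palg W).
Local Notation "f ∗ g" := (pmul A f g) (at level 39, left associativity).
Variables (al al' : {linear V -> V}) (th : {linear V -> W}) (U : V ⊗ W).
Hypotheses (al_mor : hopf_mor h al) (al'_mor : hopf_mor h al').
Hypotheses (alK : cancel al al') (al'K : cancel al' al).
Hypothesis d : datum h A al th U.
Local Notation iact := (iact h A th).
Local Notation icoact := (icoact h T A U).

(** [dU3] solved for th(b) on the left of [U]; S(b_1) absorbs the leg that the rule leaves in
    front. *)
Lemma dU3l X (F : V -> W -> X) b : bilin F ->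
  \∑(y, q <- U) F y (th b ∗ q) =
  \∑(b1, b' <- Δ b) \∑(b2, b3 <- Δ b') \∑(y, q <- U) F (S b1 ∙ y ∙ al b3) (q ∗ th b2).
Proof.
move=> hF; symmetry.
transitivity (\∑(b1, b' <- Δ b) \∑(b2, b3 <- Δ b') \∑(y, q <- U) F (S b1 ∙ b2 ∙ y) (th b3 ∗ q)).
  apply: eq_sw => b1 b'; rewrite sw_exch.
  under eq_sw => y q do under eq_sw => b2 b3 do rewrite -pmulA.
  rewrite (dU3 d (F := fun y q => F (S b1 ∙ y) q)) // sw_exch; apply: eq_sw => b2 b3; apply: eq_sw => y q.
  by rewrite pmulA.
rewrite -(coassoc h (fun b1 b2 b3 => \∑(y, q <- U) F (S b1 ∙ b2 ∙ y) (th b3 ∗ q))) //.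
under eq_sw => b1 b2.
  rewrite (antl h _ (f := fun z => \∑(y, q <- U) F (z ∙ y) (th b2 ∗ q))) //.
  over.
rewrite (counl h _ (f := fun b2 => \∑(y, q <- U) F (e1 ∙ y) (th b2 ∗ q))) //.
by apply: eq_sw => y q; rewrite pmul1l.
Qed.

(** An analogue of Drinfel'd's element, with [U] in the role of an R-matrix. The choices [v] and
    [v'] below are mutually inverse, and it is in [v'] that the inverse [al'] of the twist
    enters. *)
Definition drinfeld (f : V -> V) : W := \∑(x, p <- U) p ∗ th (f x).
Let v := drinfeld (fun x => T (T x)).
Let v' := drinfeld (fun x => S (al' x)).

Lemma al'_antip x : al' (S x) = S (al' x). Proof. exact: (hm_antip x al'_mor). Qed.
Lemma al_antip x : al (S x) = S (al x). Proof. exact: (hm_antip x al_mor). Qed.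

(** th(T²(x)) is moved across the second copy of [U] by [dU3l], the two copies merge by [dU1r], and
    neighbouring factors cancel in turn. The last pair is T²(x_2 S(x_3)), since [al'] undoes the
    [al] that [dU3l] brought in. *)
Lemma drinfeldK : v ∗ v' = pone A.
Proof.
rewrite /v /drinfeld (sw_linear (fun z => z ∗ v')) //.
transitivity (\∑(x, p <- U) \∑(y, q <- U) p ∗ (th (T (T x)) ∗ q ∗ th (S (al' y)))).
  apply: eq_sw => x p; rewrite /v' /drinfeld (sw_linear (fun z => p ∗ th (T (T x)) ∗ z)) //.
  by apply: eq_sw => y q; rewrite !pmulA.
transitivity (\∑(x, p <- U) \∑(y, q <- U) \∑(x1, x' <- Δ x) \∑(x2, x3 <- Δ x')
   p ∗ q ∗ (th (T (T x2)) ∗ th (S (al' (T x1 ∙ y ∙ al (T (T x3))))))).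
  apply: eq_sw => x p.
  rewrite (dU3l (F := fun y q => p ∗ (q ∗ th (S (al' y))))) // (comul_ai ST TS) // (comul_ai ST TS) //.
  rewrite [RHS]sw_exch; apply: eq_sw => x1 x'.
  rewrite (comul_ai ST TS) // (comul_ai ST TS) // [RHS]sw_exch; apply: eq_sw => x2 x3; apply: eq_sw => y q.
  by rewrite TS !pmulA.
rewrite (dU1r d (F := fun y x r => \∑(x1, x' <- Δ x) \∑(x2, x3 <- Δ x')
   r ∗ (th (T (T x2)) ∗ th (S (al' (T x1 ∙ y ∙ al (T (T x3)))))))) //.
rewrite -[RHS](d_counU d (f := fun p => p)) //; apply: eq_sw => z r.
rewrite -(coassoc h (fun y x1 x' => \∑(x2, x3 <- Δ x')
   r ∗ (th (T (T x2)) ∗ th (S (al' (T x1 ∙ y ∙ al (T (T x3)))))))) //.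
under eq_sw => a b.
  rewrite (ail ST TS _ (f := fun u => \∑(x2, x3 <- Δ b)
   r ∗ (th (T (T x2)) ∗ th (S (al' (u ∙ al (T (T x3)))))))) //.
  over.
rewrite (counl h _ (f := fun b => \∑(x2, x3 <- Δ b)
   r ∗ (th (T (T x2)) ∗ th (S (al' (e1 ∙ al (T (T x3)))))))) //.
have E x2 x3 : th (T (T x2)) ∗ th (S (al' (e1 ∙ al (T (T x3))))) = th (T (T (x2 ∙ S x3))).
  by rewrite pmul1l alK TS -(d_thM d) !(aiM ST TS) ST.
under eq_sw => x2 x3 do rewrite E.
by rewrite (antr h _ (f := fun u => r ∗ th (T (T u)))) // !(ai1 ST) (d_th1 d) pmul1r.
Qed.

Lemma drinfeldVK : v' ∗ v = pone A.
Proof.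
rewrite {1}/v' /drinfeld (sw_linear (fun z => z ∗ v)) //.
transitivity (\∑(x, p <- U) \∑(y, q <- U) p ∗ (th (S (al' x)) ∗ q ∗ th (T (T y)))).
  apply: eq_sw => x p; rewrite /v /drinfeld (sw_linear (fun z => p ∗ th (S (al' x)) ∗ z)) //.
  by apply: eq_sw => y q; rewrite !pmulA.
transitivity (\∑(x, p <- U) \∑(y, q <- U) \∑(x1, x' <- Δ x) \∑(x2, x3 <- Δ x')
   p ∗ q ∗ (th (S (al' x2)) ∗ th (T (T (S (S (al' x3)) ∙ (y ∙ S x1)))))).
  apply: eq_sw => x p.
  rewrite (dU3l (F := fun y q => p ∗ (q ∗ th (T (T y))))) // comul_antip // (hm_comul al'_mor) //.
  under eq_sw => a b.
    rewrite comul_antip // (hm_comul al'_mor) //.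
    over.
  rewrite (coassoc h (fun a b c => \∑(y, q <- U)
    p ∗ (q ∗ th (S (al' b)) ∗ th (T (T (S (S (al' c)) ∙ y ∙ al (S (al' a)))))))) //.
  rewrite [RHS]sw_exch; apply: eq_sw => x1 x'.
  rewrite [RHS]sw_exch; apply: eq_sw => x2 x3; apply: eq_sw => y q.
  by rewrite al_antip al'K !pmulA.
rewrite (dU1r d (F := fun y x r => \∑(x1, x' <- Δ x) \∑(x2, x3 <- Δ x')
   r ∗ (th (S (al' x2)) ∗ th (T (T (S (S (al' x3)) ∙ (y ∙ S x1))))))) //.
rewrite -[RHS](d_counU d (f := fun p => p)) //; apply: eq_sw => z r.
rewrite -(coassoc h (fun y x1 x' => \∑(x2, x3 <- Δ x')
   r ∗ (th (S (al' x2)) ∗ th (T (T (S (S (al' x3)) ∙ (y ∙ S x1))))))) //.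
under eq_sw => a b.
  rewrite (antr h _ (f := fun u => \∑(x2, x3 <- Δ b)
   r ∗ (th (S (al' x2)) ∗ th (T (T (S (S (al' x3)) ∙ u)))))) //.
  over.
rewrite (counl h _ (f := fun b => \∑(x2, x3 <- Δ b)
   r ∗ (th (S (al' x2)) ∗ th (T (T (S (S (al' x3)) ∙ e1)))))) //.
have E x2 x3 : th (S (al' x2)) ∗ th (T (T (S (S (al' x3)) ∙ e1))) = th (al' (S x2 ∙ x3)).
  by rewrite pmul1r !ST -(d_thM d) (hmM al'_mor) al'_antip.
under eq_sw => x2 x3 do rewrite E.
by rewrite (antl h _ (f := fun u => r ∗ th (al' u))) // (hm1 al'_mor) (d_th1 d) pmul1r.
Qed.

Definition jmap (a : W) : W := \∑(x, p <- U) p ∗ a ∗ th (T x).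
Definition jmapV (a : W) : W := \∑(x, p <- U) p ∗ a ∗ th (T (T x)).
Lemma jmap_lin : linear jmap. Proof. rewrite /jmap; mlin. Qed.

Lemma jmapK : cancel jmap jmapV.
Proof.
move=> a; rewrite /jmapV.
transitivity (\∑(x, p <- U) \∑(y, q <- U) p ∗ q ∗ a ∗ th (T (T x ∙ y))).
  apply: eq_sw => x p; rewrite /jmap (sw_linear (fun z => p ∗ z ∗ th (T (T x)))) //.
  by apply: eq_sw => y q; rewrite (aiM ST TS) (d_thM d) !pmulA.
rewrite (dU1r d (F := fun y x r => r ∗ a ∗ th (T (T x ∙ y)))) //.
under eq_sw => x p do (rewrite (ail ST TS _ (f := fun z => p ∗ a ∗ th (T z))) //).
by rewrite (d_counU d (f := fun p => p ∗ a ∗ th (T e1))) ?(ai1 ST) ?(d_th1 d) ?pmul1l ?pmul1r.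
Qed.
Lemma jmapVK : cancel jmapV jmap.
Proof.
move=> a; rewrite {1}/jmap.
transitivity (\∑(x, p <- U) \∑(y, q <- U) p ∗ q ∗ a ∗ th (T (x ∙ T y))).
  apply: eq_sw => x p; rewrite /jmapV (sw_linear (fun z => p ∗ z ∗ th (T x))) //.
  by apply: eq_sw => y q; rewrite (aiM ST TS) (d_thM d) !pmulA.
rewrite (dU1r d (F := fun y x r => r ∗ a ∗ th (T (x ∙ T y)))) //.
under eq_sw => x p do (rewrite (air ST TS _ (f := fun z => p ∗ a ∗ th (T z))) //).
by rewrite (d_counU d (f := fun p => p ∗ a ∗ th (T e1))) ?(ai1 ST) ?(d_th1 d) ?pmul1l ?pmul1r.
Qed.

Lemma act_ai x b : iact (T x) b = \∑(x1, x2 <- Δ x) th (T x2) ∗ b ∗ th x1.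
Proof.
rewrite /iact (comul_ai ST TS) //.
by apply: eq_sw => x1 x2; rewrite TS.
Qed.

(** In the coaction x T(y) ⊗ p a q, the factor T(y) contributes th(T²(y)), hence [v], and x
    contributes [jmap]. *)
Lemma coact_th a : \∑(x, p <- icoact a) p ∗ th (T x) = jmap (a ∗ v).
Proof.
rewrite (sw_coact h T A U (F := fun x p => p ∗ th (T x))) //.
apply: eq_sw => x p; rewrite /v /drinfeld (sw_linear (fun z => p ∗ (a ∗ z) ∗ th (T x))) //.
by apply: eq_sw => y q; rewrite (aiM ST TS) (d_thM d) !pmulA.
Qed.

Section Twist.
Variables (W' : lmodType k) (act' : V -> W' -> W').
Hypotheses (act'_bilin : bilin act') (act'1 : forall f, act' e1 f = f).
Hypothesis act'M : forall b c f, act' (b ∙ c) f = act' b (act' c f).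

(** The part of the braiding that acts on the second factor. The action is left abstract: in
    [azF_bij] it is [iact] on the same algebra, in [tau_bij] that on the other tensor factor. *)
Definition twist (t : W ⊗ W') : W ⊗ W' := \∑(f, g <- t) \∑(x, p <- U) tens (f ∗ p) (act' (T x) g).
Definition untwist (t : W ⊗ W') : W ⊗ W' :=
  \∑(f, g <- t) \∑(x, p <- U) tens (f ∗ p) (act' (T (T x)) g).
Lemma twist_lin : linear twist. Proof. rewrite /twist; mlin. Qed.
Lemma untwist_lin : linear untwist. Proof. rewrite /untwist; mlin. Qed.

Lemma twistE f g : twist (tens f g) = \∑(x, p <- U) tens (f ∗ p) (act' (T x) g).
Proof. rewrite /twist sw_tens //. Qed.
Lemma untwistE f g : untwist (tens f g) = \∑(x, p <- U) tens (f ∗ p) (act' (T (T x)) g).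
Proof. rewrite /untwist sw_tens //. Qed.

Lemma twistK : cancel twist untwist.
Proof.
have hu := untwist_lin; have ht := twist_lin.
apply: tens_lin_ext => // f g; rewrite twistE (sw_linear _ untwist_lin).
transitivity (\∑(x, p <- U) \∑(y, q <- U) tens (f ∗ (p ∗ q)) (act' (T (x ∙ T y)) g)).
  apply: eq_sw => x p; rewrite untwistE; apply: eq_sw => y q.
  by rewrite -act'M -(aiM ST TS) pmulA.
rewrite (dU1r d (F := fun y x r => tens (f ∗ r) (act' (T (x ∙ T y)) g))) //.
under eq_sw => x p do (rewrite (air ST TS _ (f := fun z => tens (f ∗ p) (act' (T z) g))) //).
by rewrite (d_counU d (f := fun p => tens (f ∗ p) (act' (T e1) g))) // (ai1 ST) act'1 pmul1r.
Qed.
Lemma untwistK : cancel untwist twist.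
Proof.
have hu := untwist_lin; have ht := twist_lin.
apply: tens_lin_ext => // f g; rewrite untwistE (sw_linear _ twist_lin).
transitivity (\∑(x, p <- U) \∑(y, q <- U) tens (f ∗ (p ∗ q)) (act' (T (T x ∙ y)) g)).
  apply: eq_sw => x p; rewrite twistE; apply: eq_sw => y q.
  by rewrite -act'M -(aiM ST TS) pmulA.
rewrite (dU1r d (F := fun y x r => tens (f ∗ r) (act' (T (T x ∙ y)) g))) //.
under eq_sw => x p do (rewrite (ail ST TS _ (f := fun z => tens (f ∗ p) (act' (T z) g))) //).
by rewrite (d_counU d (f := fun p => tens (f ∗ p) (act' (T e1) g))) // (ai1 ST) act'1 pmul1r.
Qed.
End Twist.

Lemma tmap_cancel X Y X' Y' (f : {linear X -> X'}) (g : {linear Y -> Y'})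
    (f' : {linear X' -> X}) (g' : {linear Y' -> Y}) :
  cancel f f' -> cancel g g' -> cancel (f ⊠ g) (f' ⊠ g').
Proof.
by move=> ff gg; apply: tens_lin_ext => // x y; rewrite !tliftE ff gg.
Qed.

Variable can : {linear W ⊗ W -> LHom W W}.
Hypothesis canE : forall a b c, (can (tens a b) : {linear W -> W}) c = a ∗ c ∗ b.
Hypothesis can_bij : bijective can.

Let jl : {linear W -> W} := mk_lin jmap_lin.
Lemma jmapV_lin : linear jmapV. Proof. by rewrite /jmapV; mlin. Qed.
Let jlV : {linear W -> W} := mk_lin jmapV_lin.

Lemma mull_lin a : linear (fun b => a ∗ b). Proof. by mlin. Qed.
Lemma mulr_lin a : linear (fun b => b ∗ a). Proof. by mlin. Qed.

(** [F] factors as [can] after id ⊗ [g1] after [twist], where g1(b) = jmap(v b); the invertibility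
    of [v] makes [g1] bijective. *)
Lemma azF_bij (F : {linear W ⊗ W -> LHom W W}) :
  (forall a b c, (F (tens a b) : {linear W -> W}) c =
     \∑(x, c' <- icoact c) a ∗ (c' ∗ iact (T x) b)) -> bijective F.
Proof.
move=> FE.
have ha := iact_bilin h A th; have hj := jmap_lin; have hc := icoact_lin h T A U.
have htl := twist_lin ha.
pose g1 : {linear W -> W} := jl \o mk_lin (mull_lin v).
pose g2 : {linear W -> W} := mk_lin (mull_lin v') \o jlV.
have g12 : cancel g1 g2 by move=> a /=; rewrite jmapK pmulA drinfeldVK pmul1l.
have g21 : cancel g2 g1 by move=> a /=; rewrite pmulA drinfeldK pmul1l jmapVK.
pose G : {linear W ⊗ W -> W ⊗ W} := (lid W ⊠ g1) \o mk_lin htl.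
have Gbij : bijective G.
  exists (untwist iact \o (lid W ⊠ g2)) => t /=.
    rewrite (tmap_cancel (f := lid W) (f' := lid W)) //.
    exact: (twistK ha (act1 d) (actM d)).
  rewrite (untwistK ha (act1 d) (actM d)).
  exact: (tmap_cancel (f := lid W) (f' := lid W)).
suff -> : F = can \o G by exact: bij_comp can_bij Gbij.
apply: tensor_lin_ext => a b; apply: lin_ext => c; rewrite FE /=.
transitivity (\∑(x, p <- U) \∑(y, q <- U) a ∗ jmap (p ∗ c ∗ q ∗ v) ∗ b ∗ th x ∗ th (T y)).
  transitivity (\∑(x, c' <- icoact c) a ∗ jmap (c' ∗ v) ∗ b ∗ th x).
    (* The action of T(x) on b is th(T(x_2)) b th(x_1); its left factor joins c', where
       coassociativity lets [coact_th] evaluate it. *)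
    transitivity (\∑(x, c' <- icoact c) \∑(x1, x2 <- Δ x) a ∗ (c' ∗ th (T x2)) ∗ b ∗ th x1).
      apply: eq_sw => x c'; rewrite act_ai (sw_linear (fun z => a ∗ (c' ∗ z))) //.
      by apply: eq_sw => x1 x2; rewrite !pmulA.
    rewrite (coact_coassoc ST TS d (F := fun x1 x2 c' => a ∗ (c' ∗ th (T x2)) ∗ b ∗ th x1)) //.
    apply: eq_sw => x c'; rewrite -coact_th.
    rewrite (sw_linear (fun z => a ∗ z ∗ b ∗ th x)); last by mlin.
    by [].
  rewrite sw_coact //.
  by apply: eq_sw => x p; apply: eq_sw => y q; rewrite (d_thM d) !pmulA.
rewrite twistE; last by [].
rewrite (sw_lin (lid W ⊠ g1)) (sw_lin can).
pose K t := (can (tmap (lid W) g1 t) : {linear W -> W}) c.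
have Klin : linear K by rewrite /K; mlin.
transitivity (\∑(x, p <- U) K (tens (a ∗ p) (iact (T x) b))); last first.
  by rewrite [RHS](sw_linear (fun g : LHom W W => (g : {linear W -> W}) c)).
transitivity (\∑(x, p <- U) \∑(z, r <- U) K (tens (a ∗ (r ∗ p)) (th (T z) ∗ b ∗ th x))); last first.
  rewrite -(dU1 d (F := fun x z r => K (tens (a ∗ r) (th (T z) ∗ b ∗ th x)))) //.
  apply: eq_sw => x p; rewrite act_ai (sw_linear (fun z => K (tens (a ∗ p) z))) //.

apply: eq_sw => x p.
transitivity (\∑(y, q <- U) \∑(z, r <- U) a ∗ (r ∗ (p ∗ c ∗ q ∗ v) ∗ th (T z)) ∗ b ∗ th x ∗ th (T y)).
  apply: eq_sw => y q; rewrite {1}/jmap (sw_linear (fun u => a ∗ u ∗ b ∗ th x ∗ th (T y))) //.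

rewrite sw_exch; apply: eq_sw => z r; rewrite /K tliftE canE /= /jmap.
rewrite (sw_linear (fun u => a ∗ (r ∗ p) ∗ c ∗ u)) //.
by apply: eq_sw => y q; rewrite !pmulA.
Qed.

(** [F] factors as [can] after [g1] ⊗ id after [G0], where now g1(a) = jmap(a v), and [G0] spreads
    the coaction of a over b through th; replacing th by th ∘ T inverts [G0]. *)
Lemma azG_bij (F : {linear W ⊗ W -> LHom W W}) :
  (forall a b c, (F (tens a b) : {linear W -> W}) c =
     \∑(x, a' <- icoact a) a' ∗ iact (T x) c ∗ b) -> bijective F.
Proof.
move=> FE.
have ha := iact_bilin h A th; have hj := jmap_lin; have hc := icoact_lin h T A U.
pose g1 : {linear W -> W} := jl \o mk_lin (mulr_lin v).
pose g2 : {linear W -> W} := mk_lin (mulr_lin v') \o jlV.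
have g12 : cancel g1 g2 by move=> a /=; rewrite jmapK -pmulA drinfeldK pmul1r.
have g21 : cancel g2 g1 by move=> a /=; rewrite -pmulA drinfeldVK pmul1r jmapVK.
pose G0 (t : W ⊗ W) := \∑(a, b <- t) \∑(x, a' <- icoact a) tens a' (th x ∗ b).
pose G0V (t : W ⊗ W) := \∑(a, b <- t) \∑(x, a' <- icoact a) tens a' (th (T x) ∗ b).
have l0 : linear G0 by rewrite /G0; mlin.
have l0V : linear G0V by rewrite /G0V; mlin.
have E0 a b : G0 (tens a b) = \∑(x, a' <- icoact a) tens a' (th x ∗ b) by rewrite /G0 sw_tens.
have E0V a b : G0V (tens a b) = \∑(x, a' <- icoact a) tens a' (th (T x) ∗ b) by rewrite /G0V sw_tens.
have G0K : cancel G0 G0V.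
  apply: tens_lin_ext => // a b; rewrite E0 (sw_linear _ l0V).
  transitivity (\∑(x, a' <- icoact a) \∑(y, a'' <- icoact a') tens a'' (th (T y ∙ x) ∗ b)).
    by apply: eq_sw => x a'; rewrite E0V; apply: eq_sw => y a''; rewrite (d_thM d) pmulA.
  rewrite -(coact_coassoc ST TS d (F := fun x y a' => tens a' (th (T y ∙ x) ∗ b))) //.
  under eq_sw => x a' do (rewrite (ail ST TS _ (f := fun z => tens a' (th z ∗ b))) //).
  by rewrite (coact_coun TS d (F := fun a => tens a (th e1 ∗ b))) // (d_th1 d) pmul1l.
have G0VK : cancel G0V G0.
  apply: tens_lin_ext => // a b; rewrite E0V (sw_linear _ l0).
  transitivity (\∑(x, a' <- icoact a) \∑(y, a'' <- icoact a') tens a'' (th (y ∙ T x) ∗ b)).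
    by apply: eq_sw => x a'; rewrite E0; apply: eq_sw => y a''; rewrite (d_thM d) pmulA.
  rewrite -(coact_coassoc ST TS d (F := fun x y a' => tens a' (th (y ∙ T x) ∗ b))) //.
  under eq_sw => x a' do (rewrite (air ST TS _ (f := fun z => tens a' (th z ∗ b))) //).
  by rewrite (coact_coun TS d (F := fun a => tens a (th e1 ∗ b))) // (d_th1 d) pmul1l.
pose G : {linear W ⊗ W -> W ⊗ W} := (g1 ⊠ lid W) \o mk_lin l0.
have Gbij : bijective G.
  exists (G0V \o (g2 ⊠ lid W)) => t /=.
    by rewrite (tmap_cancel (g := lid W) (g' := lid W)) // G0K.
  by rewrite G0VK; exact: (tmap_cancel (g := lid W) (g' := lid W)).
suff -> : F = can \o G by exact: bij_comp can_bij Gbij.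
apply: tensor_lin_ext => a b; apply: lin_ext => c; rewrite FE /= E0.
rewrite (sw_lin (g1 ⊠ lid W)) (sw_lin can).
pose K t := (can (tmap g1 (lid W) t) : {linear W -> W}) c.
transitivity (\∑(x, a' <- icoact a) K (tens a' (th x ∗ b))); last first.
  by rewrite [RHS](sw_linear (fun g : LHom W W => (g : {linear W -> W}) c)).
transitivity (\∑(x, a' <- icoact a) \∑(x1, x2 <- Δ x) a' ∗ th (T x2) ∗ c ∗ th x1 ∗ b).
  apply: eq_sw => x a'; rewrite act_ai (sw_linear (fun z => a' ∗ z ∗ b)) //.
  by apply: eq_sw => x1 x2; rewrite !pmulA.
rewrite (coact_coassoc ST TS d (F := fun x1 x2 a' => a' ∗ th (T x2) ∗ c ∗ th x1 ∗ b)) //.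
apply: eq_sw => x a'; rewrite /K tliftE canE /= -coact_th.
rewrite (sw_linear (fun z => z ∗ c ∗ (th x ∗ b))) //.
by apply: eq_sw => y a''; rewrite !pmulA.
Qed.
End Azumaya.

(** * Tensor products of data *)

Section TensorDatum.
Variables (k : fieldType) (V : lmodType k) (h : phopf V) (T : {linear V -> V}).
Hypotheses (ST : cancel (pS h) T) (TS : cancel T (pS h)).
Implicit Types X Y : lmodType k.
Local Notation Δ := (pD h).
Local Notation ε := (pe h).
Local Notation S := (pS h).
Local Notation "x ∙ y" := (pmul h x y) (at level 39, left associativity).
Local Notation e1 := (pone h).
Variables (W W' Z : lmodType k) (A : palg W) (A' : palg W') (C : palg Z).
Local Notation "f ∗ g" := (pmul A f g) (at level 39, left associativity).
Local Notation "f ∗' g" := (pmul A' f g) (at level 39, left associativity).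
Local Notation "f ⋄ g" := (pmul C f g) (at level 39, left associativity).
Variables (al be : {linear V -> V}).
Hypotheses (al_mor : hopf_mor h al) (be_mor : hopf_mor h be).
Variables (th : {linear V -> W}) (U : V ⊗ W) (th' : {linear V -> W'}) (U' : V ⊗ W').
Hypotheses (d : datum h A al th U) (d' : datum h A' be th' U').
Variables (l : {linear W -> Z}) (r : {linear W' -> Z}).
Hypotheses (l1 : l (pone A) = pone C) (lM : forall f g, l (f ∗ g) = l f ⋄ l g).
Hypotheses (r1 : r (pone A') = pone C) (rM : forall f g, r (f ∗' g) = r f ⋄ r g).
Hypothesis lr : forall f g, l f ⋄ r g = r g ⋄ l f.
Local Notation act := (iact h A th).
Local Notation act' := (iact h A' th').
Local Notation coact := (icoact h T A U).
Local Notation coact' := (icoact h T A' U').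

Lemma thC_lin : linear (fun b => \∑(b1, b2 <- Δ b) l (th b1) ⋄ r (th' (al b2))).
Proof. by mlin. Qed.
Definition thC : {linear V -> Z} := mk_lin thC_lin.
Definition UC : V ⊗ Z := \∑(x, p <- U) \∑(y, q <- U') tens (x ∙ y) (l p ⋄ r q).

Lemma sw_UC X (F : V -> Z -> X) : bilin F ->
  \∑(x, p <- UC) F x p = \∑(x, p <- U) \∑(y, q <- U') F (x ∙ y) (l p ⋄ r q).
Proof.
move=> hF; rewrite /UC sw_sw //; apply: eq_sw => x p; rewrite sw_sw //.
by apply: eq_sw => y q; rewrite sw_tens.
Qed.

Lemma lrM f g f' g' : l f ⋄ r g ⋄ (l f' ⋄ r g') = l (f ∗ f') ⋄ r (g ∗' g').
Proof. by rewrite lM rM -!pmulA; congr (_ ⋄ _); rewrite !pmulA lr. Qed.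

(** Carrying b across [U] turns its last leg into al(b), on which th' is evaluated; carrying that
    across [U'] applies [be]. Hence the [al] inside [thC], and the order of the composite twist. *)
Lemma datum_tensor : datum h C (be \o al) thC UC.
Proof.
split.
- rewrite /= pD1 sw_tens //.
  by rewrite (hm1 al_mor) (d_th1 d) (d_th1 d') l1 r1 pmul1l.
- move=> x y /=; rewrite comul_pmul //.
  rewrite (sw_linear (fun z => z ⋄ thC y)) //.
  apply: eq_sw => a b; rewrite /= (sw_linear (fun z => l (th a) ⋄ r (th' (al b)) ⋄ z)) //.
  by apply: eq_sw => a' b'; rewrite lrM (hmM al_mor) (d_thM d) (d_thM d').
- move=> X F hF.
  rewrite sw_UC //.
  transitivity (\∑(x, p <- U) \∑(y, q <- U') \∑(x1, x2 <- Δ x) \∑(y1, y2 <- Δ y)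
      F (x1 ∙ y1) (x2 ∙ y2) (l p ⋄ r q)).
    by apply: eq_sw => x p; apply: eq_sw => y q; rewrite comul_pmul.
  under eq_sw => x p do rewrite sw_exch.
  rewrite (dU1 d (F := fun x1 x2 p => \∑(y, q <- U') \∑(y1, y2 <- Δ y)
      F (x1 ∙ y1) (x2 ∙ y2) (l p ⋄ r q))) //.
  transitivity (\∑(x, p <- U) \∑(x', p' <- U) \∑(y, q <- U') \∑(y', q' <- U')
      F (x ∙ y) (x' ∙ y') (l (p' ∗ p) ⋄ r (q' ∗' q))).
    apply: eq_sw => x p; apply: eq_sw => x' p'.
    by rewrite (dU1 d' (F := fun y1 y2 q => F (x ∙ y1) (x' ∙ y2) (l (p' ∗ p) ⋄ r q))).
  rewrite sw_UC //.
  apply: eq_sw => x p; rewrite sw_exch; apply: eq_sw => y q.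
  rewrite sw_UC //.
  apply: eq_sw => x' p'; apply: eq_sw => y' q'.
  by rewrite lrM.
- rewrite sw_UC //.
  transitivity (\∑(x, p <- U) (ε x : k) *: \∑(y, q <- U') (ε y : k) *: (l p ⋄ r q)).
    by apply: eq_sw => x p; rewrite swZ; apply: eq_sw => y q; rewrite peM scalerA.
  under eq_sw => x p do (rewrite (d_counU d' (f := fun q => l p ⋄ r q)) //).
  by rewrite (d_counU d (f := fun p => l p ⋄ r (pone A'))) ?l1 ?r1 ?pmul1l.
- move=> X F b hF; rewrite sw_UC //.
  transitivity (\∑(x, p <- U) \∑(b1, b2 <- Δ b) \∑(y, q <- U') \∑(c1, c2 <- Δ (al b2))
      F (x ∙ (y ∙ be c2)) (l (p ∗ th b1) ⋄ r (q ∗' th' c1))).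
    apply: eq_sw => x p; rewrite [RHS]sw_exch; apply: eq_sw => y q.
    transitivity (\∑(b12, b3 <- Δ b) \∑(b1, b2 <- Δ b12) F (x ∙ y ∙ be (al b3)) (l p ⋄ r q ⋄ (l (th b1) ⋄ r (th' (al b2))))).
      apply: eq_sw => b12 b3 /=.
      by rewrite (sw_linear (fun z => F (x ∙ y ∙ be (al b3)) (l p ⋄ r q ⋄ z))).
    rewrite (coassoc h (fun b1 b2 b3 => F (x ∙ y ∙ be (al b3)) (l p ⋄ r q ⋄ (l (th b1) ⋄ r (th' (al b2)))))) //.
    apply: eq_sw => b1 b'; rewrite (hm_comul al_mor) //.
    by apply: eq_sw => b2 b3; rewrite lrM pmulA.
  transitivity (\∑(x, p <- U) \∑(b1, b2 <- Δ b) \∑(c1, c2 <- Δ b2) \∑(y, q <- U')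
      F (x ∙ al c1 ∙ y) (l (p ∗ th b1) ⋄ r (th' (al c2) ∗' q))).
    apply: eq_sw => x p; apply: eq_sw => b1 b2.
    rewrite (dU3 d' (F := fun y q => F (x ∙ y) (l (p ∗ th b1) ⋄ r q))) // [RHS]sw_exch; apply: eq_sw => y q.
    rewrite (hm_comul al_mor) //.
    by apply: eq_sw => c1 c2; rewrite pmulA.
  transitivity (\∑(x, p <- U) \∑(b12, b3 <- Δ b) \∑(b1, b2 <- Δ b12) \∑(y, q <- U')
      F (x ∙ al b2 ∙ y) (l (p ∗ th b1) ⋄ r (th' (al b3) ∗' q))).
    apply: eq_sw => x p.
    by rewrite (coassoc h (fun b1 b2 b3 => \∑(y, q <- U')
      F (x ∙ al b2 ∙ y) (l (p ∗ th b1) ⋄ r (th' (al b3) ∗' q)))) //.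
  transitivity (\∑(b12, b3 <- Δ b) \∑(x, p <- U) \∑(b1, b2 <- Δ b12) \∑(y, q <- U')
      F (b1 ∙ x ∙ y) (l (th b2 ∗ p) ⋄ r (th' (al b3) ∗' q))).
    rewrite sw_exch; apply: eq_sw => b12 b3.
    by rewrite (dU3 d (F := fun x p => \∑(y, q <- U') F (x ∙ y) (l p ⋄ r (th' (al b3) ∗' q)))).
  rewrite sw_UC // sw_exch; apply: eq_sw => x p.
  rewrite (coassoc h (fun b1 b2 b3 => \∑(y, q <- U')
      F (b1 ∙ x ∙ y) (l (th b2 ∗ p) ⋄ r (th' (al b3) ∗' q)))) //.
  rewrite [RHS]sw_exch; apply: eq_sw => b1 b'; rewrite sw_exch; apply: eq_sw => y q.
  rewrite /= (sw_linear (fun z => F (b1 ∙ (x ∙ y)) (z ⋄ (l p ⋄ r q)))) //.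
  by apply: eq_sw => b2 b3; rewrite lrM pmulA.
Qed.

(* Conjugating the second factor by [x0] turns the braided tensor product of
   [A] and [A'] into the plain one, see [tau_conj]. *)
Let x0 : Z := \∑(x, p <- U) l p ⋄ r (th' x).
Let x0V : Z := \∑(x, p <- U) l p ⋄ r (th' (T x)).

Definition tau (t : W ⊗ W') : Z := \∑(f, g <- t) \∑(x, p <- U) l (f ∗ p) ⋄ r (act' (T x) g).
Lemma tau_lin : linear tau.
Proof. by have ha := (iact_bilin h A' th'); rewrite /tau; mlin. Qed.

Lemma x0VK : x0V ⋄ x0 = pone C.
Proof.
rewrite /x0V /x0 (sw_linear (fun z => z ⋄ x0)) //.
transitivity (\∑(x, p <- U) \∑(y, q <- U) l (p ∗ q) ⋄ r (th' (T x ∙ y))).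
  apply: eq_sw => x p; rewrite (sw_linear (fun z => l p ⋄ r (th' (T x)) ⋄ z)) //.
  by apply: eq_sw => y q; rewrite lrM (d_thM d').
rewrite (dU1r d (F := fun y x p => l p ⋄ r (th' (T x ∙ y)))) //.
under eq_sw => x p do (rewrite (ail ST TS _ (f := fun z => l p ⋄ r (th' z))) //).
by rewrite (d_counU d (f := fun p => l p ⋄ r (th' e1))) // (d_th1 d') l1 r1 pmul1l.
Qed.
Lemma x0K : x0 ⋄ x0V = pone C.
Proof.
rewrite {1}/x0 (sw_linear (fun z => z ⋄ x0V)) //.
transitivity (\∑(x, p <- U) \∑(y, q <- U) l (p ∗ q) ⋄ r (th' (x ∙ T y))).
  apply: eq_sw => x p; rewrite /x0V (sw_linear (fun z => l p ⋄ r (th' x) ⋄ z)) //.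
  by apply: eq_sw => y q; rewrite lrM (d_thM d').
rewrite (dU1r d (F := fun y x p => l p ⋄ r (th' (x ∙ T y)))) //.
under eq_sw => x p do (rewrite (air ST TS _ (f := fun z => l p ⋄ r (th' z))) //).
by rewrite (d_counU d (f := fun p => l p ⋄ r (th' e1))) // (d_th1 d') l1 r1 pmul1l.
Qed.

Lemma tauE f g : tau (tens f g) = \∑(x, p <- U) l (f ∗ p) ⋄ r (act' (T x) g).
Proof. by have ha := (iact_bilin h A' th'); rewrite /tau sw_tens //. Qed.

(** The action of T(x) on g is th'(T(x_2)) g th'(x_1); [dU1r] distributes its two outer factors over
    separate copies of [U], which form [x0V] and [x0]. *)
Lemma tau_conj f g : tau (tens f g) = l f ⋄ x0V ⋄ r g ⋄ x0.
Proof.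
rewrite tauE /x0V.
rewrite (sw_linear (fun z => l f ⋄ z ⋄ r g ⋄ x0)) //.
transitivity (\∑(x, p <- U) \∑(y, q <- U) l (f ∗ (p ∗ q)) ⋄ r (th' (T x) ∗' g ∗' th' y)).
  rewrite (dU1r d (F := fun y x p => l (f ∗ p) ⋄ r (th' (T x) ∗' g ∗' th' y))) //.
  apply: eq_sw => x p; rewrite (act_ai ST TS).
  by rewrite (sw_linear (fun z => l (f ∗ p) ⋄ r z)).
apply: eq_sw => x p; rewrite /x0 (sw_linear (fun z => l f ⋄ (l p ⋄ r (th' (T x))) ⋄ r g ⋄ z)) //.
apply: eq_sw => y q.
have -> : l f ⋄ (l p ⋄ r (th' (T x))) ⋄ r g = l (f ∗ p) ⋄ r (th' (T x) ∗' g).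
  by rewrite lM rM !pmulA.
by rewrite lrM pmulA.
Qed.

(** [x0] behaves as an R-matrix: by [dU3] it conjugates [thC] into the product of th' and th in the
    opposite order. *)
Lemma thC_x0V b : \∑(b1, b2 <- Δ b) x0V ⋄ (r (th' b1) ⋄ l (th b2)) = thC b ⋄ x0V.
Proof.
have E : \∑(b1, b2 <- Δ b) r (th' b1) ⋄ l (th b2) ⋄ x0 = x0 ⋄ thC b.
  transitivity (\∑(x, p <- U) \∑(b1, b2 <- Δ b) l (th b2 ∗ p) ⋄ r (th' (b1 ∙ x))).
    rewrite sw_exch; apply: eq_sw => b1 b2.
    rewrite /x0 (sw_linear (fun z => r (th' b1) ⋄ l (th b2) ⋄ z)) //.
    by apply: eq_sw => x p; rewrite -lr lrM (d_thM d').
  rewrite -(dU3 d (F := fun x p => l p ⋄ r (th' x))) // /x0 (sw_linear (fun z => z ⋄ thC b)) //.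
  apply: eq_sw => x p; rewrite /= (sw_linear (fun z => l p ⋄ r (th' x) ⋄ z)) //.
  by apply: eq_sw => b1 b2; rewrite lrM (d_thM d').
rewrite -[thC b in RHS](pmul1l C) -x0VK -(pmulA C x0V) -E.
rewrite (sw_linear (fun z => x0V ⋄ z ⋄ x0V)) //.
by apply: eq_sw => b1 b2; rewrite -!pmulA x0K pmul1r.
Qed.

(** By [th_cancel] it suffices to compare after multiplying by thC(b_2). Conjugation by [x0] makes
    thC act through th' and th separately, and [act_th] then applies to each factor. *)
Lemma tau_act b f g :
  tau (\∑(b1, b2 <- Δ b) tens (act b1 f) (act' b2 g)) = iact h C thC b (tau (tens f g)).
Proof.
have ha := iact_bilin h A th; have ha' := (iact_bilin h A' th'); have ht := tau_lin.
have hac := iact_bilin h C thC.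
move: b; apply: (th_cancel datum_tensor) => // b.
rewrite (act_th datum_tensor).
transitivity (\∑(b', b3 <- Δ b) \∑(b1, b2 <- Δ b') l (act b1 f) ⋄ x0V ⋄ r (act' b2 g) ⋄ (x0 ⋄ thC b3)).
  apply: eq_sw => b' b3; rewrite (sw_linear _ tau_lin) (sw_linear (fun z => z ⋄ thC b3)) //.
  by apply: eq_sw => b1 b2; rewrite tau_conj !pmulA.
have E b3 : x0 ⋄ thC b3 = \∑(c1, c2 <- Δ b3) r (th' c1) ⋄ l (th c2) ⋄ x0.
  rewrite -[LHS](pmul1r C) -x0VK pmulA -[x0 ⋄ thC b3 ⋄ x0V](pmulA C) -thC_x0V.
  rewrite (sw_linear (fun z => x0 ⋄ z ⋄ x0)) //.
  by apply: eq_sw => c1 c2; rewrite (pmulA C x0) x0K pmul1l.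
transitivity (\∑(b1, b' <- Δ b) \∑(b'', b4 <- Δ b') \∑(b2, b3 <- Δ b'')
    l (act b1 f) ⋄ x0V ⋄ r (act' b2 g ∗' th' b3) ⋄ l (th b4) ⋄ x0).
  rewrite (coassoc h (fun b1 b2 b3 => l (act b1 f) ⋄ x0V ⋄ r (act' b2 g) ⋄ (x0 ⋄ thC b3))) //.
  apply: eq_sw => b1 b'.
  rewrite (coassoc h (fun b2 b3 b4 => l (act b1 f) ⋄ x0V ⋄ r (act' b2 g ∗' th' b3) ⋄ l (th b4) ⋄ x0)) //.
  apply: eq_sw => b2 b3; rewrite E (sw_linear (fun z => l (act b1 f) ⋄ x0V ⋄ r (act' b2 g) ⋄ z)) //.
  by apply: eq_sw => c1 c2; rewrite rM !pmulA.
transitivity (\∑(b1, b' <- Δ b) l (act b1 f) ⋄ (thC b' ⋄ x0V) ⋄ r g ⋄ x0).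
  apply: eq_sw => b1 b'.
  rewrite -thC_x0V (sw_linear (fun z => l (act b1 f) ⋄ z ⋄ r g ⋄ x0)) //.
  apply: eq_sw => b2 b3.
  rewrite -(sw_linear (fun z => l (act b1 f) ⋄ x0V ⋄ r z ⋄ l (th b3) ⋄ x0)) //.
  by rewrite (act_th d') rM !pmulA -!(pmulA C _ (r g)) -lr !pmulA.
transitivity (\∑(b', b3 <- Δ b) \∑(b1, b2 <- Δ b') l (act b1 f ∗ th b2) ⋄ r (th' (al b3)) ⋄ x0V ⋄ r g ⋄ x0).
  rewrite (coassoc h (fun b1 b2 b3 => l (act b1 f ∗ th b2) ⋄ r (th' (al b3)) ⋄ x0V ⋄ r g ⋄ x0)) //.
  apply: eq_sw => b1 b'; rewrite /= (sw_linear (fun z => l (act b1 f) ⋄ (z ⋄ x0V) ⋄ r g ⋄ x0)) //.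
  by apply: eq_sw => b2 b3; rewrite lM !pmulA.
rewrite tau_conj /= (sw_linear (fun z => z ⋄ (l f ⋄ x0V ⋄ r g ⋄ x0))) //.
apply: eq_sw => b1 b2.
rewrite -(sw_linear (fun z => l z ⋄ r (th' (al b2)) ⋄ x0V ⋄ r g ⋄ x0)) //.
by rewrite (act_th d) lM !pmulA -!(pmulA C _ (l f)) lr !pmulA.
Qed.

(** The rule icoact f ⋆ U = U ⋆ (1 ⊗ f), with th' applied to the leg in B. *)
Lemma x0_l f : x0 ⋄ l f = \∑(z, f' <- coact f) l f' ⋄ r (th' z) ⋄ x0.
Proof.
transitivity (\∑(x, p <- U) l (p ∗ f) ⋄ r (th' x)).
  rewrite /x0 (sw_linear (fun z => z ⋄ l f)) //.
  by apply: eq_sw => x p; rewrite lM -!pmulA lr.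
rewrite -(sw_coactU ST TS d (F := fun x p => l p ⋄ r (th' x))) //.
apply: eq_sw => x p; rewrite /x0 (sw_linear (fun z => l p ⋄ r (th' x) ⋄ z)) //.
by apply: eq_sw => y q; rewrite lrM (d_thM d').
Qed.

(** Moving l(f') across [x0] creates the coaction of f' that occurs in the braiding; the factors
    th'(z) so obtained cancel against T(z) by coassociativity. *)
Lemma tau_mul f g f' g' :
  tau (\∑(z, f'' <- coact f') tens (f ∗ f'') (act' (T z) g ∗' g')) =
  tau (tens f g) ⋄ tau (tens f' g').
Proof.
have ha' := iact_bilin h A' th'; have ht := tau_lin; have hc := icoact_lin h T A U.
rewrite (sw_linear _ tau_lin).
transitivity (\∑(z, f'' <- coact f') l f ⋄ x0V ⋄ (l f'' ⋄ r (g ∗' th' z ∗' g')) ⋄ x0); last first.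
  rewrite !tau_conj !pmulA -!(pmulA C _ x0) x0_l.
  rewrite (sw_linear (fun z => l f ⋄ x0V ⋄ r g ⋄ z ⋄ x0V ⋄ r g' ⋄ x0)) //.
  apply: eq_sw => z f''; rewrite -!pmulA; congr (_ ⋄ (_ ⋄ _)).
  rewrite (pmulA C x0) x0K pmul1l !rM !pmulA lr -!pmulA.
  by [].
transitivity (\∑(z, f'' <- coact f') \∑(z', p <- coact f'')
   l f ⋄ x0V ⋄ (l p ⋄ r (th' z' ∗' act' (T z) g ∗' g')) ⋄ x0).
  apply: eq_sw => z f''; rewrite tau_conj lM.
  have E : l f'' ⋄ x0V = \∑(z', p <- coact f'') x0V ⋄ (l p ⋄ r (th' z')).
    rewrite -[LHS](pmul1l C) -x0VK -pmulA (pmulA C x0) x0_l.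
    rewrite (sw_linear (fun z => x0V ⋄ (z ⋄ x0V))) //.
    by apply: eq_sw => z' p; rewrite -pmulA x0K pmul1r.
  rewrite -(pmulA C (l f)) E.
  rewrite (sw_linear (fun u => l f ⋄ u ⋄ r (act' (T z) g ∗' g') ⋄ x0)) //.
  by apply: eq_sw => z' p; rewrite !rM !pmulA.
rewrite -(coact_coassoc ST TS d (F := fun z z' p =>
   l f ⋄ x0V ⋄ (l p ⋄ r (th' z' ∗' act' (T z) g ∗' g')) ⋄ x0)) //.
apply: eq_sw => z p.
transitivity (\∑(z', z3 <- Δ z) \∑(z1, z2 <- Δ z')
   l f ⋄ x0V ⋄ (l p ⋄ r (th' (z3 ∙ T z2) ∗' g ∗' th' z1 ∗' g')) ⋄ x0).
  apply: eq_sw => z' z3; rewrite (act_ai ST TS).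
  rewrite (sw_linear (fun u => l f ⋄ x0V ⋄ (l p ⋄ r (th' z3 ∗' u ∗' g')) ⋄ x0)) //.
  by apply: eq_sw => z1 z2; rewrite (d_thM d') !pmulA.
rewrite (coassoc h (fun z1 z2 z3 =>
   l f ⋄ x0V ⋄ (l p ⋄ r (th' (z3 ∙ T z2) ∗' g ∗' th' z1 ∗' g')) ⋄ x0)) //.
under eq_sw => z1 z'.
  rewrite (air ST TS _ (f := fun u => l f ⋄ x0V ⋄ (l p ⋄ r (th' u ∗' g ∗' th' z1 ∗' g')) ⋄ x0)) //.
  over.
rewrite (counr h _ (f := fun z1 => l f ⋄ x0V ⋄ (l p ⋄ r (th' e1 ∗' g ∗' th' z1 ∗' g')) ⋄ x0)) //.
by rewrite (d_th1 d') pmul1l.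
Qed.

Lemma tau_one : tau (tens (pone A) (pone A')) = pone C.
Proof. by rewrite tau_conj l1 r1 pmul1l pmul1r x0VK. Qed.

(** By [coact_uniq] both sides may be compared after multiplication by [UC], which avoids its
    inverse. The common form is the sum of the [Q], in which two copies of [U] have been merged into
    one. *)
Lemma tau_coact f g :
  icoact h T C UC (tau (tens f g)) =
  \∑(x, f' <- coact f) \∑(y, g' <- coact' g) tens (x ∙ y) (tau (tens f' g')).
Proof.
have ha' := iact_bilin h A' th'; have ht := tau_lin.
have hc := icoact_lin h T A U; have hc' := icoact_lin h T A' U'.
apply: (coact_uniq ST TS datum_tensor).
have hb := tpmul_bilin h C.
pose Q x f' y g' := \∑(v, q' <- U') \∑(w, s <- U) \∑(u, z <- Δ w)
  tens (x ∙ y ∙ u ∙ v) (l (f' ∗ s) ⋄ r (act' (T z) g' ∗' q')).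
transitivity (\∑(x, f' <- coact f) \∑(y, g' <- coact' g) Q x f' y g').
  rewrite (sw_linear (fun u => tpmul h C u UC)) //.
  apply: eq_sw => x f'; rewrite (sw_linear (fun u => tpmul h C u UC)) //.
  apply: eq_sw => y g'; rewrite /tpmul sw_tens //.
  rewrite sw_UC // sw_exch; apply: eq_sw => v q'.
  transitivity (\∑(z, p <- U) \∑(u, q <- U)
     tens (x ∙ y ∙ u ∙ v) (l (f' ∗ (p ∗ q)) ⋄ r (act' (T z) g' ∗' q'))).
    rewrite [RHS]sw_exch; apply: eq_sw => u q; rewrite tauE.
    rewrite (sw_linear (fun a => tens (x ∙ y ∙ (u ∙ v)) (a ⋄ (l q ⋄ r q')))) //.
    by apply: eq_sw => z p; rewrite lrM !pmulA.
  by rewrite (dU1r d (F := fun u z s =>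
     tens (x ∙ y ∙ u ∙ v) (l (f' ∗ s) ⋄ r (act' (T z) g' ∗' q')))) //.
symmetry; rewrite [LHS](_ : _ = \∑(u, q <- U) \∑(z, p <- U) \∑(v, q' <- U')
    tens (u ∙ v) (l (q ∗ f ∗ p) ⋄ r (q' ∗' act' (T z) g))); last first.
  rewrite /tpmul sw_UC //.
  apply: eq_sw => u q; rewrite [RHS]sw_exch; apply: eq_sw => v q'.
  rewrite sw_tens // tauE (sw_linear (fun a => tens (u ∙ v ∙ e1) (l q ⋄ r q' ⋄ a))) //.
  by apply: eq_sw => z p; rewrite lrM pmul1r !pmulA.
(* Moving T(z)·g across [U'] requires its coaction, which [sw_coact_act] expands into five legs of
   z. *)
transitivity (\∑(u, q <- U) \∑(z, p <- U) \∑(z', z3 <- Δ z) \∑(z1, z2 <- Δ z')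
    \∑(y, g' <- coact' g) \∑(v, q' <- U')
    tens (u ∙ T z3 ∙ y ∙ z1 ∙ v) (l (q ∗ f ∗ p) ⋄ r (act' (T z2) g' ∗' q'))).
  apply: eq_sw => u q; apply: eq_sw => z p.
  rewrite -(sw_coactU ST TS d' (F := fun v q' => tens (u ∙ v) (l (q ∗ f ∗ p) ⋄ r q'))) //.
  rewrite (sw_coact_act ST TS d' (F := fun x a' => \∑(v, q' <- U')
    tens (u ∙ (x ∙ v)) (l (q ∗ f ∗ p) ⋄ r (a' ∗' q')))) //.
  rewrite (comul_ai ST TS) //.
  transitivity (\∑(z1, z' <- Δ z) \∑(z2, z3 <- Δ z') \∑(y, g' <- coact' g) \∑(v, q' <- U')
    tens (u ∙ T z3 ∙ y ∙ z1 ∙ v) (l (q ∗ f ∗ p) ⋄ r (act' (T z2) g' ∗' q'))).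
    apply: eq_sw => z1 z'; rewrite (comul_ai ST TS) //.
    apply: eq_sw => z2 z3; apply: eq_sw => y g'; apply: eq_sw => v q'.
    by rewrite TS !pmulA.
  by rewrite -(coassoc h (fun z1 z2 z3 => \∑(y, g' <- coact' g) \∑(v, q' <- U')
    tens (u ∙ T z3 ∙ y ∙ z1 ∙ v) (l (q ∗ f ∗ p) ⋄ r (act' (T z2) g' ∗' q')))) //.
pose K z u f' s := \∑(z', z3 <- Δ z) \∑(z1, z2 <- Δ z')
    \∑(y, g' <- coact' g) \∑(v, q' <- U')
    tens (u ∙ T z3 ∙ y ∙ z1 ∙ v) (l (f' ∗ s) ⋄ r (act' (T z2) g' ∗' q')).
transitivity (\∑(z, p <- U) \∑(x, f' <- coact f) \∑(u, q <- U) K z (x ∙ u) f' (q ∗ p)).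
  rewrite sw_exch; apply: eq_sw => z p.
  rewrite -(sw_coactU ST TS d (F := fun u q => \∑(z', z3 <- Δ z) \∑(z1, z2 <- Δ z')
    \∑(y, g' <- coact' g) \∑(v, q' <- U')
    tens (u ∙ T z3 ∙ y ∙ z1 ∙ v) (l (q ∗ p) ⋄ r (act' (T z2) g' ∗' q')))) //.
  apply: eq_sw => x f'; apply: eq_sw => u q; rewrite /K.
  by do 4 (apply: eq_sw => ? ?); rewrite !pmulA.
rewrite sw_exch; apply: eq_sw => x f'.
have hK : forall f', trilin (fun z u s => K z (x ∙ u) f' s) by move=> f0; rewrite /K; mlin.
rewrite -(dU1 d (F := fun z u s => K z (x ∙ u) f' s)) //.
rewrite /Q; transitivity (\∑(w, s <- U) \∑(z1, z2 <- Δ w) \∑(y, g' <- coact' g) \∑(v, q' <- U')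
    tens (x ∙ y ∙ z1 ∙ v) (l (f' ∗ s) ⋄ r (act' (T z2) g' ∗' q'))); last first.
  transitivity (\∑(y, g' <- coact' g) \∑(w, s <- U) \∑(v, q' <- U') \∑(u, z <- Δ w)
      tens (x ∙ y ∙ u ∙ v) (l (f' ∗ s) ⋄ r (act' (T z) g' ∗' q'))); last first.
    by apply: eq_sw => y g'; rewrite sw_exch.
  rewrite [RHS]sw_exch; apply: eq_sw => w s.
  rewrite sw_exch; apply: eq_sw => y g'; rewrite sw_exch; by [].
apply: eq_sw => w s; rewrite /K.
rewrite (coassoc h (fun z' z3 u => \∑(z1, z2 <- Δ z')
    \∑(y, g' <- coact' g) \∑(v, q' <- U')
    tens (x ∙ u ∙ T z3 ∙ y ∙ z1 ∙ v) (l (f' ∗ s) ⋄ r (act' (T z2) g' ∗' q')))) //.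
transitivity (\∑(z', b <- Δ w) (ε b : k) *: \∑(z1, z2 <- Δ z')
    \∑(y, g' <- coact' g) \∑(v, q' <- U')
    tens (x ∙ y ∙ z1 ∙ v) (l (f' ∗ s) ⋄ r (act' (T z2) g' ∗' q'))); last first.
  by rewrite (counr h _ (f := fun z' => \∑(z1, z2 <- Δ z')
    \∑(y, g' <- coact' g) \∑(v, q' <- U')
    tens (x ∙ y ∙ z1 ∙ v) (l (f' ∗ s) ⋄ r (act' (T z2) g' ∗' q')))) //.
apply: eq_sw => z' b.
(* Merging the copies of [U] has made u and T(z_3) neighbouring legs of one element, so their
   product is a counit. *)
rewrite -[x in RHS](pmul1r h) -(air ST TS b (f := fun c => \∑(z1, z2 <- Δ z')
    \∑(y, g' <- coact' g) \∑(v, q' <- U')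
    tens (x ∙ c ∙ y ∙ z1 ∙ v) (l (f' ∗ s) ⋄ r (act' (T z2) g' ∗' q')))) //.
apply: eq_sw => z3 u; do 3 (apply: eq_sw => ? ?); by rewrite !pmulA.
Qed.

Hypothesis mult_bij : exists2 m : Z -> W ⊗ W',
  linear m & (forall f g, m (l f ⋄ r g) = tens f g) /\ (forall z, \∑(f, g <- m z) l f ⋄ r g = z).

(** [tau] is [twist] followed by the multiplication f ⊗ g -> l(f) r(g), and both are invertible. *)
Lemma tau_bij : bijective tau.
Proof.
have [m ml [mE Em]] := mult_bij.
have ha' := iact_bilin h A' th'.
have ht := twist_lin T A U ha'; have hu := untwist_lin T A U ha'.
pose lrl t := \∑(f, g <- t) l f ⋄ r g.
have lrll : linear lrl by rewrite /lrl; mlin.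
have mK : cancel lrl m.
  apply: tens_lin_ext => // f g.
  by rewrite /lrl sw_tens ?mE.
have tauF t : tau t = lrl (twist T A U act' t).
  rewrite /tau /lrl /twist sw_sw //.
  apply: eq_sw => f g; rewrite sw_sw //.
  by apply: eq_sw => x p; rewrite sw_tens.
exists (fun z => untwist T A U act' (m z)) => [t|z].
  by rewrite tauF mK (twistK ST TS d ha' (act1 d') (actM d')).
by rewrite tauF (untwistK ST TS d ha' (act1 d') (actM d')) /lrl Em.
Qed.
End TensorDatum.

(** * Uniqueness of the twist *)

Section Uniqueness.
Variables (k : fieldType) (V : lmodType k) (h : phopf V) (T : {linear V -> V}).
Hypotheses (ST : cancel (pS h) T) (TS : cancel T (pS h)).
Implicit Types X Y : lmodType k.
Local Notation Δ := (pD h).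
Local Notation ε := (pe h).
Local Notation S := (pS h).
Local Notation "x ∙ y" := (pmul h x y) (at level 39, left associativity).
Local Notation e1 := (pone h).
Variables (W : lmodType k) (A : palg W).
Local Notation "f ∗ g" := (pmul A f g) (at level 39, left associativity).
Local Notation "s ⋆ t" := (tpmul h A s t) (at level 39, left associativity).
Variables (al be : {linear V -> V}).
Variables (th th' : {linear V -> W}) (U U' : V ⊗ W).
Hypotheses (d : datum h A be th U) (d' : datum h A al th' U').
Hypothesis same_act : forall b f, iact h A th b f = iact h A th' b f.
Hypothesis same_coact : forall f, icoact h T A U f = icoact h T A U' f.
(** Triviality of the center of [A], with coefficients: Y = k produces the character, Y = B the
    group-like element. *)
Hypothesis central : forall Y (t : Y ⊗ W),
  (forall f, \∑(y, p <- t) tens y (p ∗ f) = \∑(y, p <- t) tens y (f ∗ p)) ->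
  exists y, t = tens y (pone A).
Variable phi : {linear W -> k^o}.
Hypothesis phi1 : phi (pone A) = 1 :> k.
Hypothesis grouplike_central : forall g, Δ g = tens g g -> ε g = 1 :> k -> forall x, g ∙ x = x ∙ g.
Hypothesis character_central : forall chi : {linear V -> k^o},
  chi e1 = 1 :> k -> (forall x y, chi (x ∙ y) = (chi x : k) * chi y :> k) ->
  forall x, \∑(a, b <- Δ x) (chi a : k) *: b = \∑(a, b <- Δ x) (chi b : k) *: a.

Definition chiW b : W := \∑(b1, b2 <- Δ b) th (S b1) ∗ th' b2.
Lemma chiW_lin : linear chiW. Proof. rewrite /chiW; mlin. Qed.

(** [chiW] is th^-1 * th' for convolution. As both maps induce one action, th'(b) f = Σ (b_1·f)
    th'(b_2), and th^-1 turns (b_1·f) back into f. *)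
Lemma chiW_comm b f : chiW b ∗ f = f ∗ chiW b.
Proof.
have ha := iact_bilin h A th.
have E c : \∑(b1, b2 <- Δ c) th (S b1) ∗ iact h A th b2 f = f ∗ th (S c).
  transitivity (\∑(b1, b' <- Δ c) \∑(b2, b3 <- Δ b') th (S b1) ∗ th b2 ∗ f ∗ th (S b3)).
    apply: eq_sw => b1 b2; rewrite /iact (sw_linear (fun z => th (S b1) ∗ z)) //.
    by apply: eq_sw => b3 b4; rewrite !pmulA.
  rewrite -(coassoc h (fun b1 b2 b3 => th (S b1) ∗ th b2 ∗ f ∗ th (S b3))) //.
  under eq_sw => b1 b2 do (rewrite (th_antl d (F := fun z => z ∗ f ∗ th (S b2))) //).
  by rewrite (counl h _ (f := fun c => pone A ∗ f ∗ th (S c))) ?pmul1l.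
transitivity (\∑(b1, b' <- Δ b) \∑(b2, b3 <- Δ b') th (S b1) ∗ iact h A th b2 f ∗ th' b3).
  rewrite /chiW (sw_linear (fun z => z ∗ f)) //.
  apply: eq_sw => b1 b2; rewrite -pmulA -(act_th d').
  rewrite (sw_linear (fun z => th (S b1) ∗ z)) //.
  by apply: eq_sw => b3 b4; rewrite same_act pmulA.
rewrite -(coassoc h (fun b1 b2 b3 => th (S b1) ∗ iact h A th b2 f ∗ th' b3)) //.
rewrite /chiW (sw_linear (fun z => f ∗ z)) //.
apply: eq_sw => b1 b2; rewrite -(sw_linear (fun z => z ∗ th' b2)) //.
by rewrite E pmulA.
Qed.

Definition chi : {linear V -> k^o} := phi \o mk_lin chiW_lin.
Lemma chiE b : chiW b = (chi b : k) *: pone A.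
Proof.
have [f|y E] := central (Y := k^o) (t := tens (1 : k^o) (chiW b)).
  rewrite !sw_tens; [by rewrite chiW_comm|mlin|mlin].
have {E} E : chiW b = (y : k) *: pone A.
  have := congr1 (@lun k W) E; rewrite !tliftE /= scale1r => ->.
  by [].
rewrite E; congr (_ *: _); rewrite /chi /= E linearZ /= phi1.
by rewrite [RHS]mulr1.
Qed.

Lemma th'E b : th' b = \∑(b1, b2 <- Δ b) (chi b2 : k) *: th b1.
Proof.
transitivity (\∑(b1, b' <- Δ b) \∑(b2, b3 <- Δ b') th b1 ∗ th (S b2) ∗ th' b3).
  rewrite -(coassoc h (fun b1 b2 b3 => th b1 ∗ th (S b2) ∗ th' b3)) //.
  under eq_sw => b1 b2 do (rewrite (th_antr d (F := fun z => z ∗ th' b2)) //).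
  by rewrite (counl h _ (f := fun c => pone A ∗ th' c)) ?pmul1l.
apply: eq_sw => b1 b'.
transitivity (th b1 ∗ chiW b').
  rewrite /chiW (sw_linear (fun z => th b1 ∗ z)) //.
  by apply: eq_sw => b2 b3; rewrite pmulA.
by rewrite chiE (linZ (fun z => th b1 ∗ z)) ?pmul1r.
Qed.

Lemma chi1 : chi e1 = 1 :> k.
Proof.
by rewrite /chi /= /chiW pD1 sw_tens // antip1 (d_th1 d) (d_th1 d') pmul1l.
Qed.

Lemma chiM x y : chi (x ∙ y) = (chi x : k) * chi y :> k.
Proof.
have E : chiW (x ∙ y) = (chi x : k) *: chiW y.
  rewrite {1}/chiW comul_pmul // sw_exch /chiW swZ; apply: eq_sw => c1 c2.
  transitivity (th (S c1) ∗ chiW x ∗ th' c2).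
    rewrite /chiW (sw_linear (fun z => th (S c1) ∗ z ∗ th' c2)) //.
    by apply: eq_sw => b1 b2; rewrite antipM (d_thM d) (d_thM d') !pmulA.
  rewrite chiE (linZ (fun z => th (S c1) ∗ z ∗ th' c2)) ?pmul1r //.
by rewrite /chi /= E linearZ.
Qed.

(** U^-1 U' commutes with 1 ⊗ A, because conjugations by [U] and by [U'] agree there. *)
Lemma U'_exists : exists g, U' = U ⋆ tens g (pone A).
Proof.
have hb := tpmul_bilin h A.
pose t := Uinv T U ⋆ U'.
have [f|g E] := central (t := t); last first.
  by exists g; rewrite -E /t (tmA h A) (UK ST TS d).
have l (s : V ⊗ W) : \∑(y, p <- s) tens y (p ∗ f) = s ⋆ tens e1 f.
  by rewrite /tpmul; apply: eq_sw => y p; rewrite sw_tens ?pmul1r.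
have r (s : V ⊗ W) : \∑(y, p <- s) tens y (f ∗ p) = tens e1 f ⋆ s.
  rewrite /tpmul sw_tens //.
  by apply: eq_sw => y p; rewrite pmul1l.
rewrite l r -[LHS](UinvK ST TS d) -[RHS](UinvK ST TS d) -!(tmA h A (Uinv T U) U); congr (_ ⋆ _).
rewrite /t !(tmA h A) (UK ST TS d).
rewrite -(coactU ST TS d') -same_coact -(coactU ST TS d).
by rewrite -(tmA h A _ U (Uinv T U)) (UUinv ST TS d) tm1r.
Qed.

Section Grouplike.
Variable g : V.
Hypothesis U'g : U' = U ⋆ tens g (pone A).

Lemma sw_U' X (F : V -> W -> X) : bilin F ->
  \∑(x, p <- U') F x p = \∑(x, p <- U) F (x ∙ g) p.
Proof.
move=> hF; rewrite U'g tpmul_sw //; apply: eq_sw => x p.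
by rewrite sw_tens ?pmul1r.
Qed.

(* The element [U] can be cancelled on the left in [B ⊗ B ⊗ A]. *)
Let K a b p := \∑(y, q <- U) \∑(t1, t2 <- Δ (T y)) tens (tens (t1 ∙ a) (t2 ∙ b)) (q ∗ p).
Lemma K_cancel c1 c2 :
  \∑(x, p <- U) \∑(x1, x2 <- Δ x) K (x1 ∙ c1) (x2 ∙ c2) p = tens (tens c1 c2) (pone A).
Proof.
transitivity (\∑(x, p <- U) \∑(y, q <- U) \∑(s1, s2 <- Δ (T y ∙ x))
   tens (tens (s1 ∙ c1) (s2 ∙ c2)) (q ∗ p)).
  apply: eq_sw => x p; rewrite /K sw_exch; apply: eq_sw => y q.
  rewrite sw_exch comul_pmul //.
  by do 2 (apply: eq_sw => ? ?); rewrite !pmulA.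
rewrite -(dU1 d (F := fun x y r => \∑(s1, s2 <- Δ (T y ∙ x))
   tens (tens (s1 ∙ c1) (s2 ∙ c2)) r)) //.
under eq_sw => x p.
  rewrite (ail ST TS _ (f := fun z => \∑(s1, s2 <- Δ z)
   tens (tens (s1 ∙ c1) (s2 ∙ c2)) p)) //.
  over.
rewrite (d_counU d (f := fun p => \∑(s1, s2 <- Δ e1)
   tens (tens (s1 ∙ c1) (s2 ∙ c2)) p)) //.
by rewrite pD1 sw_tens // !pmul1l.
Qed.

(** (Δ ⊗ id)(U') is computed from U' = U (g ⊗ 1) and from [dU1]. The results contain the same factor
    (Δ ⊗ id)(U), which [K] cancels, and [phi] strips the unit of [A]. *)
Lemma g_grouplike : Δ g = tens g g.
Proof.
have hK : trilin K by rewrite /K; mlin.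
have E : \∑(g1, g2 <- Δ g) tens (tens g1 g2) (pone A) = tens (tens g g) (pone A).
  transitivity (\∑(g1, g2 <- Δ g) \∑(x, p <- U) \∑(x1, x2 <- Δ x) K (x1 ∙ g1) (x2 ∙ g2) p).
    by apply: eq_sw => g1 g2; rewrite K_cancel.
  rewrite -K_cancel.
  rewrite (dU1 d (F := fun x1 x2 p => K (x1 ∙ g) (x2 ∙ g) p)) //.
  transitivity (\∑(x, p <- U') \∑(x1, x2 <- Δ x) K x1 x2 p).
    rewrite sw_U' // sw_exch; apply: eq_sw => x p; rewrite comul_pmul //.
    by rewrite sw_exch.
  rewrite (dU1 d') // sw_U' //.
  by apply: eq_sw => x p; rewrite sw_U'.
pose f (t : (V ⊗ V) ⊗ W) := \∑(s, p <- t) (phi p : k) *: s.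
have hf : linear f by rewrite /f; mlin.
have fE s : f (tens s (pone A)) = s by rewrite /f sw_tens ?phi1 ?scale1r.
have := congr1 f E; rewrite fE => <-; rewrite (sw_linear _ hf) -[LHS]sw_id.
by apply: eq_sw => g1 g2; rewrite fE.
Qed.

Lemma g_eps : ε g = 1 :> k.
Proof.
have := dU2 d'; rewrite sw_U' //.
under eq_sw => x p do rewrite peM -scalerA.
rewrite (d_counU d (f := fun p => (ε g : k) *: p)) //.
by move/(congr1 phi); rewrite linearZ /= phi1 => <-; rewrite [RHS]mulr1.
Qed.

(** Inserting th' = th * chi and U' = U (g ⊗ 1) into the condition for (th', U'), and using that for
    (th, U), shows that the difference [D] vanishes behind [U] and th ([step1]). Then [U] is
    cancelled by its inverse ([step2]), th by convolution with th ∘ S ([step3]), and [phi] strips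
    the unit. *)
Lemma twists_agree b : \∑(b1, b2 <- Δ b) (chi b1 : k) *: (g ∙ al b2) =
  \∑(b1, b2 <- Δ b) (chi b2 : k) *: (be b1 ∙ g).
Proof.
pose D b := \∑(b1, b2 <- Δ b) (chi b1 : k) *: (g ∙ al b2) - \∑(b1, b2 <- Δ b) (chi b2 : k) *: (be b1 ∙ g).
have Dl : linear D.
  have l1 : linear (fun b => \∑(b1, b2 <- Δ b) (chi b1 : k) *: (g ∙ al b2)) by mlin.
  have l2 : linear (fun b => \∑(b1, b2 <- Δ b) (chi b2 : k) *: (be b1 ∙ g)) by mlin.
  by move=> a x y; rewrite /D l1 l2 scalerBr opprD addrACA.
suff : D b = 0 by move/eqP; rewrite subr_eq0 => /eqP.
have step1 X (F : V -> W -> X) c : bilin F ->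
    \∑(x, p <- U) \∑(b1, b2 <- Δ c) F (x ∙ D b2) (p ∗ th b1) = 0.
  move=> hF.
  have -> : \∑(x, p <- U) \∑(b1, b2 <- Δ c) F (x ∙ D b2) (p ∗ th b1) =
     \∑(x, p <- U) \∑(b1, b' <- Δ c) \∑(b2, b3 <- Δ b') (chi b2 : k) *: F (x ∙ (g ∙ al b3)) (p ∗ th b1) -
     \∑(x, p <- U) \∑(b1, b' <- Δ c) \∑(b2, b3 <- Δ b') (chi b3 : k) *: F (x ∙ (be b2 ∙ g)) (p ∗ th b1).
    rewrite -scaleN1r swZ swD; apply: eq_sw => x p; rewrite swZ swD; apply: eq_sw => b1 b'.
    have lF : linear (fun z => F (x ∙ z) (p ∗ th b1)) by mlin.
    rewrite scaleN1r /D; set s := sw _ _; set s' := sw _ _.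
    rewrite -[s - s']addrC -scaleN1r lF scaleN1r addrC; congr (_ - _).
      rewrite /s (sw_linear _ lF); apply: eq_sw => b2 b3.
      by rewrite (linZ _ lF).
    rewrite /s' (sw_linear _ lF); apply: eq_sw => b2 b3.
    by rewrite (linZ _ lF).
  apply/eqP; rewrite subr_eq0; apply/eqP.
  transitivity (\∑(x, p <- U') \∑(b1, b2 <- Δ c) F (x ∙ al b2) (p ∗ th' b1)).
    rewrite sw_U' //.
    apply: eq_sw => x p.
    rewrite -(coassoc h (fun b1 b2 b3 => (chi b2 : k) *: F (x ∙ (g ∙ al b3)) (p ∗ th b1))) //.
    apply: eq_sw => b1 b2; rewrite th'E (sw_linear (fun z => F (x ∙ g ∙ al b2) (p ∗ z))) //.
    apply: eq_sw => b3 b4; rewrite (linZ (fun z => F (x ∙ g ∙ al b2) (p ∗ z))) //.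
    by rewrite pmulA.
  rewrite (dU3 d') // sw_U' //.
  transitivity (\∑(b', b3 <- Δ c) \∑(x, p <- U) \∑(b1, b2 <- Δ b') (chi b3 : k) *: F (x ∙ be b2 ∙ g) (p ∗ th b1)); last first.
    rewrite sw_exch; apply: eq_sw => x p.
    rewrite (coassoc h (fun b1 b2 b3 => (chi b3 : k) *: F (x ∙ be b2 ∙ g) (p ∗ th b1))) //.
    by do 2 (apply: eq_sw => ? ?); rewrite pmulA.
  transitivity (\∑(b', b3 <- Δ c) \∑(x, p <- U) \∑(b1, b2 <- Δ b') (chi b3 : k) *: F (b1 ∙ x ∙ g) (th b2 ∗ p)); last first.
    apply: eq_sw => b' b3.
    by rewrite (dU3 d (F := fun x p => (chi b3 : k) *: F (x ∙ g) p)).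
  rewrite [RHS]sw_exch; apply: eq_sw => x p.
  rewrite (coassoc h (fun b1 b2 b3 => (chi b3 : k) *: F (b1 ∙ x ∙ g) (th b2 ∗ p))) //.
  apply: eq_sw => b1 b2; rewrite th'E (sw_linear (fun z => F (b1 ∙ (x ∙ g)) (z ∗ p))) //.
  apply: eq_sw => b3 b4; rewrite (linZ (fun z => F (b1 ∙ (x ∙ g)) (z ∗ p))) //.
  by rewrite pmulA.
have step2 c : \∑(b1, b2 <- Δ c) tens (D b2) (th b1) = 0.
  rewrite -[RHS](step1 _ (fun a r => \∑(y, q <- U) tens (T y ∙ a) (q ∗ r)) c) //.
  symmetry; rewrite sw_exch; apply: eq_sw => b1 b2.
  transitivity (\∑(x, p <- U) \∑(y, q <- U) tens (T y ∙ x ∙ D b2) (q ∗ p ∗ th b1)).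
    by do 2 (apply: eq_sw => ? ?); rewrite !pmulA.
  rewrite -(dU1 d (F := fun x y r => tens (T y ∙ x ∙ D b2) (r ∗ th b1))) //.
  under eq_sw => x p.
    rewrite (ail ST TS _ (f := fun z => tens (z ∙ D b2) (p ∗ th b1))) //.
    over.
  by rewrite (d_counU d (f := fun p => tens (e1 ∙ D b2) (p ∗ th b1))) // !pmul1l.
have step3 : tens (D b) (pone A) = 0.
  transitivity (\∑(b1, b' <- Δ b) \∑(b2, b3 <- Δ b') tens (D b3) (th (S b1) ∗ th b2)).
    rewrite -(coassoc h (fun b1 b2 b3 => tens (D b3) (th (S b1) ∗ th b2))) //.
    under eq_sw => b1 b2 do (rewrite (th_antl d (F := fun z => tens (D b2) z)) //).
    by rewrite (counl h _ (f := fun b => tens (D b) (pone A))).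
  rewrite /sw /bsum_tens /bsum; apply: big1 => s _.
  pose G (t : V ⊗ W) := \∑(a, p <- t) tens a (th (S s.1) ∗ p).
  have Gl : linear G by rewrite /G; mlin.
  transitivity (G (\∑(b1, b2 <- Δ s.2) tens (D b2) (th b1))).
    rewrite (sw_linear _ Gl); apply: eq_bigr => q _.
    by rewrite /G sw_tens.
  by rewrite step2 lin0.
pose f (t : V ⊗ W) := \∑(s, p <- t) (phi p : k) *: s.
have hf : linear f by rewrite /f; mlin.
have := congr1 f step3; rewrite (lin0 hf) => <-.
by rewrite /f sw_tens ?phi1 ?scale1r.
Qed.

(** Centrality of g and of chi brings both sides of [twists_agree] to the same shape, so that [al]
    and [be] have equal transforms u -> chi * (g u). *)
Lemma al_be_grouplike b : al b = be b.
Proof.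
have gc := grouplike_central g_grouplike g_eps.
have cc := character_central chi1 chiM.
have Sg : S g ∙ g = e1.
  have := pSl h g; rewrite g_grouplike sw_tens //.
  by rewrite g_eps scale1r.
have E c : \∑(b1, b2 <- Δ c) (chi b1 : k) *: (g ∙ al b2) = \∑(b1, b2 <- Δ c) (chi b1 : k) *: (g ∙ be b2).
  rewrite twists_agree.
  transitivity (g ∙ be (\∑(b1, b2 <- Δ c) (chi b2 : k) *: b1)).
    rewrite (sw_linear (fun z => g ∙ be z)) //.
    apply: eq_sw => b1 b2; rewrite (linZ (fun z => g ∙ be z)) ?gc //.
  rewrite -cc (sw_linear (fun z => g ∙ be z)) //.
  by apply: eq_sw => b1 b2; rewrite (linZ (fun z => g ∙ be z)).
(* The transform is inverted by chi ∘ S and S(g). *)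
have key (u : {linear V -> V}) : u b =
    \∑(b1, b' <- Δ b) (chi (S b1) : k) *: (S g ∙ \∑(b2, b3 <- Δ b') (chi b2 : k) *: (g ∙ u b3)).
  transitivity (\∑(b1, b' <- Δ b) \∑(b2, b3 <- Δ b') (chi (S b1 ∙ b2) : k) *: u b3).
    rewrite -(coassoc h (fun b1 b2 b3 => (chi (S b1 ∙ b2) : k) *: u b3)) //.
    under eq_sw => b1 b2 do (rewrite (antl h _ (f := fun z => (chi z : k) *: u b2)) //).
    by rewrite (counl h _ (f := fun b => (chi e1 : k) *: u b)) ?chi1 ?scale1r.
  apply: eq_sw => b1 b'; rewrite (sw_linear (fun z => (chi (S b1) : k) *: (S g ∙ z))) //.
  apply: eq_sw => b2 b3; rewrite (linZ (fun z => S g ∙ z)) //.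
  by rewrite pmulA Sg pmul1l chiM scalerA.
by rewrite (key al) (key be); apply: eq_sw => b1 b'; rewrite E.
Qed.
End Grouplike.

Lemma datum_uniq b : al b = be b.
Proof. by have [g hg] := U'_exists; exact: al_be_grouplike hg b. Qed.
End Uniqueness.

(** * Endomorphism algebras *)

Section EndAlgebra.
Variable k : fieldType.
Implicit Types M N X Y : lmodType k.

Definition emul M (f g : LHom M M) : LHom M M := lcomp f g.
Fact emul_bilin M : bilin (@emul M).
Proof.
split=> [g a f f'|f a g g']; apply: lin_ext => m //=.
exact: (linearP (f : {linear M -> M})).
Qed.
Fact emulA M : associative (@emul M).
Proof. by move=> f g p; exact: lin_ext. Qed.
Fact emul1l M : left_id (lid M : LHom M M) (@emul M).
Proof. by move=> f; exact: lin_ext. Qed.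
Fact emul1r M : right_id (lid M : LHom M M) (@emul M).
Proof. by move=> f; exact: lin_ext. Qed.
Definition pend M : palg (LHom M M) := PAlg (@emul_bilin M) (@emulA M) (@emul1l M) (@emul1r M).

Lemma pendE M (f g : LHom M M) (m : M) :
  (pmul (pend M) f g : {linear M -> M}) m = (f : {linear M -> M}) ((g : {linear M -> M}) m).
Proof. by []. Qed.

Fact rank1_linear M N (phi : LHom M k^o) (x : N) :
  linear (fun m => ((phi : {linear M -> k^o}) m : k) *: x).
Proof. by mlin. Qed.
Definition rank1 M N (x : N) (phi : LHom M k^o) : LHom M N := mk_lin (rank1_linear phi x).
Lemma rank1E M N (x : N) (phi : LHom M k^o) m :
  (rank1 x phi : {linear M -> N}) m = ((phi : {linear M -> k^o}) m : k) *: x.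
Proof. by []. Qed.
Lemma rank1_bilin M N : bilin (@rank1 M N).
Proof.
split=> [phi a x y|x a phi psi]; apply: lin_ext => m /=.
  by rewrite scalerDr !scalerA mulrC.
by rewrite scalerDl scalerA.
Qed.

Lemma lhomE M N (f g : LHom M N) :
  (forall m, (f : {linear M -> N}) m = (g : {linear M -> N}) m) -> f = g.
Proof. exact: lin_ext. Qed.

Lemma lhom_sum M N n (F : 'I_n -> LHom M N) m :
  ((\sum_i F i : LHom M N) : {linear M -> N}) m = \sum_i (F i : {linear M -> N}) m.
Proof. by rewrite (linsum (fun f : LHom M N => (f : {linear M -> N}) m)) //. Qed.

Lemma fin_dim_span (I : finType) X (e : I -> X) :
  (forall u, exists c : I -> k, u = \sum_i c i *: e i) -> fin_dim X.
Proof.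
move=> he; exists #|I|, (fun i => e (enum_val i)) => u; have [c ->] := he u.
exists (fun i => c (enum_val i)).
by rewrite (reindex_onto enum_val enum_rank) => [|i _]; rewrite ?enum_rankK //;
   apply: eq_bigl => i; rewrite enum_valK eqxx.
Qed.

Section DualBasis.
Variables (M : lmodType k) (n : nat) (e : 'I_n -> M) (c : 'I_n -> {linear M -> k^o}).
Hypothesis ec : dual_basis e c.

Lemma rank1_sum N (f : LHom M N) : \sum_i rank1 ((f : {linear M -> N}) (e i)) (c i) = f.
Proof.
apply: lhomE => m; rewrite lhom_sum.
by rewrite -[RHS](db_exp ec).
Qed.

(** The identification of Y ⊗ Hom(M, N) with Hom(M, Y ⊗ N) for finite-dimensional M. Its inverse
    [htens] turns a coaction M -> B ⊗ M into the element U of B ⊗ End(M). *)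
Definition tev N Y (t : Y ⊗ LHom M N) (m : M) : Y ⊗ N := \∑(y, f <- t) tens y ((f : {linear M -> N}) m).
Definition htens N Y (lam : M -> Y ⊗ N) : Y ⊗ LHom M N :=
  \sum_i \∑(y, x <- lam (e i)) tens y (rank1 x (c i)).

Lemma tev_lin N Y m : linear (fun t : Y ⊗ LHom M N => tev t m).
Proof. by rewrite /tev; mlin. Qed.
Lemma tev_lin2 N Y (t : Y ⊗ LHom M N) : linear (tev t).
Proof. by rewrite /tev; mlin. Qed.

Lemma sw_rank1_lin N Y i : linear (fun t : Y ⊗ N => \∑(y, x <- t) tens y (rank1 x (c i))).
Proof. by have h := @rank1_bilin M N; mlin. Qed.

Lemma htensK N Y (lam : M -> Y ⊗ N) m : linear lam -> tev (htens lam) m = lam m.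
Proof.
move=> hl; rewrite /htens (linsum (fun t => tev t m)); last exact: tev_lin.
rewrite -[RHS](db_exp ec) //; apply: eq_bigr => i _.
rewrite (sw_linear (fun t => tev t m)); last exact: tev_lin.
rewrite -[in RHS](sw_id (lam (e i))) swZ; apply: eq_sw => y x.
by rewrite /tev sw_tens // rank1E (linZ (tens y)).
Qed.

Lemma htens_tev N Y (t : Y ⊗ LHom M N) : htens (tev t) = t.
Proof.
have hr i := sw_rank1_lin (N := N) (Y := Y) i.
have l : linear (fun t : Y ⊗ LHom M N => htens (tev t)).
  move=> a s s'; rewrite /htens scaler_sumr -big_split; apply: eq_bigr => i _ /=.
  have -> : tev (a *: s + s') (e i) = a *: tev s (e i) + tev s' (e i) by exact: tev_lin.
  exact: hr.
move: t; apply: tens_lin_ext => // y f; rewrite /htens.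
rewrite -[in RHS](rank1_sum f) (linsum (tens y)) //.
apply: eq_bigr => i _; rewrite /tev (sw_linear _ (hr i)) sw_tens.
  by rewrite sw_tens //; have h := @rank1_bilin M N; mlin.
by have h := @rank1_bilin M N; mlin.
Qed.

Lemma tev_inj N Y (s t : Y ⊗ LHom M N) : (forall m, tev s m = tev t m) -> s = t.
Proof.
move=> st; rewrite -(htens_tev s) -(htens_tev t) /htens.
by apply: eq_bigr => i _; rewrite st.
Qed.

Lemma sw_tev N Y X (t : Y ⊗ LHom M N) m (F : Y -> N -> X) : bilin F ->
  \∑(y, x <- tev t m) F y x = \∑(y, f <- t) F y ((f : {linear M -> N}) m).
Proof.
move=> hF; rewrite /tev sw_sw //; apply: eq_sw => y f.
by rewrite sw_tens.
Qed.

Lemma fin_dim_LHom N : fin_dim N -> fin_dim (LHom M N).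
Proof.
case/fin_dim_dual_basis => n' [e' [c' ec']].
apply: (fin_dim_span (e := fun p : 'I_n * 'I_n' => rank1 (e' p.2) (c p.1))) => f.
exists (fun p => (c' p.2 ((f : {linear M -> N}) (e p.1)) : k)).
rewrite -[LHS]rank1_sum -(pair_bigA _ (fun i j => (c' j ((f : {linear M -> N}) (e i)) : k) *: rank1 (e' j) (c i))).
apply: eq_bigr => i _ /=; have h := @rank1_bilin M N.
by rewrite -[LHS](db_exp ec' (f := fun x => rank1 x (c i))).
Qed.

Lemma fin_dim_tens N : fin_dim N -> fin_dim (M ⊗ N).
Proof.
case/fin_dim_dual_basis => n' [e' [c' ec']].
apply: (fin_dim_span (e := fun p : 'I_n * 'I_n' => tens (e p.1) (e' p.2))) => t.
exists (fun p => (\∑(a, b <- t) (c p.1 a : k) *: c' p.2 b : k^o) : k).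
rewrite -(pair_bigA _ (fun i j => (\∑(a, b <- t) (c i a : k) *: c' j b : k) *: tens (e i) (e' j))) /=.
rewrite -[LHS]sw_id.
transitivity (\∑(a, b <- t) \sum_i \sum_j (c i a : k) *: ((c' j b : k) *: tens (e i) (e' j))).
  apply: eq_sw => a b; rewrite -(db_exp ec (f := fun a => tens a b)) //.
  apply: eq_bigr => i _; rewrite -scaler_sumr; congr (_ *: _).
  by rewrite -(db_exp ec' (f := fun b => tens (e i) b)).
rewrite /sw /bsum_tens /bsum exchange_big; apply: eq_bigr => i _.
rewrite exchange_big; apply: eq_bigr => j _; rewrite scaler_suml; apply: eq_bigr => p _.
by rewrite scalerA.
Qed.

Fact sandwich_lin1 (a b : LHom M M) : linear (fun x => pmul (pend M) (pmul (pend M) a x) b).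
Proof. by mlin. Qed.
Fact sandwich_bilin : bilin (fun a b => mk_lin (sandwich_lin1 a b) : LHom (LHom M M) (LHom M M)).
Proof.
split=> [b|a] u x y; apply: lin_ext => f /=.
  have l : linear (fun a => pmul (pend M) (pmul (pend M) a f) b) by mlin.
  exact: l.
have l : linear (fun b => pmul (pend M) (pmul (pend M) a f) b) by mlin.
exact: l.
Qed.
Definition sandwich : {linear LHom M M ⊗ LHom M M -> LHom (LHom M M) (LHom M M)} := tlift sandwich_bilin.
Lemma sandwichE a b x : (sandwich (tens a b) : {linear _ -> _}) x = pmul (pend M) (pmul (pend M) a x) b.
Proof. by rewrite /sandwich tliftE. Qed.

(** A map F is recovered from its values on the matrix units E_ij = e_i ⊗ c_j: the preimage is the
    sum of (F(E_ij) e_q ⊗ c_i) ⊗ E_jq. *)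
Lemma sandwich_bij : bijective sandwich.
Proof.
pose g (F : LHom (LHom M M) (LHom M M)) : LHom M M ⊗ LHom M M :=
  \sum_i \sum_j \sum_q tens (rank1 (((F : {linear _ -> _}) (rank1 (e i) (c j)) : {linear M -> M}) (e q)) (c i))
                            (rank1 (e j) (c q)).
have gl : linear g.
  move=> a F G; rewrite /g !scaler_sumr -big_split; apply: eq_bigr => i _ /=.
  rewrite !scaler_sumr -big_split; apply: eq_bigr => j _ /=.
  rewrite !scaler_sumr -big_split; apply: eq_bigr => q _ /=.
  by rewrite (rank1_bilin M M).1 tensl.
have hr := @rank1_bilin M M.
exists g => [t|F].
  move: t; apply: tens_lin_ext; [by mlin|by mlin|] => a b.
  have E i j q : ((sandwich (tens a b) : {linear _ -> _}) (rank1 (e i) (c j)) : {linear M -> M}) (e q) =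
      (c j ((b : {linear M -> M}) (e q)) : k) *: (a : {linear M -> M}) (e i).
    by rewrite sandwichE !pendE rank1E linearZ.
  rewrite /g; under eq_bigr => i _ do under eq_bigr => j _ do under eq_bigr => q _ do rewrite E.
  rewrite -[in RHS](rank1_sum a) (linsum (fun a => tens a b)) //.
  apply: eq_bigr => i _; rewrite exchange_big.
  rewrite -[in RHS](rank1_sum b) (linsum (fun b => tens (rank1 _ _) b)) //.
  apply: eq_bigr => q _.
  transitivity (\sum_j (c j ((b : {linear M -> M}) (e q)) : k) *:
      tens (rank1 ((a : {linear M -> M}) (e i)) (c i)) (rank1 (e j) (c q))).
    by apply: eq_bigr => j _; rewrite (linZ (fun x => tens (rank1 x _) _)).
  by rewrite (db_exp ec (f := fun x => tens (rank1 _ _) (rank1 x (c q)))).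
apply: lhomE => x; apply: lhomE => m.
have Kl : linear (fun t => ((sandwich t : {linear _ -> _}) x : {linear M -> M}) m) by mlin.
rewrite /g (linsum _ Kl).
transitivity (\sum_i \sum_j (c i ((x : {linear M -> M}) (e j)) : k) *:
    ((F : {linear _ -> _}) (rank1 (e i) (c j)) : {linear M -> M}) m).
  apply: eq_bigr => i _; rewrite (linsum _ Kl); apply: eq_bigr => j _; rewrite (linsum _ Kl).
  rewrite -[in RHS](db_exp ec m (f := (F : {linear _ -> _}) (rank1 (e i) (c j)) : {linear M -> M})) //.
  rewrite scaler_sumr; apply: eq_bigr => q _.
  by rewrite sandwichE !pendE !rank1E !linearZ /= !scalerA.
rewrite exchange_big.
have Fl : linear (fun y : LHom M M => ((F : {linear _ -> _}) y : {linear M -> M}) m) by mlin.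
rewrite -[in RHS](rank1_sum x) (linsum _ Fl); apply: eq_bigr => j _.
by rewrite -(db_exp ec ((x : {linear M -> M}) (e j)) (f := fun y => ((F : {linear _ -> _}) (rank1 y (c j)) : {linear M -> M}) m)).
Qed.

(* Commuting with the rank-one maps [m ⊗ c_i0] forces [t(m) = y ⊗ m]. *)
Lemma pend_central (i0 : 'I_n) Y (t : Y ⊗ LHom M M) :
  (forall f, \∑(y, p <- t) tens y (pmul (pend M) p f) = \∑(y, p <- t) tens y (pmul (pend M) f p)) ->
  exists y, t = tens y (pone (pend M)).
Proof.
move=> comm; exists (\∑(y, p <- t) (c i0 ((p : {linear M -> M}) (e i0)) : k) *: y).
apply: tev_inj => m; rewrite {2}/tev sw_tens //.
have := congr1 (fun s => tev s (e i0)) (comm (rank1 m (c i0))).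
rewrite !(sw_linear _ (tev_lin (e i0))).
have E (y : Y) (p : LHom M M) : tev (tens y p) (e i0) = tens y ((p : {linear M -> M}) (e i0)).
  by rewrite /tev sw_tens.
under eq_sw => y p do rewrite E pendE rank1E ec.2 eqxx scale1r.
move=> H; rewrite /tev H (sw_linear (fun y => tens y m)) //.
apply: eq_sw => y p; rewrite E pendE rank1E (linZ (tens y)) //.
by rewrite (linZ (fun y => tens y m)).
Qed.

Lemma pend_functional (i0 : 'I_n) :
  exists phi : {linear LHom M M -> k^o}, phi (pone (pend M)) = 1 :> k.
Proof.
have l : linear (fun f : LHom M M => c i0 ((f : {linear M -> M}) (e i0))) by mlin.
by exists (mk_lin l) => //=; rewrite ec.2 eqxx.
Qed.
End DualBasis.

Section EndTensor.
Variables (M N : lmodType k).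

Fact endl_linear : linear (fun f : LHom M M => f ⊠ lid N : LHom (M ⊗ N) (M ⊗ N)).
Proof.
move=> a f g; apply: tensor_lin_ext => m x /=.
by rewrite !tliftE /= tensl.
Qed.
Definition endl : {linear LHom M M -> LHom (M ⊗ N) (M ⊗ N)} := mk_lin endl_linear.
Fact endr_linear : linear (fun f : LHom N N => lid M ⊠ f : LHom (M ⊗ N) (M ⊗ N)).
Proof.
move=> a f g; apply: tensor_lin_ext => m x /=.
by rewrite !tliftE /= tensr.
Qed.
Definition endr : {linear LHom N N -> LHom (M ⊗ N) (M ⊗ N)} := mk_lin endr_linear.
Lemma endl1 : endl (pone (pend M)) = pone (pend (M ⊗ N)).
Proof. by apply: tensor_lin_ext => m x; rewrite /= tliftE. Qed.
Lemma endr1 : endr (pone (pend N)) = pone (pend (M ⊗ N)).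
Proof. by apply: tensor_lin_ext => m x; rewrite /= tliftE. Qed.
Lemma endlM f g : endl (pmul (pend M) f g) = pmul (pend (M ⊗ N)) (endl f) (endl g).
Proof. by apply: tensor_lin_ext => m x; rewrite /= !tliftE. Qed.
Lemma endrM f g : endr (pmul (pend N) f g) = pmul (pend (M ⊗ N)) (endr f) (endr g).
Proof. by apply: tensor_lin_ext => m x; rewrite /= !tliftE. Qed.
Lemma endlr f g : pmul (pend (M ⊗ N)) (endl f) (endr g) = pmul (pend (M ⊗ N)) (endr g) (endl f).
Proof. by apply: tensor_lin_ext => m x; rewrite /= !tliftE. Qed.
Lemma endlrE f g m x :
  (pmul (pend (M ⊗ N)) (endl f) (endr g) : {linear _ -> _}) (tens m x) =
  tens ((f : {linear M -> M}) m) ((g : {linear N -> N}) x).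
Proof. by rewrite /= !tliftE. Qed.

Variables (n n' : nat) (e : 'I_n -> M) (c : 'I_n -> {linear M -> k^o}).
Variables (e' : 'I_n' -> N) (c' : 'I_n' -> {linear N -> k^o}).
Hypotheses (ec : dual_basis e c) (ec' : dual_basis e' c').

(** The inverse reads off the values on the vectors e_i ⊗ e'_j and rebuilds each as a tensor of
    rank-one maps. *)
Lemma endlr_bij : exists2 m : LHom (M ⊗ N) (M ⊗ N) -> LHom M M ⊗ LHom N N,
  linear m & (forall f g, m (pmul (pend (M ⊗ N)) (endl f) (endr g)) = tens f g) /\
  (forall z, \∑(f, g <- m z) pmul (pend (M ⊗ N)) (endl f) (endr g) = z).
Proof.
have hr := @rank1_bilin M M; have hr' := @rank1_bilin N N.
pose mu (F : LHom (M ⊗ N) (M ⊗ N)) : LHom M M ⊗ LHom N N :=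
  \sum_i \sum_j \∑(x, y <- (F : {linear _ -> _}) (tens (e i) (e' j))) tens (rank1 x (c i)) (rank1 y (c' j)).
have ml : linear mu.
  move=> a F G; rewrite /mu scaler_sumr -big_split; apply: eq_bigr => i _ /=.
  rewrite scaler_sumr -big_split; apply: eq_bigr => j _ /=.
  have l : linear (fun t : M ⊗ N => \∑(x, y <- t) tens (rank1 x (c i)) (rank1 y (c' j))) by mlin.
  exact: l.
exists mu => //; split=> [f g|F].
  rewrite /mu -[in RHS](rank1_sum ec f) (linsum (fun f => tens f g)) //.
  apply: eq_bigr => i _; rewrite -[in RHS](rank1_sum ec' g) (linsum (fun g => tens (rank1 _ _) g)) //.
  apply: eq_bigr => j _; rewrite endlrE sw_tens //.
apply: tensor_lin_ext => m x.
have l : linear (fun t : LHom M M ⊗ LHom N N =>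
   (\∑(f, g <- t) pmul (pend (M ⊗ N)) (endl f) (endr g) : {linear _ -> _}) (tens m x)) by mlin.
rewrite /mu (linsum _ l).
rewrite -[in RHS](db_exp ec m (f := fun m => (F : {linear _ -> _}) (tens m x))) //.
apply: eq_bigr => i _; rewrite (linsum _ l).
rewrite -[in RHS](db_exp ec' x (f := fun x => (F : {linear _ -> _}) (tens (e i) x))) //.
rewrite scaler_sumr; apply: eq_bigr => j _.
rewrite (sw_linear _ l) -[in RHS](sw_id ((F : {linear _ -> _}) _)) !swZ; apply: eq_sw => u v.
by rewrite sw_tens // endlrE !rank1E (linZ (tens _)) // (linZ (fun y => tens y v)) ?scalerA 1?mulrC.
Qed.
End EndTensor.
End EndAlgebra.

(** * Twisted modules and their data *)

Section ModuleDatum.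
Variables (k : fieldType) (V : lmodType k) (h : phopf V) (T : {linear V -> V}).
Implicit Types X Y : lmodType k.
Local Notation Δ := (pD h).
Local Notation ε := (pe h).
Local Notation S := (pS h).
Local Notation "x ∙ y" := (pmul h x y) (at level 39, left associativity).
Local Notation e1 := (pone h).
Variables (M : lmodType k) (n : nat) (e : 'I_n -> M) (c : 'I_n -> {linear M -> k^o}).
Hypothesis ec : dual_basis e c.

(** The identity twist gives the objects over B ([byd_ydmod]); the object B_alpha satisfies the
    condition with twist alpha ([twist_ydmod]). *)
Record ydmod (al : {linear V -> V}) (th : {linear V -> LHom M M}) (lam : {linear M -> V ⊗ M}) : Prop := YDMod {
  ym1 : forall m, (th e1 : {linear M -> M}) m = m;
  ymM : forall x y m, (th (x ∙ y) : {linear M -> M}) m = (th x : {linear M -> M}) ((th y : {linear M -> M}) m);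
  ymA : forall X (F : V -> V -> M -> X) m, trilin F ->
    \∑(x, m' <- lam m) \∑(a, b <- Δ x) F a b m' = \∑(x, m' <- lam m) \∑(y, m'' <- lam m') F x y m'';
  ymE : forall m, \∑(x, m' <- lam m) (ε x : k) *: m' = m;
  ymYD : forall X (F : V -> M -> X) b m, bilin F ->
    \∑(b1, b2 <- Δ b) \∑(x, m' <- lam ((th b1 : {linear M -> M}) m)) F (x ∙ al b2) m' =
    \∑(b1, b2 <- Δ b) \∑(x, m' <- lam m) F (b1 ∙ x) ((th b2 : {linear M -> M}) m')
}.

Variables (al : {linear V -> V}) (th : {linear V -> LHom M M}) (lam : {linear M -> V ⊗ M}).

Definition umod : V ⊗ LHom M M := htens e c lam.

Lemma sw_umod X (F : V -> M -> X) m : bilin F ->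
  \∑(x, p <- umod) F x ((p : {linear M -> M}) m) = \∑(x, m' <- lam m) F x m'.
Proof.
move=> hF; rewrite -sw_tev // /umod htensK //.
Qed.

(** [tev] transfers each axiom to B ⊗ End(M) for the universal test map, and a general [F] follows
    by applying a linear map. The reversed product in [dU1] is the composition of maps: the coaction
    applied second stands on the left. *)
Lemma datum_of_module : ydmod al th lam -> datum h (pend M) al th umod.
Proof.
case=> H1 HM HA HE HYD; split.
- by apply: lhomE => m; rewrite H1.
- by move=> x y; apply: lhomE => m; rewrite HM.
- move=> X F hF.
  have E : \∑(x, p <- umod) \∑(a, b <- Δ x) tens (tens a b) p =
           \∑(x, p <- umod) \∑(y, q <- umod) tens (tens x y) (pmul (pend M) q p).
    apply: (tev_inj ec) => m.
    have tE (s : V ⊗ V) (p : LHom M M) : tev (tens s p) m = tens s ((p : {linear M -> M}) m).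
      by rewrite /tev sw_tens.
    rewrite !(sw_linear _ (tev_lin m)).
    transitivity (\∑(x, m' <- lam m) \∑(a, b <- Δ x) tens (tens a b) m').
      rewrite -(sw_umod (F := fun x m' => \∑(a, b <- Δ x) tens (tens a b) m')) //.
      apply: eq_sw => x p; rewrite (sw_linear _ (tev_lin m)); apply: eq_sw => a b.
      by rewrite tE.
    rewrite (HA _ (fun a b m' => tens (tens a b) m')) //.
    rewrite -(sw_umod (F := fun x m' => \∑(y, m'' <- lam m') tens (tens x y) m'')) //.
    apply: eq_sw => x p; rewrite (sw_linear _ (tev_lin m)).
    rewrite -(sw_umod (F := fun y m'' => tens (tens x y) m'')) //.
    by apply: eq_sw => y q; rewrite tE.
  pose L (t : (V ⊗ V) ⊗ LHom M M) := \∑(s, p <- t) \∑(a, b <- s) F a b p.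
  have Ll : linear L by rewrite /L; mlin.
  have LE a b p : L (tens (tens a b) p) = F a b p by rewrite /L !sw_tens.
  have := congr1 L E; rewrite !(sw_linear _ Ll).
  under eq_sw => x p do (rewrite (sw_linear _ Ll); under eq_sw => a b do rewrite LE).
  by move=> ->; apply: eq_sw => x p; rewrite (sw_linear _ Ll); apply: eq_sw => y q; rewrite LE.
- apply: lhomE => m; rewrite (sw_linear (fun p : LHom M M => (p : {linear M -> M}) m)) //.
  rewrite -[RHS]HE -(sw_umod (F := fun x m' => (ε x : k) *: m')); last by mlin.
  by [].
- move=> X F b hF.
  have E : \∑(x, p <- umod) \∑(b1, b2 <- Δ b) tens (x ∙ al b2) (pmul (pend M) p (th b1)) =
           \∑(x, p <- umod) \∑(b1, b2 <- Δ b) tens (b1 ∙ x) (pmul (pend M) (th b2) p).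
    apply: (tev_inj ec) => m.
    have tE (s : V) (p : LHom M M) : tev (tens s p) m = tens s ((p : {linear M -> M}) m).
      by rewrite /tev sw_tens.
    rewrite !(sw_linear _ (tev_lin m)).
    transitivity (\∑(b1, b2 <- Δ b) \∑(x, m' <- lam ((th b1 : {linear M -> M}) m)) tens (x ∙ al b2) m').
      under eq_sw => x p do rewrite (sw_linear _ (tev_lin m)).
      rewrite sw_exch; apply: eq_sw => b1 b2.
      rewrite -(sw_umod (F := fun x m' => tens (x ∙ al b2) m')) //.
      by apply: eq_sw => x p; rewrite tE.
    rewrite (HYD _ (fun x m' => tens x m')) //.
    under [RHS]eq_sw => x p do rewrite (sw_linear _ (tev_lin m)).
    rewrite [RHS]sw_exch; apply: eq_sw => b1 b2.
    rewrite -(sw_umod (F := fun x m' => tens (b1 ∙ x) ((th b2 : {linear M -> M}) m'))) //.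
    by apply: eq_sw => x p; rewrite tE.
  pose L (t : V ⊗ LHom M M) := \∑(s, p <- t) F s p.
  have Ll : linear L by rewrite /L; mlin.
  have LE s p : L (tens s p) = F s p by rewrite /L !sw_tens.
  have := congr1 L E; rewrite !(sw_linear _ Ll).
  under eq_sw => x p do (rewrite (sw_linear _ Ll); under eq_sw => a b' do rewrite LE).
  by move=> ->; apply: eq_sw => x p; rewrite (sw_linear _ Ll); apply: eq_sw => y q; rewrite LE.
Qed.

Lemma tev_coact (f : LHom M M) m :
  tev (icoact h T (pend M) umod f) m =
  \∑(y, m0 <- lam m) \∑(x, m1 <- lam ((f : {linear M -> M}) m0)) tens (x ∙ T y) m1.
Proof.
rewrite coactE (sw_linear _ (tev_lin m)).
rewrite -(sw_umod (F := fun y m0 => \∑(x, m1 <- lam ((f : {linear M -> M}) m0)) tens (x ∙ T y) m1)) //.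
transitivity (\∑(x, p <- umod) \∑(y, q <- umod) tev (tens (x ∙ T y) (pmul (pend M) (pmul (pend M) p f) q)) m).
  by apply: eq_sw => x p; rewrite (sw_linear _ (tev_lin m)).
rewrite sw_exch; apply: eq_sw => y q.
rewrite -(sw_umod (F := fun x m1 => tens (x ∙ T y) m1)) //.
by apply: eq_sw => x p; rewrite /tev sw_tens.
Qed.
End ModuleDatum.

(** * Triviality of the structures over H *)

Section Evaluation.
Variable k : fieldType.
Implicit Types U V W X : lmodType k.

Lemma lcompE U V W (g : {linear V -> W}) (f : {linear U -> V}) u : (g ∘ f) u = g (f u).
Proof. by []. Qed.
Lemma lin_eqE U V (f g : {linear U -> V}) : f = g -> forall u, f u = g u.
Proof. by move=> ->. Qed.
Lemma tmapE U V U' V' (f : {linear U -> U'}) (g : {linear V -> V'}) u v :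
  (f ⊠ g) (tens u v) = tens (f u) (g v).
Proof. exact: tliftE. Qed.
Lemma tmap_swE U V U' V' (f : {linear U -> U'}) (g : {linear V -> V'}) t :
  (f ⊠ g) t = \∑(u, v <- t) tens (f u) (g v).
Proof. by rewrite lin_sw; apply: eq_sw => u v; rewrite tmapE. Qed.
Lemma swapE U V (u : U) (v : V) : swap U V (tens u v) = tens v u.
Proof. exact: tliftE. Qed.
Lemma ascE U V W (t : U ⊗ V) (w : W) : asc U V W (tens t w) = \∑(u, v <- t) tens u (tens v w).
Proof. by rewrite /asc tliftE lin_sw; apply: eq_sw => u v; rewrite tliftE. Qed.
Lemma ascVE U V W (u : U) (t : V ⊗ W) : ascV U V W (tens u t) = \∑(v, w <- t) tens (tens u v) w.
Proof. by rewrite /ascV tliftE lin_sw; apply: eq_sw => v w; rewrite tliftE. Qed.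
Lemma asc_tens U V W (u : U) (v : V) (w : W) : asc U V W (tens (tens u v) w) = tens u (tens v w).
Proof. by rewrite ascE sw_tens //. Qed.
Lemma ascV_tens U V W (u : U) (v : V) (w : W) : ascV U V W (tens u (tens v w)) = tens (tens u v) w.
Proof. by rewrite ascVE sw_tens //. Qed.
Lemma lunE U (a : k^o) (u : U) : lun U (tens a u) = (a : k) *: u.
Proof. exact: tliftE. Qed.
Lemma runE U (u : U) (a : k^o) : run U (tens u a) = (a : k) *: u.
Proof. by rewrite /run lcompE swapE lunE. Qed.
Lemma runVE U (u : U) : runV U u = tens u (1 : k^o).
Proof. by rewrite /runV lcompE /= swapE. Qed.
Lemma evE V W (f : LHom V W) v : ev V W (tens f v) = (f : {linear V -> W}) v.
Proof. exact: tliftE. Qed.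
Lemma arotE U V W V' W' (f : {linear V ⊗ W -> W' ⊗ V'}) u v w :
  arot U f (tens (tens u v) w) = \∑(x, y <- f (tens v w)) tens (tens u x) y.
Proof. by rewrite /arot !lcompE asc_tens tmapE ascVE. Qed.
Lemma amidE U V W X V' W' (f : {linear V ⊗ W -> W' ⊗ V'}) u v w x :
  amid U X f (tens (tens u v) (tens w x)) = \∑(y, z <- f (tens v w)) tens (tens u y) (tens z x).
Proof.
rewrite /amid !lcompE asc_tens tmapE !lcompE ascV_tens tmapE ascE.
rewrite (sw_linear (fun t => ascV _ _ _ (tens _ t))) //.
by apply: eq_sw => y z; rewrite ascV_tens.
Qed.
Lemma tens_lin_ext3 U V W X (f g : U ⊗ V ⊗ W -> X) : linear f -> linear g ->
  (forall u v w, f (tens (tens u v) w) = g (tens (tens u v) w)) -> f =1 g.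
Proof.
move=> hf hg fg; apply: tens_lin_ext => // t w; move: t.
have hf' : linear (fun t => f (tens t w)) by mlin.
have hg' : linear (fun t => g (tens t w)) by mlin.
by apply: tens_lin_ext => // u v; exact: fg.
Qed.
Lemma amid_sw U V W X V' W' (f : {linear V ⊗ W -> W' ⊗ V'}) (s : U ⊗ V) (t : W ⊗ X) :
  amid U X f (tens s t) =
  \∑(u, v <- s) \∑(w, x <- t) \∑(y, z <- f (tens v w)) tens (tens u y) (tens z x).
Proof.
rewrite -[s in LHS]sw_id (sw_linear (fun s => amid _ _ _ (tens s t))) //.
apply: eq_sw => u v; rewrite -[t in LHS]sw_id.
rewrite (sw_linear (fun t => amid _ _ _ (tens _ t))) //.
by apply: eq_sw => w x; rewrite amidE.
Qed.
Lemma arot_sw U V W V' W' (f : {linear V ⊗ W -> W' ⊗ V'}) (s : U ⊗ V) w :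
  arot U f (tens s w) = \∑(u, v <- s) \∑(x, y <- f (tens v w)) tens (tens u x) y.
Proof.
rewrite -[s in LHS]sw_id (sw_linear (fun s => arot _ _ (tens s w))) //.
by apply: eq_sw => u v; rewrite arotE.
Qed.

Lemma tmap_amid_sw U V W X V' W' (Y Z : lmodType k) (f : {linear V ⊗ W -> W' ⊗ V'})
    (mu : {linear U ⊗ W' -> Y}) (nu : {linear V' ⊗ X -> Z}) (s : U ⊗ V) (t : W ⊗ X) :
  (mu ⊠ nu) (amid U X f (tens s t)) =
  \∑(u, v <- s) \∑(w, x <- t) \∑(y, z <- f (tens v w)) tens (mu (tens u y)) (nu (tens z x)).
Proof.
rewrite amid_sw (sw_lin (mu ⊠ nu)); apply: eq_sw => u v.
rewrite (sw_lin (mu ⊠ nu)); apply: eq_sw => w x.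
by rewrite (sw_lin (mu ⊠ nu)); apply: eq_sw => y z; rewrite tmapE.
Qed.
(** Evaluates the side of the Yetter-Drinfel'd compatibility in which the coaction follows the
    action; [f] and [g] are flips in the condition over H and braidings in that over B. *)
Lemma yd_rhsE U V W V' W' (A M N B : lmodType k) (f : {linear V ⊗ W -> W' ⊗ V'}) (C : {linear U ⊗ W' -> A ⊗ M})
    (g : {linear M ⊗ V' -> N ⊗ B}) (mu : {linear A ⊗ N -> U}) (s : U ⊗ V) w :
  (mu ⊠ lid B) (arot A g ((C ⊠ lid V') (arot U f (tens s w)))) =
  \∑(u, v <- s) \∑(w', v' <- f (tens v w)) \∑(a, m <- C (tens u w')) \∑(n, b <- g (tens m v'))
    tens (mu (tens a n)) b.
Proof.
pose L t := (mu ⊠ lid B) (arot A g ((C ⊠ lid V') t)).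
have hL : linear L by rewrite /L; mlin.
rewrite -/(L _) arot_sw (sw_linear _ hL); apply: eq_sw => u v.
rewrite (sw_linear _ hL); apply: eq_sw => w' v'.
rewrite /L tmapE arot_sw (sw_lin (mu ⊠ lid B)); apply: eq_sw => a m.
by rewrite (sw_lin (mu ⊠ lid B)); apply: eq_sw => n b; rewrite tmapE.
Qed.

End Evaluation.

Section HopfAlg.
Variables (k : fieldType) (H : hopfAlg k).
Local Notation Hl := (hopf_car H : lmodType k).
Fact Hmul_bilin : bilin (fun x y : Hl => (x : H) * (y : H) : Hl).
Proof. exact: mulm_bilin. Qed.
Definition Halg : palg Hl :=
  @PAlg k Hl (fun x y : Hl => (x : H) * (y : H) : Hl) (1 : H) Hmul_bilin (@mulrA H) (@mul1r H) (@mulr1 H).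
Definition Hphopf : phopf Hl.
Proof.
refine (@PHopf k Hl Halg (comul H) (counit H) (antipode H) _ _ _ _ _ _ _ _ _).
- by move=> x; exact: (lin_eqE (comulA H) x).
- move=> x; rewrite -[RHS](lin_eqE (comul_counitl H) x) !lcompE tmap_swE (sw_lin (lun _)).
  by apply: eq_sw => a b; rewrite lunE.
- move=> x; rewrite -[RHS](lin_eqE (comul_counitr H) x) 2!lcompE tmap_swE (sw_lin (run _)).
  by apply: eq_sw => a b; rewrite runE.
- move=> x y; have := lin_eqE (Defs.comulM H) (tens x y); rewrite !lcompE /mulm tliftE => ->.
  pose L s t := (mulm H ⊠ mulm H) (amid H H (swap H H) (tens s t)).
  have hL : bilin L by rewrite /L; mlin.
  rewrite tmapE -/(L _ _) -[comul H x in LHS]sw_id -[comul H y in LHS]sw_id.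
  rewrite (sw_linear (fun t => L t _)) //.
  apply: eq_sw => a b; rewrite (sw_linear (fun t => L _ t)) //.
  apply: eq_sw => c d.
  by rewrite /L amidE swapE sw_tens ?tmapE /mulm ?tliftE.
- exact: comul1.
- exact: counitM.
- exact: counit1.
- move=> x; have := lin_eqE (antipodel H) x; rewrite !lcompE /= => <-.
  by rewrite tmap_swE (sw_lin (mulm _)); apply: eq_sw => a b; rewrite /mulm tliftE.
- move=> x; have := lin_eqE (antipoder H) x; rewrite !lcompE /= => <-.
  by rewrite tmap_swE (sw_lin (mulm _)); apply: eq_sw => a b; rewrite /mulm tliftE.
(* Transparent, so that the operations of [Hphopf H] convert to those of H. *)
Defined.
End HopfAlg.

Section TestModules.
Variables (k : fieldType) (H : hopfAlg k).
Hypothesis antipode_bij : bijective (antipode H).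
Local Notation Hl := (hopf_car H : lmodType k).
Local Notation h := (Hphopf H).
Local Notation Δ := (pD h).
Local Notation ε := (pe h).
Local Notation S := (pS h).
Local Notation T := (linv (antipode H)).
Local Notation "x ∙ y" := (pmul h x y) (at level 39, left associativity).
Local Notation e1 := (pone h).

Let ST : cancel S T. Proof. exact: (linvP antipode_bij).1. Qed.
Let TS : cancel T S. Proof. exact: (linvP antipode_bij).2. Qed.

Lemma mulmE (x y : H) : mulm H (tens x y) = pmul h x y.
Proof. by rewrite /mulm tliftE. Qed.

Lemma is_ydP (M : ydata H) :
  (forall x y m, yd_act M (tens (x ∙ y) m) = yd_act M (tens x (yd_act M (tens y m)))) ->
  (forall m, yd_act M (tens (1 : H) m) = m) ->
  (forall m, \∑(x, m' <- yd_coact M m) \∑(a, b <- Δ x) tens (tens a b) m' =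
             \∑(x, m' <- yd_coact M m) \∑(y, m'' <- yd_coact M m') tens (tens x y) m'') ->
  (forall m, \∑(x, m' <- yd_coact M m) (ε x : k) *: m' = m) ->
  (forall b m, \∑(b1, b2 <- Δ b) \∑(x, m' <- yd_coact M m) tens (b1 ∙ x) (yd_act M (tens b2 m')) =
     \∑(b1, b2 <- Δ b) \∑(x, m' <- yd_coact M (yd_act M (tens b1 m))) tens (x ∙ b2) m') ->
  is_yd M.
Proof.
case: M => M a l /= H1 H2 H3 H4 H5; split=> //=.
- apply: lin_ext; apply: tens_lin_ext3 => // u v w.
  by rewrite !lcompE !tmapE asc_tens !tmapE mulmE H1.
- apply: lin_ext => x; rewrite 3!lcompE !tmap_swE (sw_lin (ascV _ _ _)).
  transitivity (\∑(x, m' <- l x) \∑(a, b <- Δ x) tens (tens a b) m').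
    apply: eq_sw => y m; rewrite -(sw_linear (fun t => tens t m)) //.
    by rewrite sw_id.
  by rewrite H3; apply: eq_sw => y m; rewrite ascVE.
- apply: lin_ext => x; rewrite 2!lcompE !tmap_swE (sw_lin (lun _)) -[RHS]H4.
  by apply: eq_sw => y m; rewrite lunE.
- apply: lin_ext; apply: tens_lin_ext => // b m.
  rewrite 6!lcompE !tmapE yd_rhsE tmap_amid_sw.
  transitivity (\∑(b1, b2 <- Δ b) \∑(x, m' <- l m) tens (b1 ∙ x) (a (tens b2 m'))).
    apply: eq_sw => b1 b2; apply: eq_sw => x m'.
    by rewrite swapE sw_tens ?mulmE.
  rewrite H5; apply: eq_sw => b1 b2; rewrite swapE sw_tens //.
  by rewrite lcompE; apply: eq_sw => x m'; rewrite swapE sw_tens ?mulmE.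
Qed.

Fact adc_lin : linear (fun x : Hl => \∑(a, b <- Δ x) \∑(c, d <- Δ b) tens (a ∙ S d) c).
Proof. by mlin. Qed.
Definition adc : {linear Hl -> Hl ⊗ Hl} := mk_lin adc_lin.
Lemma sw_adc (X : lmodType k) (F : Hl -> Hl -> X) (x : Hl) : bilin F ->
  \∑(a, b <- adc x) F a b = \∑(a, b <- Δ x) \∑(c, d <- Δ b) F (a ∙ S d) c.
Proof.
move=> hF; rewrite /= sw_sw //; apply: eq_sw => a b; rewrite sw_sw //.
by apply: eq_sw => c d; rewrite sw_tens.
Qed.

(* The test object whose braiding with [B] forces the coaction of [B] to be
   trivial; its own coaction is [h1 S(h3) ⊗ h2]. *)
Definition free_yd : ydata H := @YData k H Hl (mulm H) adc.

Lemma free_yd_is_yd : is_yd free_yd.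
Proof.
apply: is_ydP.
- by move=> x y m; rewrite !mulmE pmulA.
- by move=> m; rewrite mulmE pmul1l.
- move=> x; rewrite (sw_adc (F := fun x m' => \∑(a, b <- Δ x) tens (tens a b) m')) //.
  transitivity (\∑(a1, y <- Δ x) \∑(a2, h' <- Δ y) \∑(b, c <- Δ h') \∑(c1, c2 <- Δ c)
     tens (tens (a1 ∙ S c2) (a2 ∙ S c1)) b).
    rewrite -(coassoc h (fun a1 a2 h' => \∑(b, c <- Δ h') \∑(c1, c2 <- Δ c)
     tens (tens (a1 ∙ S c2) (a2 ∙ S c1)) b)) //.
    apply: eq_sw => a h'; rewrite [RHS]sw_exch; apply: eq_sw => b c.
    rewrite (comul_pmul h (F := fun p q => tens (tens p q) b)) //.
    by apply: eq_sw => a1 a2; rewrite comul_antip.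
  rewrite (sw_adc (F := fun x m' => \∑(y, m'' <- adc m') tens (tens x y) m'')) //.
  apply: eq_sw => a1 y.
  transitivity (\∑(u, c <- Δ y) \∑(a', v <- Δ u) \∑(b', c' <- Δ v) tens (tens (a1 ∙ S c) (a' ∙ S c')) b'); last first.
    by apply: eq_sw => u c; rewrite sw_adc.
  rewrite (coassoc h (fun a' v c => \∑(b', c' <- Δ v) tens (tens (a1 ∙ S c) (a' ∙ S c')) b')) //.
  apply: eq_sw => a' w.
  by rewrite (coassoc h (fun b' c' c => tens (tens (a1 ∙ S c) (a' ∙ S c')) b')).
- move=> x; rewrite (sw_adc (F := fun x m' => (ε x : k) *: m')) //.
  transitivity (\∑(a, b <- Δ x) (ε a : k) *: \∑(c, d <- Δ b) (ε d : k) *: c).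
    apply: eq_sw => a b; rewrite swZ; apply: eq_sw => c d.
    by rewrite peM eps_antip scalerA.
  under eq_sw => a b do rewrite pD_counr.
  by rewrite pD_counl.
- move=> b m.
  transitivity (\∑(b1, b2 <- Δ b) \∑(m1, m' <- Δ m) \∑(m2, m3 <- Δ m') tens (b1 ∙ m1 ∙ S m3) (b2 ∙ m2)).
    apply: eq_sw => b1 b2.
    rewrite (sw_adc (F := fun x m' => tens (b1 ∙ x) (mulm H (tens b2 m')))) //.
    by do 2 (apply: eq_sw => ? ?); rewrite mulmE pmulA.
  symmetry; transitivity (\∑(b12, b' <- Δ b) \∑(b1, b2 <- Δ b12) \∑(b3, b4 <- Δ b')
     \∑(m1, m' <- Δ m) \∑(m2, m3 <- Δ m') tens (b1 ∙ m1 ∙ S m3 ∙ (S b3 ∙ b4)) (b2 ∙ m2)).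
    transitivity (\∑(y, b4 <- Δ b) \∑(b1, z <- Δ y) \∑(b2, b3 <- Δ z)
       \∑(m1, m' <- Δ m) \∑(m2, m3 <- Δ m') tens (b1 ∙ m1 ∙ S m3 ∙ (S b3 ∙ b4)) (b2 ∙ m2)).
      apply: eq_sw => y b4; rewrite mulmE (sw_adc (F := fun x m' => tens (x ∙ b4) m')) //.
      rewrite comul_pmul //.
      apply: eq_sw => b1 z; rewrite [RHS]sw_exch; apply: eq_sw => m1 m'.
      rewrite comul_pmul //.
      by do 2 (apply: eq_sw => ? ?); rewrite antipM !pmulA.
    transitivity (\∑(y, b4 <- Δ b) \∑(b12, b3 <- Δ y) \∑(b1, b2 <- Δ b12)
       \∑(m1, m' <- Δ m) \∑(m2, m3 <- Δ m') tens (b1 ∙ m1 ∙ S m3 ∙ (S b3 ∙ b4)) (b2 ∙ m2)).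
      apply: eq_sw => y b4.
      by rewrite (coassoc h (fun b1 b2 b3 => \∑(m1, m' <- Δ m) \∑(m2, m3 <- Δ m')
        tens (b1 ∙ m1 ∙ S m3 ∙ (S b3 ∙ b4)) (b2 ∙ m2))) //.
    rewrite (coassoc h (fun b12 b3 b4 => \∑(b1, b2 <- Δ b12) \∑(m1, m' <- Δ m) \∑(m2, m3 <- Δ m')
        tens (b1 ∙ m1 ∙ S m3 ∙ (S b3 ∙ b4)) (b2 ∙ m2))) //.
    by apply: eq_sw => b12 b'; rewrite sw_exch.
  under eq_sw => b12 b'.
    rewrite sw_exch (antl h _ (f := fun z => \∑(b1, b2 <- Δ b12) \∑(m1, m' <- Δ m) \∑(m2, m3 <- Δ m')
        tens (b1 ∙ m1 ∙ S m3 ∙ z) (b2 ∙ m2))) //.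
    over.
  rewrite (counr h _ (f := fun b => \∑(b1, b2 <- Δ b) \∑(m1, m' <- Δ m) \∑(m2, m3 <- Δ m')
        tens (b1 ∙ m1 ∙ S m3 ∙ e1) (b2 ∙ m2))) //.
  by do 3 (apply: eq_sw => ? ?); rewrite pmul1r.
Qed.

Fact ad_bilin : bilin (fun x m : Hl => \∑(a, b <- Δ x) (a ∙ m ∙ S b)).
Proof. by mlin. Qed.
Definition ad : {linear Hl ⊗ Hl -> Hl} := tlift ad_bilin.
Lemma adE x m : ad (tens x m) = \∑(a, b <- Δ x) (a ∙ m ∙ S b).
Proof. exact: tliftE. Qed.

(* The test object whose braiding with [B] forces the action on [B] to be
   trivial; its own action is adjoint. *)
Definition cofree_yd : ydata H := @YData k H Hl ad (comul H).

Lemma cofree_yd_is_yd : is_yd cofree_yd.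
Proof.
apply: is_ydP.
- move=> x y m; rewrite [LHS]adE [RHS]adE adE.
  rewrite comul_pmul //.
  apply: eq_sw => a b; rewrite (sw_linear (fun z => a ∙ z ∙ S b)) //.
  by apply: eq_sw => c d; rewrite antipM !pmulA.
- move=> m; rewrite [LHS]adE pD1 sw_tens //.
  by rewrite antip1 pmul1l pmul1r.
- by move=> m; rewrite (coassoc h (fun a b c => tens (tens a b) c)).
- exact: (pD_counl h).
- move=> b m.
  transitivity (\∑(b1, b' <- Δ b) \∑(b2, b3 <- Δ b') \∑(m1, m2 <- Δ m) tens (b1 ∙ m1) (b2 ∙ m2 ∙ S b3)).
    apply: eq_sw => b1 b2; rewrite [RHS]sw_exch; apply: eq_sw => m1 m2.
    by rewrite [yd_act _ _]adE (sw_linear (fun z => tens (b1 ∙ m1) z)).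
  symmetry; transitivity (\∑(y, b5 <- Δ b) \∑(b12, b34 <- Δ y) \∑(b1, b2 <- Δ b12) \∑(b3, b4 <- Δ b34)
      \∑(m1, m2 <- Δ m) tens (b1 ∙ m1 ∙ (S b4 ∙ b5)) (b2 ∙ m2 ∙ S b3)).
    apply: eq_sw => y b5; rewrite [yd_act _ _]adE.
    rewrite (sw_lin (comul H)) sw_sw //.
    apply: eq_sw => b12 b34.
    rewrite comul_pmul // comul_pmul //.
    apply: eq_sw => b1 b2; rewrite [RHS]sw_exch; apply: eq_sw => m1 m2.
    rewrite comul_antip //.
    by apply: eq_sw => b3 b4; rewrite !pmulA.
  rewrite (coassoc h (fun b12 b34 b5 => \∑(b1, b2 <- Δ b12) \∑(b3, b4 <- Δ b34)
      \∑(m1, m2 <- Δ m) tens (b1 ∙ m1 ∙ (S b4 ∙ b5)) (b2 ∙ m2 ∙ S b3))) //.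
  transitivity (\∑(b12, b3 <- Δ b) \∑(b1, b2 <- Δ b12) \∑(m1, m2 <- Δ m) tens (b1 ∙ m1 ∙ e1) (b2 ∙ m2 ∙ S b3)); last first.
    rewrite (coassoc h (fun b1 b2 b3 => \∑(m1, m2 <- Δ m) tens (b1 ∙ m1 ∙ e1) (b2 ∙ m2 ∙ S b3))) //.
    by do 3 (apply: eq_sw => ? ?); rewrite pmul1r.
  apply: eq_sw => b12 z.
  under eq_sw => b34 b5 do rewrite sw_exch.
  rewrite (coassoc h (fun b3 b4 b5 => \∑(b1, b2 <- Δ b12)
      \∑(m1, m2 <- Δ m) tens (b1 ∙ m1 ∙ (S b4 ∙ b5)) (b2 ∙ m2 ∙ S b3))) //.
  under eq_sw => b3 b'.
    rewrite (antl h _ (f := fun u => \∑(b1, b2 <- Δ b12)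
      \∑(m1, m2 <- Δ m) tens (b1 ∙ m1 ∙ u) (b2 ∙ m2 ∙ S b3))) //.
    over.
  by rewrite (counr h _ (f := fun b3 => \∑(b1, b2 <- Δ b12)
      \∑(m1, m2 <- Δ m) tens (b1 ∙ m1 ∙ e1) (b2 ∙ m2 ∙ S b3))) //.
Qed.

Lemma braidE (M N : ydata H) (m : M) (n : N) :
  braid M N (tens m n) = \∑(x, n' <- yd_coact N n) tens n' (yd_act M (tens (T x) m)).
Proof.
rewrite /braid 3!lcompE swapE tmapE 2!lcompE [(linv _ ⊠ _) _]tmap_swE (sw_lin (swap _ _)).
rewrite (sw_linear (fun t => (lid N ⊠ yd_act M) (asc N H M (tens t (lid M m))))) //.
by apply: eq_sw => x n'; rewrite swapE asc_tens tmapE.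
Qed.

Section Trivialization.
Variable B : ydata H.
Hypothesis B_yd : is_yd B.
Hypothesis B_sym : forall M : ydata H, is_yd M -> braid B M = braidV M B.

(** The test object has coaction 1 ⊗ 1 at 1, so its braiding with b, evaluated at b ⊗ 1, is a flip.
    Symmetry then says that b_[0] ⊗ S^-1(b_[-1]) = b ⊗ 1. *)
Lemma sym_coact b : yd_coact B b = tens e1 b.
Proof.
have act1 : forall b, yd_act B (tens (1 : H) b) = b by case: B_yd.
have braid1 : braid B free_yd (tens b (1 : H)) = tens (1 : H) b.
  rewrite braidE (sw_adc (F := fun x n' => tens n' (yd_act B (tens (T x) b)))) // pD1 sw_tens //.
  by rewrite pD1 sw_tens // antip1 pmul1l (ai1 ST) act1.
have := B_sym free_yd_is_yd; rewrite /braidV => E.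
have [bij|nbij] := pselect (bijective (braid free_yd B)).
  have [_ lK] := linvP bij.
  have E2 := lK (tens b (1 : H)); rewrite -E braid1 braidE /= in E2.
  pose G (t : B ⊗ Hl) := \∑(b', y <- t) tens (S y) b'.
  have hG : linear G by rewrite /G; mlin.
  have GE b' y : G (tens b' y) = tens (S y) b' by rewrite /G sw_tens.
  have := congr1 G E2; rewrite (sw_linear _ hG) GE antip1 => <-.
  rewrite -[LHS]sw_id; apply: eq_sw => x b'.
  by rewrite GE mulmE pmul1r TS.
(* If the braiding were not bijective, [linv] would return 0, and [braid1] would force b = 0. *)
have E0 : braid B free_yd = \0.
  rewrite E /linv /the_lin; case: pselect => // -[g [g1 g2]].
  by case: nbij; exists g.
have b0 : b = 0.
  pose G (t : Hl ⊗ B) := \∑(y, b' <- t) (ε y : k) *: b'.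
  have hG : linear G by rewrite /G; mlin.
  have := congr1 G braid1; rewrite E0 /= (lin0 hG) /G sw_tens //.
  by rewrite pe1 scale1r.
by rewrite b0 linear0 (lin0 (f := fun b => tens e1 b)).
Qed.

(** As the coaction of B is trivial, the braiding of the test object with B is a flip, hence so is
    the opposite one. At b ⊗ S(x), applying ε to the leg in H leaves S^-1(S(x))·b on one side and
    ε(x) b on the other. *)
Lemma sym_act x b : yd_act B (tens x b) = (ε x : k) *: b.
Proof.
have act1 : forall b, yd_act B (tens (1 : H) b) = b by case: B_yd.
have cofree1 (m : Hl) : ad (tens (1 : H) m) = m.
  by rewrite adE pD1 sw_tens ?antip1 ?pmul1l ?pmul1r.
have swE : forall t, braid cofree_yd B t = swap Hl B t.
  apply: tens_lin_ext => // m b0.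
  by rewrite braidE sym_coact sw_tens // swapE (ai1 ST) /= cofree1.
have := B_sym cofree_yd_is_yd; rewrite /braidV => E.
have swK (U V : lmodType k) : cancel (swap U V) (swap V U).
  by apply: tens_lin_ext => // u v; rewrite !swapE.
have linvS : linv (braid cofree_yd B) = swap B Hl.
  by apply: linvE => t; rewrite swE; exact: swK.
pose G (t : Hl ⊗ B) := \∑(y, b' <- t) (ε y : k) *: b'.
have hG : linear G by rewrite /G; mlin.
have := congr1 (fun f : {linear B ⊗ Hl -> Hl ⊗ B} => G (f (tens b (S x)))) E.
rewrite linvS swapE /G [in RHS]sw_tens // eps_antip => <-; rewrite braidE /= -/(G _) (sw_linear _ hG).
transitivity (yd_act B (tens (T (\∑(x1, x2 <- Δ (S x)) (ε x2 : k) *: x1)) b)).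
  by rewrite pD_counr ST.
rewrite (sw_linear (fun z => yd_act B (tens (T z) b))) //.
apply: eq_sw => x1 x2; rewrite /G sw_tens //.
by rewrite (linZ (fun z => yd_act B (tens (T z) b))).
Qed.
End Trivialization.
End TestModules.

(** * Algebras over B *)

Section Transport.
Variables (k : fieldType) (V : lmodType k) (h : phopf V) (T : {linear V -> V}).
Variables (W W' : lmodType k) (A : palg W) (A' : palg W') (om : {linear W -> W'}).
Hypotheses (om1 : om (pone A) = pone A') (omM : forall f g, om (pmul A f g) = pmul A' (om f) (om g)).
Variables (al : {linear V -> V}) (th : {linear V -> W}) (U : V ⊗ W).

Lemma sw_om (X : lmodType k) (F : V -> W' -> X) : bilin F ->
  \∑(x, p <- (lid V ⊠ om) U) F x p = \∑(x, p <- U) F x (om p).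
Proof. by move=> hF; rewrite sw_tmap. Qed.

Lemma act_om b f : iact h A' (om \o th) b (om f) = om (iact h A th b f).
Proof. by rewrite /iact (sw_lin om); apply: eq_sw => b1 b2; rewrite !omM. Qed.

Lemma coact_om f : icoact h T A' ((lid V ⊠ om) U) (om f) = (lid V ⊠ om) (icoact h T A U f).
Proof.
rewrite !coactE sw_om // (sw_lin (lid V ⊠ om)); apply: eq_sw => x p.
by rewrite sw_om // (sw_lin (lid V ⊠ om)); apply: eq_sw => y q; rewrite tmapE !omM.
Qed.

Lemma datum_om : datum h A al th U -> datum h A' al (om \o th) ((lid V ⊠ om) U).
Proof.
move=> d; split.
- by rewrite /= (d_th1 d).
- by move=> x y; rewrite /= (d_thM d) omM.
- move=> X F hF; rewrite sw_om //.
  rewrite (dU1 d (F := fun a b p => F a b (om p))) // sw_om //.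
  apply: eq_sw => x p; rewrite sw_om //.
  by apply: eq_sw => y q; rewrite omM.
- rewrite sw_om //.
  rewrite -om1 -(dU2 d) (sw_lin om); apply: eq_sw => x p.
  by rewrite linearZ.
- move=> X F b hF; rewrite !sw_om //.
  have := dU3 d (F := fun x p => F x (om p)) b.
  have hF' : bilin (fun x p => F x (om p)) by mlin.
  move=> /(_ hF') E; transitivity (\∑(x, p <- U) \∑(b1, b2 <- pD h b) F (pmul h x (al b2)) (om (pmul A p (th b1)))).
    by do 2 (apply: eq_sw => ? ?); rewrite omM.
  by rewrite E; do 2 (apply: eq_sw => ? ?); rewrite omM.
Qed.
End Transport.

Lemma curryE (k : fieldType) (U V W : lmodType k) (f : {linear U ⊗ V -> W}) u v :
  (curry f u : {linear V -> W}) v = f (tens u v).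
Proof. by []. Qed.

(** * Trivial structures over H and braidings that are flips *)

Section Bridge.
Variables (k : fieldType) (H : hopfAlg k).
Hypothesis antipode_bij : bijective (antipode H).
Local Notation hH := (Hphopf H).
Local Notation TH := (linv (antipode H)).
Let STH : cancel (pS hH) TH. Proof. exact: (linvP antipode_bij).1. Qed.
Let TSH : cancel TH (pS hH). Proof. exact: (linvP antipode_bij).2. Qed.

Definition trivH (M : ydata H) : Prop :=
  (forall x m, yd_act M (tens x m) = (counit H x : k) *: m) /\ (forall m, yd_coact M m = tens (1 : H) m).
(** What the braiding of an object with a trivial one sees of its structures. Objects M in a Brauer
    equivalence have this property, and [mild_yd_hom] passes it on to End(M). *)
Definition mild (M : ydata H) : Prop :=
  (forall m, yd_act M (tens (1 : H) m) = m) /\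
  (forall m, \∑(x, m' <- yd_coact M m) (counit H x : k) *: m' = m).

Lemma trivH_mild M : trivH M -> mild M.
Proof.
case=> ha hc; split=> m; first by rewrite ha (pe1 hH) scale1r.
by rewrite hc sw_tens ?(pe1 hH) ?scale1r.
Qed.

Lemma is_yd_mild M : is_yd M -> mild M.
Proof.
case=> _ h1 _ h2 _; split=> // m; rewrite -[RHS](lin_eqE h2 m) 2!lcompE tmap_swE (sw_lin (lun _)).
by apply: eq_sw => x m'; rewrite lunE.
Qed.

Lemma trivH_is_yd M : trivH M -> is_yd M.
Proof.
case=> ha hc; apply: is_ydP.
- by move=> x y m; rewrite !ha (peM hH) scalerA.
- by move=> m; rewrite ha (pe1 hH) scale1r.
- move=> m; rewrite hc sw_tens //.
  by rewrite [RHS]sw_tens // (pD1 hH) sw_tens ?hc ?sw_tens.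
- by move=> m; rewrite hc sw_tens ?(pe1 hH) ?scale1r.
- move=> b m; transitivity (tens b m).
    rewrite -[RHS](counr hH b (f := fun b => tens b m)) //.
    apply: eq_sw => b1 b2; rewrite hc sw_tens //.
    by rewrite ha (pmul1r hH) (linZ (tens b1)).
  rewrite -[LHS](counl hH b (f := fun b => tens b m)) //.
  apply: eq_sw => b1 b2; rewrite ha hc.
  have E (y : M) : \∑(x, m' <- tens (1 : H) y) tens (pmul hH x b2) m' = tens b2 y.
    by rewrite sw_tens ?(pmul1l hH).
  by rewrite E (linZ (tens b2)).
Qed.

Lemma trivH_mor (M N : ydata H) (f : {linear M -> N}) : trivH M -> trivH N -> yd_mor f.
Proof.
case=> ha hc [ha' hc']; split; apply: lin_ext.
  apply: tens_lin_ext => // x m.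
  by rewrite 2!lcompE tmapE ha ha' linearZ.
by move=> m; rewrite 2!lcompE hc hc' tmapE.
Qed.

Lemma trivH_unit : trivH (yd_unit H).
Proof.
split=> [x m|m].
  by rewrite [LHS]lcompE tmapE lunE.
by rewrite [LHS]lcompE [LHS]tmapE /= scale1r.
Qed.

Lemma trivH_tens (M N : ydata H) : trivH M -> trivH N -> trivH (yd_tens M N).
Proof.
move=> [ha hc] [ha' hc']; split.
  move=> x; apply: tens_lin_ext => // m n.
  rewrite [LHS]lcompE lcompE tmapE tmap_amid_sw.
  rewrite -(counl hH x (f := fun x => (counit H x : k) *: tens m n)) //.
  apply: eq_sw => x1 x2; rewrite sw_tens //.
  by rewrite swapE sw_tens // ha ha' (linZ (tens _)) // (linZ (fun y => tens y n)) ?scalerA 1?mulrC.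
apply: tens_lin_ext => // m n.
by rewrite [LHS]lcompE lcompE tmapE hc hc' amidE swapE sw_tens // tmapE mulmE (pmul1l hH).
Qed.

Lemma mild_braid_l (M N : ydata H) : trivH M -> mild N -> forall t, braid M N t = swap M N t.
Proof.
move=> [ha _] [_ hN]; apply: tens_lin_ext => // m n.
rewrite braidE swapE -[in RHS](hN n) (sw_linear (fun n => tens n m)) //.
apply: eq_sw => x n'; rewrite ha (eps_ai (h := hH) TSH) (linZ (tens n')) //.
by rewrite (linZ (fun n => tens n m)).
Qed.

Lemma mild_braid_r (M N : ydata H) : mild M -> trivH N -> forall t, braid M N t = swap M N t.
Proof.
move=> [h1 _] [_ hc]; apply: tens_lin_ext => // m n.
by rewrite braidE swapE hc sw_tens ?(ai1 (h := hH) STH) ?h1.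
Qed.

Lemma swapK (U V : lmodType k) : cancel (swap U V) (swap V U).
Proof. by apply: tens_lin_ext => // u v; rewrite !swapE. Qed.

Lemma braidV_swap (M N : ydata H) : (forall t, braid M N t = swap M N t) -> braidV M N = swap N M.
Proof. by move=> E; apply: linvE => t; rewrite E; exact: swapK. Qed.

(** For finite-dimensional M the map [tev] is bijective, so the condition that defines the coaction
    of an inner Hom has exactly one solution, and [the_lin] selects it. *)
Lemma the_lin_ev (M N Y : lmodType k) (Q : {linear LHom M N ⊗ M -> Y ⊗ N}) : fin_dim M ->
  forall f m, tev (the_lin (fun lam : {linear LHom M N -> Y ⊗ LHom M N} =>
    (lid Y ⊠ ev M N) ∘ asc Y (LHom M N) M ∘ (lam ⊠ lid M) = Q) f) m = Q (tens f m).
Proof.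
case/fin_dim_dual_basis => n [e [c ec]].
have pairE (lam : {linear LHom M N -> Y ⊗ LHom M N}) f m :
    ((lid Y ⊠ ev M N) ∘ asc Y (LHom M N) M ∘ (lam ⊠ lid M)) (tens f m) = tev (lam f) m.
  rewrite 2!lcompE tmapE ascE (sw_lin (lid Y ⊠ ev M N)); apply: eq_sw => y g.
  by rewrite tmapE evE.
have Ql f : linear (fun m => Q (tens f m)) by mlin.
have l : linear (fun f => htens e c (fun m => Q (tens f m))).
  move=> a f g; apply: (tev_inj ec) => m.
  pose ht f := htens e c (fun m => Q (tens f m)).
  transitivity (a *: tev (ht f) m + tev (ht g) m); last by symmetry; exact: tev_lin.
  by rewrite /ht !(htensK ec) // tensl linearP.
rewrite (the_linE (f := mk_lin l)).
- by move=> f m; rewrite mk_linE (htensK ec).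
- by apply: tensor_lin_ext => f m; rewrite pairE mk_linE (htensK ec).
- move=> g /lin_eqE E; apply: lin_ext => f; apply: (tev_inj ec) => m.
  by rewrite -pairE E mk_linE (htensK ec).
Qed.

Lemma tev_yd_hom (M N : ydata H) : fin_dim M -> forall (f : yd_hom M N) m,
  tev (yd_coact (yd_hom M N) f) m =
  \∑(y, m0 <- yd_coact M m) \∑(x, n0 <- yd_coact N ((f : {linear M -> N}) m0)) tens (pmul hH x (TH y)) n0.
Proof.
move=> fM f m; rewrite [LHS](the_lin_ev _ fM) 6!lcompE tmapE.
move: (yd_coact M) (yd_coact N) => cM cN; rewrite -[cM m in LHS]sw_id.
pose L t := ((mulm H ∘ swap H H) ⊠ lid N) (ascV H H N ((TH ⊠ (cN ∘ ev M N))
   (asc H (LHom M N) M ((swap (LHom M N) H ⊠ lid M) (ascV (LHom M N) H M (tens f t)))))).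
have Ll : linear L by rewrite /L; mlin.
rewrite -/(L _) (sw_linear _ Ll); apply: eq_sw => y m0.
rewrite /L ascV_tens tmapE swapE asc_tens tmapE lcompE evE ascVE (sw_lin ((_ ∘ _) ⊠ _)).
by apply: eq_sw => x n0; rewrite tmapE lcompE swapE mulmE.
Qed.

Lemma act_yd_hom (M N : ydata H) x (f : yd_hom M N) m :
  (yd_act (yd_hom M N) (tens x f) : {linear M -> N}) m =
  \∑(x1, x2 <- comul H x) yd_act N (tens x1 ((f : {linear M -> N}) (yd_act M (tens (antipode H x2) m)))).
Proof.
rewrite [LHS]curryE 5!lcompE tmapE lcompE tmapE arot_sw.
move: (yd_act M) (yd_act N) => aM aN.
pose L t := aN ((lid H ⊠ ev M N) (asc H (LHom M N) M ((lid (H ⊗ LHom M N) ⊠ (aM ∘ (antipode H ⊠ lid M)))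
   (asc (H ⊗ LHom M N) H M (tens t m))))).
have Ll : linear L by rewrite /L; mlin.
rewrite -/(L _) (sw_linear _ Ll); apply: eq_sw => x1 x2.
by rewrite swapE sw_tens // /L asc_tens tmapE lcompE tmapE asc_tens tmapE evE.
Qed.

Lemma mild_yd_hom (M N : ydata H) : fin_dim M -> mild M -> mild N -> mild (yd_hom M N).
Proof.
move=> fM [hM1 hM2] [hN1 hN2]; split=> f.
  apply: lhomE => m; rewrite act_yd_hom (pD1 hH) sw_tens //.
  by rewrite (antip1 hH) hM1 hN1.
apply: lhomE => m.
pose G (t : H ⊗ N) := \∑(x, n0 <- t) (counit H x : k) *: n0.
have Gl : linear G by rewrite /G; mlin.
transitivity (G (tev (yd_coact (yd_hom M N) f) m)).
  rewrite /G sw_tev // (sw_linear (fun g : LHom M N => (g : {linear M -> N}) m)); last by mlin.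
  by [].
rewrite tev_yd_hom // (sw_linear _ Gl) -[in RHS](hM2 m) sw_lin; apply: eq_sw => y m0.
rewrite linearZ /= -[in RHS](hN2 ((f : {linear M -> N}) m0)) swZ (sw_linear _ Gl); apply: eq_sw => x n0.
by rewrite /G sw_tens // (peM hH) (eps_ai (h := hH) TSH) mulrC scalerA.
Qed.

Lemma trivH_yd_hom (M N : ydata H) : fin_dim M -> trivH M -> trivH N -> trivH (yd_hom M N).
Proof.
move=> fM tM tN; have [[hM1 hM2] [hN1 hN2]] := (tM, tN); split=> [x f|f].
  apply: lhomE => m; rewrite act_yd_hom.
  transitivity ((counit H x : k) *: (f : {linear M -> N}) m) => //.
  rewrite -(counl hH x (f := fun x => (counit H x : k) *: (f : {linear M -> N}) m)) //.
  apply: eq_sw => x1 x2; rewrite hM1 hN1 linearZ /= (eps_antip hH).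
  by [].
have [n [e [c ec]]] := fin_dim_dual_basis fM.
apply: (tev_inj ec) => m; rewrite tev_yd_hom // hM2 sw_tens //.
by rewrite hN2 sw_tens // (pmul1l hH) (ai1 (h := hH) STH) /tev sw_tens.
Qed.
End Bridge.

Record hopf_of (k : fieldType) (H : hopfAlg k) (B : chopf H) (hB : phopf B) : Prop := HopfOf {
  ho_mul : forall x y, cmul B (tens x y) = pmul hB x y;
  ho_one : forall a : k, cone B (a : k^o) = a *: pone hB;
  ho_D : ccomul B = pD hB;
  ho_e : ccounit B = pe hB;
  ho_S : cS B = pS hB
}.

Section HopfOf.
Variables (k : fieldType) (H : hopfAlg k).
Hypothesis antipode_bij : bijective (antipode H).
Variable B : chopf H.
Hypotheses (B_hopf : is_chopf B) (B_triv : trivH B).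

Lemma cone_scale (a : k) : cone B (a : k^o) = a *: cone B (1 : k).
Proof. by rewrite -linearZ /=; congr (cone B _); rewrite [RHS]mulr1. Qed.

(** Among the Hopf algebra axioms in the category only the compatibility of product and coproduct
    contains the braiding, which is the flip by triviality. *)
Lemma hopf_of_exists : exists hB : phopf B, hopf_of hB.
Proof.
have braidBB t : braid B B t = swap B B t.
  exact: (mild_braid_l antipode_bij B_triv (trivH_mild B_triv)).
case: B_hopf => -[_ _ _ mA [m1 m2]] [_ _ cA c1 c2] [bM b1 bE b1E] _ [S1 S2].
have mb : bilin (fun x y : B => cmul B (tens x y)) by mlin.
have mA' : associative (fun x y : B => cmul B (tens x y)).
  by move=> x y z; have := lin_eqE mA (tens (tens x y) z); rewrite 3!lcompE !tmapE asc_tens tmapE.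
have m1' : left_id (cone B (1 : k)) (fun x y : B => cmul B (tens x y)).
  by move=> x; have := lin_eqE m1 (tens (1 : k^o) x); rewrite lcompE tmapE lunE scale1r.
have m2' : right_id (cone B (1 : k)) (fun x y : B => cmul B (tens x y)).
  by move=> x; have := lin_eqE m2 (tens x (1 : k^o)); rewrite lcompE tmapE runE scale1r.
pose A := PAlg mb mA' m1' m2'.
have hD x : (ccomul B ⊠ lid B) (ccomul B x) = ascV B B B ((lid B ⊠ ccomul B) (ccomul B x)).
  by have := lin_eqE cA x; rewrite 3!lcompE.
have hl x : \∑(a, b <- ccomul B x) (ccounit B a : k) *: b = x.
  rewrite -[RHS](lin_eqE c1 x) 2!lcompE tmap_swE (sw_lin (lun _)).
  by apply: eq_sw => a b; rewrite lunE.
have hr x : \∑(a, b <- ccomul B x) (ccounit B b : k) *: a = x.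
  rewrite -[RHS](lin_eqE c2 x) 2!lcompE tmap_swE (sw_lin (run _)).
  by apply: eq_sw => a b; rewrite runE.
have hM x y : ccomul B (pmul A x y) =
    \∑(a, b <- ccomul B x) \∑(c, d <- ccomul B y) tens (pmul A a c) (pmul A b d).
  have := lin_eqE bM (tens x y); rewrite 3!lcompE tmapE tmap_amid_sw => ->.
  do 2 (apply: eq_sw => ? ?); rewrite braidBB swapE sw_tens //.
have h1 : ccomul B (pone A) = tens (pone A) (pone A).
  by have := lin_eqE b1 (1 : k^o); rewrite 2!lcompE /= tmapE.
have hE x y : ccounit B (pmul A x y) = (ccounit B x : k) * ccounit B y :> k.
  by have := lin_eqE bE (tens x y); rewrite 2!lcompE tmapE lunE.
have hE1 : ccounit B (pone A) = 1 :> k by exact: (lin_eqE b1E (1 : k^o)).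
have hS1 x : \∑(a, b <- ccomul B x) pmul A (cS B a) b = (ccounit B x : k) *: pone A.
  have := lin_eqE S1 x; rewrite 3!lcompE cone_scale => <-.
  by rewrite tmap_swE (sw_lin (cmul B)).
have hS2 x : \∑(a, b <- ccomul B x) pmul A a (cS B b) = (ccounit B x : k) *: pone A.
  have := lin_eqE S2 x; rewrite 3!lcompE cone_scale => <-.
  by rewrite tmap_swE (sw_lin (cmul B)).
exists (PHopf hD hl hr hM h1 hE hE1 hS1 hS2); split=> //.
by move=> a; exact: cone_scale.
Qed.
End HopfOf.

(** * Objects and endomorphism algebras over B in Sweedler form *)

Section OverB.
Variables (k : fieldType) (H : hopfAlg k).
Hypothesis antipode_bij : bijective (antipode H).
Variables (B : chopf H) (hB : phopf B).
Hypotheses (B_triv : trivH B) (hBP : hopf_of hB) (S_bij : bijective (pS hB)).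
Local Notation T := (linv (cS B)).
Local Notation Δ := (pD hB).
Local Notation ε := (pe hB).
Local Notation S := (pS hB).
Local Notation "x ∙ y" := (pmul hB x y) (at level 39, left associativity).
Local Notation e1 := (pone hB).

Lemma cS_linvK : cancel S T. Proof. by rewrite (ho_S hBP); exact: (linvP S_bij).1. Qed.
Lemma linv_cSK : cancel T S. Proof. by rewrite (ho_S hBP); exact: (linvP S_bij).2. Qed.

Let Bmild : mild B. Proof. exact: trivH_mild. Qed.
Lemma braidBM (M : ydata H) : mild M -> forall t, braid B M t = swap B M t.
Proof. by move=> hM; exact: (mild_braid_l antipode_bij B_triv). Qed.
Lemma braidMB (M : ydata H) : mild M -> forall t, braid M B t = swap M B t.
Proof. by move=> hM; exact: (mild_braid_r antipode_bij hM B_triv). Qed.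

(** The braidings in [is_byd] involve B, so they are flips even if H acts non-trivially on M. *)
Lemma byd_ydmod (M : bdata B) : is_byd M -> ydmod hB (lid B) (curry (bact M)) (bcoact M).
Proof.
case=> yM _ [aA a1] [cA c1] ydM; have mM := is_yd_mild yM.
split.
- move=> m; rewrite curryE; have := lin_eqE a1 (tens (1 : k^o) m).
  by rewrite lcompE tmapE lunE scale1r (ho_one hBP) scale1r.
- move=> x y m; rewrite !curryE -(ho_mul hBP).
  by have := lin_eqE aA (tens (tens x y) m); rewrite 3!lcompE !tmapE asc_tens tmapE.
- move=> X F m hF.
  pose L (t : B ⊗ B ⊗ M) := \∑(s, m' <- t) \∑(a, b <- s) F a b m'.
  have hL : linear L by rewrite /L; mlin.
  have := congr1 L (lin_eqE cA m); rewrite 3!lcompE (ho_D hBP).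
  rewrite /L sw_tmap //.
  move=> ->; rewrite tmap_swE (sw_lin (ascV _ _ _)) sw_sw //.
  apply: eq_sw => x m'; rewrite ascVE sw_sw //.
  apply: eq_sw => y m''; rewrite sw_tens //.
  by rewrite sw_tens.
- move=> m; rewrite -[RHS](lin_eqE c1 m) 2!lcompE (ho_e hBP) tmap_swE (sw_lin (lun _)).
  by apply: eq_sw => x m'; rewrite lunE.
- move=> X F b m hF.
  have := lin_eqE ydM (tens b m); rewrite 6!lcompE !tmapE (ho_D hBP).
  rewrite yd_rhsE tmap_amid_sw => E.
  have E' : \∑(b1, b2 <- Δ b) \∑(x, m' <- bcoact M (bact M (tens b1 m))) tens (x ∙ b2) m' =
      \∑(b1, b2 <- Δ b) \∑(x, m' <- bcoact M m) tens (b1 ∙ x) (bact M (tens b2 m')).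
    transitivity (\∑(u, v <- pD hB b) \∑(w', v' <- braid B M (tens v m))
       \∑(a, m0 <- (bcoact M ∘ bact M) (tens u w')) \∑(n, b0 <- braid M B (tens m0 v')) tens (cmul B (tens a n)) b0).
      apply: eq_sw => b1 b2; rewrite braidBM // swapE sw_tens; last first.
        by move: (bcoact M ∘ bact M) => f; mlin.
      rewrite lcompE; apply: eq_sw => x m'; rewrite braidMB // swapE sw_tens ?(ho_mul hBP) //.
    rewrite E; apply: eq_sw => b1 b2; apply: eq_sw => x m'.
    by rewrite braidBM // swapE sw_tens ?(ho_mul hBP).
  have Fl : linear (fun t => sw t F) by exact: (@lin_swl _ _ _ _ _ F (fun t => t)).
  have := congr1 (fun t => sw t F) E'; rewrite !(sw_linear _ Fl).
  under eq_sw => b1 b2 do (rewrite (sw_linear _ Fl); under eq_sw => x m' do rewrite sw_tens //).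
  move=> ->; apply: eq_sw => b1 b2; rewrite (sw_linear _ Fl); apply: eq_sw => x m'.
  by rewrite sw_tens.
Qed.

(** Every linear map between objects with trivial structures is a morphism over H, so [trivH M]
    leaves only the conditions over B. *)
Lemma ydmod_byd (M : bdata B) : trivH M -> ydmod hB (lid B) (curry (bact M)) (bcoact M) -> is_byd M.
Proof.
move=> tM [H1 HM HA HE HYD]; have mM := trivH_mild tM.
have aE b m : (curry (bact M) b : {linear M -> M}) m = bact M (tens b m) by [].
split.
- exact: trivH_is_yd tM.
- split; apply: trivH_mor => //; exact: trivH_tens.
- split; apply: lin_ext.
    apply: tens_lin_ext3 => // x y m.
    by rewrite 3!lcompE !tmapE asc_tens tmapE (ho_mul hBP) -!aE HM.
  apply: tens_lin_ext => // a m.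
  by rewrite lcompE tmapE lunE (ho_one hBP) (linZ (fun b => bact M (tens b m))) // -aE H1.
- split; apply: lin_ext => m.
    rewrite 3!lcompE !tmap_swE (sw_lin (ascV _ _ _)) (ho_D hBP).
    transitivity (\∑(x, m' <- bcoact M m) \∑(a, b <- Δ x) tens (tens a b) m').
      apply: eq_sw => x m'; rewrite -(sw_linear (fun t => tens t m')) //.
      by rewrite sw_id.
    rewrite (HA _ (fun a b m' => tens (tens a b) m')) //.
    by apply: eq_sw => x m'; rewrite ascVE.
  rewrite 2!lcompE tmap_swE (sw_lin (lun _)) (ho_e hBP) -[RHS]HE.
  by apply: eq_sw => x m'; rewrite lunE.
- apply: lin_ext; apply: tens_lin_ext => // b m.
  rewrite 6!lcompE !tmapE (ho_D hBP) yd_rhsE tmap_amid_sw.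
  have E : \∑(b1, b2 <- Δ b) \∑(x, m' <- bcoact M (bact M (tens b1 m))) tens (x ∙ b2) m' =
      \∑(b1, b2 <- Δ b) \∑(x, m' <- bcoact M m) tens (b1 ∙ x) (bact M (tens b2 m')).
    by apply: (HYD _ (fun x m' => tens x m')); mlin.
  transitivity (\∑(b1, b2 <- Δ b) \∑(x, m' <- bcoact M (bact M (tens b1 m))) tens (x ∙ b2) m').
    apply: eq_sw => b1 b2; rewrite braidBM // swapE sw_tens; last first.
      by move: (bcoact M ∘ bact M) => f; mlin.
    rewrite lcompE; apply: eq_sw => x m'; rewrite braidMB // swapE sw_tens ?(ho_mul hBP) //.
  rewrite E; apply: eq_sw => b1 b2; apply: eq_sw => x m'.
  by rewrite braidBM // swapE sw_tens ?(ho_mul hBP).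
Qed.

Lemma bact_tens (M N : bdata B) b (m : M) (n : N) : mild M ->
  bact (byd_tens M N) (tens b (tens m n)) =
  \∑(b1, b2 <- Δ b) tens (bact M (tens b1 m)) (bact N (tens b2 n)).
Proof.
move=> mM; rewrite [LHS]lcompE lcompE tmapE tmap_amid_sw (ho_D hBP).
apply: eq_sw => b1 b2; rewrite sw_tens //.
by rewrite braidBM // swapE sw_tens.
Qed.

Lemma bcoact_tens (M N : bdata B) (m : M) (n : N) : mild M ->
  bcoact (byd_tens M N) (tens m n) =
  \∑(x, m' <- bcoact M m) \∑(y, n' <- bcoact N n) tens (x ∙ y) (tens m' n').
Proof.
move=> mM; rewrite [LHS]lcompE lcompE tmapE tmap_amid_sw.
do 2 (apply: eq_sw => ? ?).
by rewrite braidMB // swapE sw_tens ?(ho_mul hBP).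
Qed.

Lemma byd_braidE (M N : bdata B) (m : M) (n : N) : mild M -> trivH N ->
  byd_braid M N (tens m n) = \∑(b, n' <- bcoact N n) tens n' (bact M (tens (T b) m)).
Proof.
move=> mM tN; have mN := trivH_mild tN; rewrite 5!lcompE.
rewrite (braidV_swap (mild_braid_l antipode_bij tN mM)) swapE.
rewrite (braidV_swap (braidMB mN)) [(bcoact N ⊠ _) _]tmapE.
pose L t := (lid N ⊠ bact M) (asc N B M ((swap B N ⊠ lid M) (((T ⊠ lid N) ⊠ lid M) (tens t m)))).
have Ll : linear L by rewrite /L; mlin.
rewrite -[bcoact N n in LHS]sw_id -/(L _) (sw_linear _ Ll).
by apply: eq_sw => b n'; rewrite /L !tmapE swapE asc_tens tmapE.
Qed.

Section EndBalg.
Variable M : bdata B.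
Hypotheses (M_mild : mild M) (M_fin : fin_dim M).

Lemma mild_end : mild (yd_hom M M). Proof. exact: mild_yd_hom. Qed.

Lemma endo_mulE (f g : LHom M M) : endo_mul M (tens f g) = pmul (pend M) f g.
Proof.
apply: lhomE => m; rewrite [LHS]curryE 2!lcompE asc_tens tmapE !evE.
by [].
Qed.

Lemma end_mul (f g : balg_end M) : bmul (balg_end M) (tens f g) = pmul (pend M) f g.
Proof. exact: endo_mulE. Qed.

Lemma end_one : bone (balg_end M) (1 : k^o) = pone (pend M).
Proof. by apply: lhomE => m; rewrite [LHS]curryE lunE scale1r. Qed.

Lemma end_act b (f : balg_end M) :
  bact (balg_end M) (tens b f) = iact hB (pend M) (curry (bact M)) b f.
Proof.
rewrite [LHS]lcompE 4!lcompE tmapE (ho_D hBP).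
pose L t := endo_mul M ((endo_mul M ⊠ lid _) (((curry (bact M) ⊠ lid _) ⊠ curry (bact M))
  (arot B (braid B (yd_hom M M)) (((lid B ⊠ cS B) ⊠ lid _) (tens t f))))).
have Ll : linear L by rewrite /L; mlin.
rewrite -/(L _) -[Δ b]sw_id (sw_linear _ Ll); apply: eq_sw => b1 b2.
by rewrite /L !tmapE arotE (braidBM mild_end) swapE sw_tens // !tmapE !endo_mulE (ho_S hBP).
Qed.

Lemma tev_end_coact (f : balg_end M) m :
  tev (bcoact (balg_end M) f) m =
  \∑(y, m0 <- bcoact M m) \∑(x, m1 <- bcoact M ((f : {linear M -> M}) m0)) tens (x ∙ T y) m1.
Proof.
rewrite [LHS](the_lin_ev _ M_fin) 7!lcompE tmapE.
pose L t := ((cmul B ∘ braid B B) ⊠ lid M) (ascV B B M ((lid B ⊠ (bcoact M ∘ ev M M)) (asc B (LHom M M) M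
  (((T ⊠ lid _) ⊠ lid M) ((braid (yd_hom M M) B ⊠ lid M) (ascV (LHom M M) B M (tens f t))))))).
have Ll : linear L by rewrite /L; mlin.
rewrite -[bcoact M m in LHS]sw_id -/(L _) (sw_linear _ Ll); apply: eq_sw => y m0.
rewrite /L ascV_tens tmapE (braidMB mild_end) swapE !tmapE asc_tens tmapE lcompE evE ascVE.
rewrite (sw_lin ((_ ∘ _) ⊠ _)); apply: eq_sw => x m1.
by rewrite tmapE lcompE (braidBM Bmild) swapE (ho_mul hBP).
Qed.

Lemma end_coact n (e : 'I_n -> M) (c : 'I_n -> {linear M -> k^o}) (ec : dual_basis e c) (f : balg_end M) :
  bcoact (balg_end M) f = icoact hB T (pend M) (umod e c (bcoact M)) f.
Proof. by apply: (tev_inj ec) => m; rewrite tev_end_coact (tev_coact _ _ ec). Qed.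
End EndBalg.
End OverB.

(** * Braided algebras identified with plain algebras *)

Section Via.
Variables (k : fieldType) (H : hopfAlg k).
Hypothesis antipode_bij : bijective (antipode H).
Variables (B : chopf H) (hB : phopf B).
Hypotheses (B_triv : trivH B) (hBP : hopf_of hB) (S_bij : bijective (pS hB)).
Local Notation T := (linv (cS B)).
Local Notation Δ := (pD hB).
Local Notation ε := (pe hB).
Local Notation S := (pS hB).
Local Notation "x ∙ y" := (pmul hB x y) (at level 39, left associativity).
Local Notation e1 := (pone hB).
Let ST := cS_linvK hBP S_bij.
Let TS := linv_cSK hBP S_bij.

(* [ph] identifies the braided algebra [X] with the plain algebra [C], on which
   [B] acts and coacts by conjugation with [th] and [U]. *)
Record via (X : balg B) (Z : lmodType k) (C : palg Z) (ph : {linear X -> Z})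
    (th : {linear B -> Z}) (U : B ⊗ Z) : Prop := Via {
  v_mul : forall x y, ph (bmul X (tens x y)) = pmul C (ph x) (ph y);
  v_one : ph (bone X (1 : k^o)) = pone C;
  v_act : forall b x, ph (bact X (tens b x)) = iact hB C th b (ph x);
  v_coact : forall x, (lid B ⊠ ph) (bcoact X x) = icoact hB T C U (ph x);
  v_bij : exists2 ps : {linear Z -> X}, cancel ph ps & cancel ps ph
}.

(** The Azumaya property of a plain algebra, in the form in which [azF_bij] and [azG_bij] consume
    it. *)
Definition sandwich_alg (Z : lmodType k) (C : palg Z) : Prop :=
  exists2 can : {linear Z ⊗ Z -> LHom Z Z}, bijective can &
    forall a b c, (can (tens a b) : {linear Z -> Z}) c = pmul C (pmul C a c) b.

Lemma bone_scale (X : balg B) (a : k) : bone X (a : k^o) = a *: bone X (1 : k^o).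
Proof. by rewrite -linearZ /=; congr (bone X _); rewrite [RHS]mulr1. Qed.

Section Azumaya.
Variable X : balg B.
Hypotheses (X_triv : trivH X) (X_fin : fin_dim X) (X_nz : nonzero X).
Let X_mild : mild X. Proof. exact: trivH_mild. Qed.

(** Conditions over H hold since all structures over H are trivial; those over B are the identities
    of [iact] and [icoact]. The braiding unfolds the two Azumaya maps into the shapes treated by
    [azF_bij] and [azG_bij]. *)
Lemma inner_azumaya (A : palg X) (al al' : {linear B -> B}) (th : {linear B -> X}) (U : B ⊗ X) :
  hopf_mor hB al -> hopf_mor hB al' -> cancel al al' -> cancel al' al ->
  via A (lid X) th U -> datum hB A al th U -> sandwich_alg A -> azumaya X.
Proof.
move=> al_mor al'_mor alK al'K [vM v1 va vc _] d [can can_bij canE].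
have mulE x y : bmul X (tens x y) = pmul A x y by exact: vM.
have oneE (a : k) : bone X (a : k^o) = a *: pone A by rewrite bone_scale; congr (_ *: _); exact: v1.
have actE b x : bact X (tens b x) = iact hB A th b x by exact: va.
have coactE x : bcoact X x = icoact hB T A U x.
  rewrite -[RHS]vc -[LHS]sw_id tmap_swE; by [].
have ha := iact_bilin hB A th.
have hc := icoact_lin hB T A U.
have XX_triv : trivH (byd_tens X X) by exact: trivH_tens.
split=> //.
- split.
  + apply: (ydmod_byd antipode_bij B_triv hBP) => //; split.
    * by move=> m; rewrite curryE actE (act1 d).
    * by move=> x y m; rewrite !curryE !actE (actM d).
    * by move=> Y F m hF; rewrite !coactE (coact_coassoc ST TS d) //; apply: eq_sw => x p; rewrite coactE.
    * by move=> m; rewrite coactE (coact_coun TS d).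
    * move=> Y F b m hF.
      pose L (t : B ⊗ X) := \∑(x, p <- t) F x p.
      have Ll : linear L by rewrite /L; mlin.
      have := congr1 L (act_yd ST TS d b m).
      rewrite !(sw_linear _ Ll) => E.
      transitivity (\∑(b1, b2 <- Δ b) L (tpmul hB A (icoact hB T A U (iact hB A th b1 m)) (tens b2 (pone A)))).
        apply: eq_sw => b1 b2; rewrite curryE actE coactE /L tpmul_sw //; apply: eq_sw => x p.
        by rewrite sw_tens ?pmul1r.
      rewrite E; apply: eq_sw => b1 b2; rewrite (sw_linear _ Ll) coactE; apply: eq_sw => x p.
      by rewrite /L sw_tens // curryE actE.
  + split; first exact: trivH_mor.
      apply: lin_ext => t; move: t; apply: tens_lin_ext => // b.
      apply: tens_lin_ext => // x y.
      rewrite 2!lcompE (bact_tens antipode_bij B_triv hBP) // tmapE mulE actE (act_mul d) (sw_lin (bmul X)).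
      by apply: eq_sw => b1 b2; rewrite mulE !actE.
    apply: lin_ext; apply: tens_lin_ext => // x y.
    rewrite 2!lcompE mulE coactE (coactM ST TS d) (bcoact_tens antipode_bij B_triv hBP) //.
    rewrite !coactE (sw_lin (lid B ⊠ bmul X)) /tpmul; apply: eq_sw => u p.
    rewrite (sw_lin (lid B ⊠ bmul X)); apply: eq_sw => w q.
    by rewrite tmapE mulE.
  + split; first exact: trivH_mor (trivH_unit H) X_triv.
      apply: lin_ext; apply: tens_lin_ext => // b a.
      rewrite 2!lcompE oneE; transitivity (((ε b : k) * a) *: pone A).
        by congr (_ *: _); rewrite [LHS]lcompE tmapE lunE (ho_e hBP).
      by rewrite tmapE oneE (linZ (tens b)) // linearZ /= actE (act_one d) scalerA mulrC.
    apply: lin_ext => a; rewrite 2!lcompE oneE (linZ (bcoact X)) ?coactE ?(coact1 ST TS d) //.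
    have -> : bcoact (byd_unit B) a = tens (cone B (1 : k)) (a : k^o) by rewrite [LHS]lcompE [LHS]tmapE.
    rewrite tmapE (ho_one hBP) scale1r oneE.
    by rewrite (linZ (tens e1)).
  + apply: lin_ext; apply: tens_lin_ext3 => // x y z.
    by rewrite 3!lcompE !tmapE asc_tens tmapE !mulE pmulA.
  + split; apply: lin_ext; apply: tens_lin_ext; try mlin.
      by move=> a x; rewrite lcompE tmapE lunE oneE mulE (linZ (fun z => pmul A z x)) ?pmul1l.
    by move=> x a; rewrite lcompE tmapE runE oneE mulE (linZ (pmul A x)) ?pmul1r.
- apply: (azF_bij ST TS al_mor al'_mor alK al'K d canE can_bij) => a b c.
  rewrite [LHS]curryE 2!lcompE asc_tens tmapE lcompE (byd_braidE antipode_bij B_triv) // mulE coactE.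
  rewrite (sw_lin (bmul X)) (sw_linear (pmul A (lid X a))) //.
  by apply: eq_sw => x c'; rewrite mulE actE.
- apply: (azG_bij ST TS al_mor al'_mor alK al'K d canE can_bij) => a b c.
  rewrite [LHS]curryE 3!lcompE swapE ascV_tens tmapE lcompE (byd_braidE antipode_bij B_triv) // mulE coactE.
  rewrite (sw_lin (bmul X)) (sw_linear (fun z => pmul A z (lid X b))) //.
  by apply: eq_sw => x c'; rewrite mulE actE.
Qed.

(** The product of [X], with associativity and unit read through [ph], is a plain algebra to which
    the data and the sandwich property are pulled back; the identification then becomes the
    identity. *)
Lemma via_azumaya Z (C : palg Z) (ph : {linear X -> Z}) (al al' : {linear B -> B})
    (th : {linear B -> Z}) (U : B ⊗ Z) :
  hopf_mor hB al -> hopf_mor hB al' -> cancel al al' -> cancel al' al ->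
  via C ph th U -> datum hB C al th U -> sandwich_alg C -> azumaya X.
Proof.
move=> al_mor al'_mor alK al'K [vM v1 va vc [ps phK psK]] d [can [cV canK cVK] canE].
have phI := can_inj phK.
have mb : bilin (fun x y : X => bmul X (tens x y)) by mlin.
have mA : associative (fun x y : X => bmul X (tens x y)).
  by move=> x y z; apply: phI; rewrite !vM pmulA.
have m1 : left_id (bone X (1 : k^o)) (fun x y : X => bmul X (tens x y)).
  by move=> x; apply: phI; rewrite vM v1 pmul1l.
have m2 : right_id (bone X (1 : k^o)) (fun x y : X => bmul X (tens x y)).
  by move=> x; apply: phI; rewrite vM v1 pmul1r.
pose A := PAlg mb mA m1 m2.
have ps1 : ps (pone C) = pone A by apply: phI; rewrite psK v1.
have psM f g : ps (pmul C f g) = pmul A (ps f) (ps g) by apply: phI; rewrite psK vM !psK.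
have dA := datum_om ps1 psM d.
apply: (inner_azumaya al_mor al'_mor alK al'K _ dA).
  split=> //.
  - by move=> b x; rewrite /= -[x in RHS]phK (act_om hB psM) -va phK.
  - move=> x; rewrite -[x in RHS]phK (coact_om hB T psM) -vc tmap_swE [RHS]tmap_swE sw_tmap //.
    by apply: eq_sw => y z; rewrite phK.
  - by exists (lid X).
have cl a b : linear (fun c => ps (pmul C (pmul C (ph a) (ph c)) (ph b))) by mlin.
have cb : bilin (fun a b : X => mk_lin (cl a b) : LHom X X).
  split=> [b|a] u x y; apply: lin_ext => c /=.
    have l : linear (fun a => ps (pmul C (pmul C (ph a) (ph c)) (ph b))) by mlin.
    exact: l.
  have l : linear (fun b => ps (pmul C (pmul C (ph a) (ph c)) (ph b))) by mlin.
  exact: l.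
pose G (F : LHom X X) : LHom Z Z := ph \o F \o ps.
pose GV (F : LHom Z Z) : LHom X X := ps \o F \o ph.
have GVl : linear GV by move=> a F F'; apply: lin_ext => c /=; rewrite linearP.
exists (tlift cb).
  have -> : tlift cb = mk_lin GVl \o can \o (ph ⊠ ph).
    apply: tensor_lin_ext => a b; apply: lin_ext => c.
    by rewrite tliftE /= tmapE canE.
  have Gbij : bijective (mk_lin GVl).
    exists G => F; apply: lin_ext => c /=; first by rewrite !psK.
    by rewrite !phK.
  have pbij : bijective (ph ⊠ ph) by exists (ps ⊠ ps); exact: tmap_cancel.
  exact: bij_comp (bij_comp Gbij (Bijective canK cVK)) pbij.
move=> a b c; rewrite tliftE /=; apply: phI.
by rewrite psK !vM.
Qed.
End Azumaya.

(** The identification is [tau] after [ph] ⊗ [ph']. [Y] is [mild] rather than [trivH] because it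
    will be End(M) for an arbitrary M in a Brauer equivalence. *)
Lemma via_tens (X Y : balg B) (W W' Z : lmodType k) (A : palg W) (A' : palg W') (C : palg Z)
    (ph : {linear X -> W}) (ph' : {linear Y -> W'}) (al be : {linear B -> B})
    (th : {linear B -> W}) (U : B ⊗ W) (th' : {linear B -> W'}) (U' : B ⊗ W')
    (l : {linear W -> Z}) (r : {linear W' -> Z})
    (al_mor : hopf_mor hB al) (d : datum hB A al th U) (d' : datum hB A' be th' U')
    (l1 : l (pone A) = pone C) (lM : forall f g, l (pmul A f g) = pmul C (l f) (l g))
    (r1 : r (pone A') = pone C) (rM : forall f g, r (pmul A' f g) = pmul C (r f) (r g))
    (lr : forall f g, pmul C (l f) (r g) = pmul C (r g) (l f))
    (mult_bij : exists2 m : Z -> W ⊗ W', linear m &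
       (forall f g, m (pmul C (l f) (r g)) = tens f g) /\
       (forall z, \∑(f, g <- m z) pmul C (l f) (r g) = z)) :
  trivH X -> mild Y -> via A ph th U -> via A' ph' th' U' ->
  exists ta : {linear balg_tens X Y -> Z},
    via C ta (thC hB C al th th' l r) (UC hB C U U' l r).
Proof.
move=> X_triv Y_mild [vM v1 va vc [ps phK psK]] [vM' v1' va' vc' [ps' phK' psK']].
have X_mild := trivH_mild X_triv.
have tl := tau_lin hB T A A' C U th' l r.
have dC := datum_tensor al_mor d d' l1 lM r1 rM lr.
have [tV tK tVK] := tau_bij ST TS d d' mult_bij.
pose ta : {linear balg_tens X Y -> Z} := mk_lin tl \o (ph ⊠ ph').
have taE x y : ta (tens x y) = tau hB T A A' C U th' l r (tens (ph x) (ph' y)).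
  by rewrite /= tmapE.
have hc := icoact_lin hB T A U; have hc' := icoact_lin hB T A' U'.
have ha := iact_bilin hB A th; have ha' := iact_bilin hB A' th'.
have haC := iact_bilin hB C (thC hB C al th th' l r).
have hcC := icoact_lin hB T C (UC hB C U U' l r).
exists ta; split.
- move=> s t.
  move: s; apply: tens_lin_ext => // x y.
  move: t; apply: tens_lin_ext => // x' y'.
  rewrite !taE -(tau_mul ST TS d d' l1 lM r1 rM lr).
  rewrite [X in ta X]lcompE tmap_amid_sw sw_tens // sw_tens // (byd_braidE antipode_bij B_triv) // sw_sw //.
  rewrite (sw_lin ta) (sw_linear _ tl) -vc sw_tmap //.
  apply: eq_sw => z x''; rewrite sw_tens //.
  by rewrite taE vM vM' va'.
- have -> : bone (balg_tens X Y) (1 : k^o) = tens (bone X (1 : k^o)) (bone Y (1 : k^o)).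
    by rewrite [LHS]lcompE [LHS]tmapE.
  by rewrite taE v1 v1' (tau_one ST TS d d' l1 lM r1 rM lr).
- move=> b t; move: t; apply: tens_lin_ext => // x y.
  rewrite taE -(tau_act ST TS al_mor d d' l1 lM r1 rM lr).
  rewrite (bact_tens antipode_bij B_triv hBP) // (sw_lin ta) (sw_linear _ tl).
  by apply: eq_sw => b1 b2; rewrite taE va va'.
- apply: tens_lin_ext => // x y.
  rewrite taE (tau_coact ST TS al_mor d d' l1 lM r1 rM lr).
  rewrite (bcoact_tens antipode_bij B_triv hBP) // (sw_lin (lid B ⊠ ta)) -vc sw_tmap //.
  apply: eq_sw => u x'; rewrite (sw_lin (lid B ⊠ ta)) -vc' sw_tmap //.
  by apply: eq_sw => w y'; rewrite tmapE taE.
- have taV_lin : linear (fun z => (ps ⊠ ps') (tV z)).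
    have tVl : linear tV by move=> a z z'; apply: (can_inj tK); rewrite tl !tVK.
    by mlin.
  exists (mk_lin taV_lin) => [t|z] /=.
    by rewrite tK (tmap_cancel phK phK').
  by rewrite (tmap_cancel psK psK') tVK.
Qed.

(** The isomorphism, read through [ph] and [ph'], carries the data on [C] to [C'], where they induce
    the same action and coaction as the data already there; [datum_uniq] compares the twists. *)
Lemma via_uniq (X X' : balg B) (Z Z' : lmodType k) (C : palg Z) (C' : palg Z')
    (ph : {linear X -> Z}) (ph' : {linear X' -> Z'}) (al be : {linear B -> B})
    (th : {linear B -> Z}) (U : B ⊗ Z) (th' : {linear B -> Z'}) (U' : B ⊗ Z') (phi : {linear Z' -> k^o}) :
  via C ph th U -> via C' ph' th' U' -> datum hB C al th U -> datum hB C' be th' U' ->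
  balg_iso X X' ->
  (forall (Y : lmodType k) (t : Y ⊗ Z'),
    (forall f, \∑(y, p <- t) tens y (pmul C' p f) = \∑(y, p <- t) tens y (pmul C' f p)) ->
    exists y, t = tens y (pone C')) ->
  phi (pone C') = 1 :> k ->
  (forall g, Δ g = tens g g -> ε g = 1 :> k -> forall x, g ∙ x = x ∙ g) ->
  (forall chi : {linear B -> k^o}, chi e1 = 1 :> k ->
    (forall x y, chi (x ∙ y) = (chi x : k) * chi y :> k) ->
    forall x, \∑(a, b <- Δ x) (chi a : k) *: b = \∑(a, b <- Δ x) (chi b : k) *: a) ->
  al =1 be.
Proof.
move=> [vM v1 va vc [ps phK psK]] [vM' v1' va' vc' [ps' phK' psK']] d d' [f [fbij [_ fact fcoact] fM f1]].
move=> cent phi1 gl ch.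
pose om : {linear Z -> Z'} := ph' \o f \o ps.
have psM a b : ps (pmul C a b) = bmul X (tens (ps a) (ps b)).
  by apply: (can_inj phK); rewrite vM !psK.
have om1 : om (pone C) = pone C'.
  rewrite /= -v1' -v1 phK; congr (ph' _).
  by have := lin_eqE f1 (1 : k^o); rewrite lcompE.
have omM a b : om (pmul C a b) = pmul C' (om a) (om b).
  rewrite /= psM -vM'; congr (ph' _).
  by have := lin_eqE fM (tens (ps a) (ps b)); rewrite 2!lcompE tmapE.
have [g fg gf] := fbij.
have surj z : exists x, z = ph' (f x) by exists (g (ps' z)); rewrite gf psK'.
have omE x : om (ph x) = ph' (f x) by rewrite /= phK.
have sact b z : iact hB C' th' b z = iact hB C' (om \o th) b z.
  have [x ->] := surj z; rewrite -omE (act_om hB omM) -va omE -va'; congr (ph' _).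
  have := lin_eqE fact (tens b x); rewrite 2!lcompE tmapE => E.
  by rewrite phK E.
have scoact z : icoact hB T C' U' z = icoact hB T C' ((lid B ⊠ om) U) z.
  have [x ->] := surj z; rewrite -omE (coact_om hB T omM) -vc omE -vc'.
  have := lin_eqE fcoact x; rewrite 2!lcompE => ->.
  rewrite [(lid B ⊠ f) _]tmap_swE (sw_lin (lid B ⊠ ph')) [(lid B ⊠ ph) _]tmap_swE (sw_lin (lid B ⊠ om)).
  by apply: eq_sw => y x'; rewrite !tmapE omE.
exact: (datum_uniq ST TS d' (datum_om om1 omM d) sact scoact cent phi1 gl ch).
Qed.

(** Conjugation by [g] carries (th, U) to (th', U'), hence also the inner structures that they
    define. *)
Lemma via_iso (X X' : balg B) (P P' : lmodType k) (ph : {linear X -> LHom P P}) (ph' : {linear X' -> LHom P' P'})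
    (th : {linear B -> LHom P P}) (U : B ⊗ LHom P P) (th' : {linear B -> LHom P' P'}) (U' : B ⊗ LHom P' P')
    (g : {linear P -> P'}) (gV : {linear P' -> P}) :
  trivH X -> trivH X' -> via (pend P) ph th U -> via (pend P') ph' th' U' ->
  cancel g gV -> cancel gV g -> fin_dim P' ->
  (forall b p, gV ((th' b : {linear P' -> P'}) p) = (th b : {linear P -> P}) (gV p)) ->
  (forall p, (lid B ⊠ gV) (tev U' p) = tev U (gV p)) ->
  balg_iso X X'.
Proof.
move=> tX tX' [vM v1 va vc [ps phK psK]] [vM' v1' va' vc' [ps' phK' psK']] gK gVK P'_fin gth gU.
have [n [e [c ec]]] := fin_dim_dual_basis P'_fin.
have cjl : linear (fun f : LHom P P => (g \o (f : {linear P -> P}) \o gV : LHom P' P')).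
  by move=> a f f'; apply: lin_ext => p /=; rewrite linearP.
pose om : {linear LHom P P -> LHom P' P'} := mk_lin cjl.
have omE f p : (om f : {linear P' -> P'}) p = g ((f : {linear P -> P}) (gV p)) by [].
have om1 : om (pone (pend P)) = pone (pend P') by apply: lhomE => p; rewrite omE /= gVK.
have omM f f' : om (pmul (pend P) f f') = pmul (pend P') (om f) (om f').
  by apply: lhomE => p; rewrite omE !pendE !omE gK.
have omI : injective om.
  move=> f f' E; apply: lhomE => p; have := congr1 (fun F : LHom P' P' => (F : {linear P' -> P'}) (g p)) E.
  by rewrite !omE gK => /(can_inj gK).
have thE b : th' b = om (th b) by apply: lhomE => p; rewrite omE -gth gVK.
have UE : U' = (lid B ⊠ om) U.
  apply: (tev_inj ec) => p; rewrite -[LHS](tmap_cancel (f := lid B) (f' := lid B) _ gVK) // gU.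
  rewrite /tev (sw_lin (lid B ⊠ g)) sw_tmap //.
  by apply: eq_sw => x f; rewrite tmapE.
have actE b f : iact hB (pend P') th' b (om f) = om (iact hB (pend P) th b f).
  rewrite -(act_om hB omM); apply: eq_sw => b1 b2.
  by rewrite !thE.
pose F : {linear X -> X'} := ps' \o om \o ph.
have FE x : ph' (F x) = om (ph x) by rewrite /= psK'.
have I' := can_inj phK'.
have oVl : linear (fun f : LHom P' P' => (gV \o (f : {linear P' -> P'}) \o g : LHom P P)).
  by move=> a f f'; apply: lin_ext => p /=; rewrite linearP.
exists F; split.
- exists (fun y => ps (gV \o (ph' y : {linear P' -> P'}) \o g : LHom P P)) => x.
    rewrite FE; apply: (can_inj phK); rewrite psK; apply: lhomE => p /=.
    by rewrite !gK.
  apply: I'; rewrite FE psK; apply: lhomE => p /=.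
  by rewrite !gVK.
- split; first exact: trivH_mor.
    apply: lin_ext; apply: tens_lin_ext => // b x.
    by rewrite 2!lcompE tmapE; apply: I'; rewrite FE va va' FE actE.
  apply: lin_ext => x; rewrite 2!lcompE.
  have inj : injective (lid B ⊠ ph') by apply: can_inj (tmap_cancel (f := lid B) (f' := lid B) _ phK').
  apply: inj; rewrite vc' FE UE (coact_om hB T omM) -vc.
  rewrite [(lid B ⊠ ph) _]tmap_swE (sw_lin (lid B ⊠ om)) [(lid B ⊠ F) _]tmap_swE (sw_lin (lid B ⊠ ph')).
  by apply: eq_sw => y x'; rewrite !tmapE FE.
- apply: lin_ext; apply: tens_lin_ext => // x y.
  by rewrite 2!lcompE tmapE; apply: I'; rewrite FE vM vM' omM !FE.
- apply: lin_ext => a; rewrite 2!lcompE (bone_scale X) (bone_scale X').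
  have <- : F (bone X (1 : k^o)) = bone X' (1 : k^o) by apply: I'; rewrite FE v1 v1' om1.
  by apply: linZ; mlin.
Qed.

Lemma via_end (M : bdata B) n (e : 'I_n -> M) (c : 'I_n -> {linear M -> k^o}) :
  mild M -> dual_basis e c ->
  via (X := balg_end M) (pend M) (lid (LHom M M)) (curry (bact M)) (umod e c (bcoact M)).
Proof.
move=> mM ec.
have fM : fin_dim M.
  by exists n, e => u; exists (fun i => c i u : k); exact: ec.1.
split.
- exact: end_mul.
- exact: end_one.
- by move=> b x; exact: (end_act antipode_bij B_triv hBP).
- move=> x; rewrite tmap_swE -[RHS](end_coact antipode_bij B_triv hBP mM fM ec x).
  by rewrite sw_id.
- by exists (lid (LHom M M)).
Qed.
End Via.

(** * Group-likes *)

Section Grouplikes.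
Variables (k : fieldType) (H : hopfAlg k).
Hypothesis antipode_bij : bijective (antipode H).

(** [point g] is a morphism because the structures of [X] are trivial, so it factors through the
    center; in the identity that defines the center the braiding is a flip, and either side gives
    the same equation. *)
Lemma grouplikes_commute (s : side) (X : chopf H) : trivH X -> grouplikes_in_center s X ->
  forall g : X, ccomul X g = tens g g -> ccounit X g = 1 :> k ->
  forall x, cmul X (tens g x) = cmul X (tens x g).
Proof.
move=> X_triv [Z [i [[_ _ icent _] fact]]] g gD ge x.
have braidXX t : braid X X t = swap X X t.
  exact: (mild_braid_l antipode_bij X_triv (trivH_mild X_triv)).
have [|g' _ gE] := fact (point g).
  split.
  - exact: (@trivH_mor _ _ (yd_unit H) X (point g) (trivH_unit H) X_triv).
  - apply: lin_ext => a; rewrite 2!lcompE.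
    transitivity ((a : k) *: tens g g); first by rewrite -gD; apply: linZ; mlin.
    transitivity (tens (point g (1 : k^o)) (point g a)); last by rewrite [RHS]tmapE.
    by rewrite /= scale1r; symmetry; apply: linZ; mlin.
  - apply: lin_ext => a; rewrite lcompE.
    transitivity ((a : k) *: ccounit X g); first by apply: linZ; mlin.
    by rewrite ge; exact: mulr1.
have {gE} gE : g = i (g' (1 : k^o)) by have := lin_eqE gE (1 : k^o); rewrite lcompE => <-; rewrite /= scale1r.
rewrite gE; case: s icent {fact} => /= E.
  have := lin_eqE E (tens x (g' (1 : k^o))).
  by rewrite 3!lcompE !tmapE braidXX swapE => <-.
have := lin_eqE E (tens (g' (1 : k^o)) x).
by rewrite 3!lcompE !tmapE braidXX swapE => <-.
Qed.

Variable B : chopf H.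
Hypotheses (B_fin : fin_dim B) (B_triv : trivH B).
Local Notation D := (LHom B k^o).

Lemma nested_evE (s : D ⊗ D) (x y : B) : nested_ev B (tens s (tens x y)) =
  \∑(f, g <- s) ((f : {linear B -> k^o}) y : k) *: (g : {linear B -> k^o}) x.
Proof.
rewrite [LHS]lcompE lcompE ascE (sw_lin (lid _ ⊠ _)) (sw_lin (ev _ _)); apply: eq_sw => f g.
rewrite tmapE 2!lcompE ascV_tens tmapE evE lunE evE linearZ /=.
by rewrite /GRing.scale /= mulrC.
Qed.

Lemma nested_ev_inj n (e : 'I_n -> B) (c : 'I_n -> {linear B -> k^o}) (ec : dual_basis e c) (s t : D ⊗ D) :
  (forall x y, nested_ev B (tens s (tens x y)) = nested_ev B (tens t (tens x y))) -> s = t.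
Proof.
move=> st.
have exp (r : D ⊗ D) : r = \sum_i \sum_j
    (nested_ev B (tens r (tens (e i) (e j))) : k) *: tens (c j : D) (c i : D).
  move: r; apply: tens_lin_ext => [|a u v|f g]; first by mlin.
    rewrite scaler_sumr -big_split; apply: eq_bigr => i _ /=.
    rewrite scaler_sumr -big_split; apply: eq_bigr => j _ /=.
    have l : linear (fun s => (nested_ev B (tens s (tens (e i) (e j))) : k) *: tens (c j : D) (c i : D)) by mlin.
    exact: l.
  have dexp (p : D) : \sum_i ((p : {linear B -> k^o}) (e i) : k) *: (c i : D) = p.
    apply: lhomE => b; rewrite lhom_sum -[RHS](db_exp ec) //.
    by apply: eq_bigr => i _; rewrite [LHS]mulrC.
  rewrite -{1}(dexp g) (linsum (fun g : D => tens f g)) //.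
  apply: eq_bigr => i _; rewrite -{1}(dexp f) (linsum (fun f : D => tens f _)) //.
  apply: eq_bigr => j _; rewrite nested_evE sw_tens //.
  by rewrite (linZ (fun f : D => tens f _)) // (linZ (fun g : D => tens _ g)) ?scalerA.
by rewrite (exp s) (exp t); do 2 (apply: eq_bigr => ? _); rewrite st.
Qed.

(** The pairing [nested_ev] is non-degenerate, so the transpose of the multiplication exists, is
    unique, and is what [the_lin] selects. *)
Lemma ccomul_cdual (f : cdual B) x y :
  nested_ev B (tens (ccomul (cdual B) f) (tens x y)) = (f : {linear B -> k^o}) (cmul B (tens x y)).
Proof.
have [n [e [c ec]]] := fin_dim_dual_basis B_fin.
(* c_j stands first because [nested_ev] pairs the first functional with the second argument. *)
pose d0 (f : D) : D ⊗ D := \sum_i \sum_j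
  ((f : {linear B -> k^o}) (cmul B (tens (e i) (e j))) : k) *: tens (c j : D) (c i : D).
have d0l : linear d0.
  move=> a u v; rewrite /d0 scaler_sumr -big_split; apply: eq_bigr => i _ /=.
  rewrite scaler_sumr -big_split; apply: eq_bigr => j _ /=.
  have l : linear (fun f : D => ((f : {linear B -> k^o}) (cmul B (tens (e i) (e j))) : k) *: tens (c j : D) (c i : D)) by mlin.
  exact: l.
have d0E (g : D) u v : nested_ev B (tens (d0 g) (tens u v)) = (g : {linear B -> k^o}) (cmul B (tens u v)).
  have l : linear (fun s => nested_ev B (tens s (tens u v))) by mlin.
  rewrite /d0 (linsum _ l) -(db_exp ec u (f := fun u => (g : {linear B -> k^o}) (cmul B (tens u v)))) //.
  apply: eq_bigr => i _; rewrite (linsum _ l).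
  rewrite -(db_exp ec v (f := fun v => (g : {linear B -> k^o}) (cmul B (tens (e i) v)))) //.
  rewrite scaler_sumr; apply: eq_bigr => j _; rewrite (linZ _ l) nested_evE sw_tens //.
  have mulCA (a b p : k) : a * (b * p) = p * (b * a) by rewrite mulrC [b * p]mulrC -mulrA.
  exact: mulCA.
have pE (d : {linear D -> D ⊗ D}) : nested_ev B ∘ (d ⊠ lid (B ⊗ B)) = ev B k^o ∘ (lid D ⊠ cmul B) <->
    forall g u v, nested_ev B (tens (d g) (tens u v)) = (g : {linear B -> k^o}) (cmul B (tens u v)).
  split=> [E g u v|E].
    have := lin_eqE E (tens g (tens u v)).
    by rewrite lcompE tmapE [in X in _ = X -> _]lcompE tmapE evE.
  apply: lin_ext; apply: tens_lin_ext => // g; apply: tens_lin_ext => // u v.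
  by rewrite [LHS]lcompE [RHS]lcompE !tmapE evE -E.
rewrite -d0E; congr (nested_ev B (tens _ _)).
have -> : ccomul (cdual B) = mk_lin d0l; last by [].
apply: the_linE; first by apply/pE.
move=> d /pE E; apply: lin_ext => g; apply: (nested_ev_inj ec) => u v.
by rewrite E d0E.
Qed.

(** A character of B is a group-like element of the dual, whose structures over H are trivial too.
    It therefore commutes with each c_i in convolution; evaluating at x gives the coordinates of the
    two sides. *)
Lemma characters_commute (s : side) : grouplikes_in_center s (cdual B) ->
  forall chi : {linear B -> k^o}, chi (cone B (1 : k^o)) = 1 :> k ->
  (forall x y, chi (cmul B (tens x y)) = (chi x : k) * chi y :> k) ->
  forall x, \∑(a, b <- ccomul B x) (chi a : k) *: b = \∑(a, b <- ccomul B x) (chi b : k) *: a.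
Proof.
move=> cent chi chi1 chiM x; have [n [e [c ec]]] := fin_dim_dual_basis B_fin.
have D_triv : trivH (cdual B) by exact: (trivH_yd_hom antipode_bij B_fin B_triv (trivH_unit H)).
have comm := @grouplikes_commute s (cdual B) D_triv cent (chi : D).
have cmulE (f g : D) y : (cmul (cdual B) (tens f g) : {linear B -> k^o}) y =
    \∑(a, b <- ccomul B y) ((f : {linear B -> k^o}) b : k) *: (g : {linear B -> k^o}) a.
  rewrite [LHS]curryE lcompE tmapE -[ccomul B y in LHS]sw_id.
  rewrite (sw_linear (fun t => nested_ev B (tens (tens f g) t))) //.
  by apply: eq_sw => a b; rewrite nested_evE sw_tens.
have gD : ccomul (cdual B) (chi : D) = tens (chi : D) (chi : D).
  apply: (nested_ev_inj ec) => u v; rewrite ccomul_cdual nested_evE sw_tens //.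
  by rewrite chiM [RHS]mulrC.
have ge : ccounit (cdual B) (chi : D) = 1 :> k.
  by rewrite [LHS]lcompE lcompE runVE tmapE evE.
have E i : c i (\∑(a, b <- ccomul B x) (chi a : k) *: b) = c i (\∑(a, b <- ccomul B x) (chi b : k) *: a).
  have := congr1 (fun f : D => (f : {linear B -> k^o}) x) (comm gD ge (c i : D)).
  rewrite !cmulE !(sw_lin (c i)) => E.
  rewrite [RHS](_ : _ = \∑(a, b <- ccomul B x) (chi b : k) *: c i a); last first.
    by apply: (eq_sw (W := k^o)) => a b; exact: linearZ.
  rewrite E; apply: (eq_sw (W := k^o)) => a b.
  by rewrite linearZ /=; exact: mulrC.
by rewrite (ec.1 (\∑(a, b <- _) (chi a : k) *: b)) (ec.1 (\∑(a, b <- _) (chi b : k) *: a)); apply: eq_bigr => i _; rewrite E.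
Qed.
End Grouplikes.

(** * The algebras End(B_alpha) *)

Section HopfMorphisms.
Variables (k : fieldType) (V : lmodType k) (h : phopf V).

Lemma hopf_mor_comp (al be : {linear V -> V}) :
  hopf_mor h al -> hopf_mor h be -> hopf_mor h (be \o al).
Proof.
move=> al_mor be_mor; split=> [x y||X F x hF|x] /=.
- by rewrite (hmM al_mor) (hmM be_mor).
- by rewrite (hm1 al_mor) (hm1 be_mor).
- by rewrite (hm_comul be_mor _ hF) (hm_comul al_mor (F := fun a b => F (be a) (be b))).
- by rewrite (hm_eps be_mor) (hm_eps al_mor).
Qed.

Lemma hopf_mor_inv (al al' : {linear V -> V}) :
  hopf_mor h al -> cancel al al' -> cancel al' al -> hopf_mor h al'.
Proof.
move=> [aM a1 aD ae] alK al'K; split.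
- by move=> x y; apply: (can_inj alK); rewrite aM !al'K.
- by apply: (can_inj alK); rewrite a1 al'K.
- move=> X F x hF; rewrite -{2}[x]al'K (aD _ (fun a b => F (al' a) (al' b))) //.
  by apply: eq_sw => a b; rewrite !alK.
- by move=> x; rewrite -{2}[x]al'K ae.
Qed.
End HopfMorphisms.

Section TensorModules.
Variables (k : fieldType) (V : lmodType k) (h : phopf V) (M N : lmodType k).
Variables (al : {linear V -> V}) (th : {linear V -> LHom M M}) (th' : {linear V -> LHom N N}).
Variables (U : V ⊗ LHom M M) (U' : V ⊗ LHom N N).
Local Notation P := (pend (M ⊗ N)).

Lemma thC_end b m n : (thC h P al th th' (endl M N) (endr M N) b : {linear M ⊗ N -> M ⊗ N}) (tens m n) =
  \∑(b1, b2 <- pD h b) tens ((th b1 : {linear M -> M}) m) ((th' (al b2) : {linear N -> N}) n).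
Proof.
rewrite [LHS](sw_linear (fun f : LHom (M ⊗ N) (M ⊗ N) => (f : {linear _ -> _}) (tens m n))) //.
by apply: eq_sw => b1 b2; rewrite endlrE.
Qed.

Lemma tev_UC_end m n : tev (UC h P U U' (endl M N) (endr M N)) (tens m n) =
  \∑(x, m' <- tev U m) \∑(y, n' <- tev U' n) tens (pmul h x y) (tens m' n').
Proof.
rewrite /UC (sw_linear _ (tev_lin _)) sw_tev //.
apply: eq_sw => x f; rewrite (sw_linear _ (tev_lin _)) sw_tev //.
apply: eq_sw => y g; rewrite /tev sw_tens //.
by rewrite endlrE.
Qed.
End TensorModules.

Section Twist.
Variables (k : fieldType) (H : hopfAlg k).
Hypothesis antipode_bij : bijective (antipode H).
Variables (B : chopf H) (hB : phopf B).
Hypotheses (B_triv : trivH B) (hBP : hopf_of hB) (S_bij : bijective (pS hB)).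
Local Notation T := (linv (cS B)).
Local Notation Δ := (pD hB).
Local Notation ε := (pe hB).
Local Notation S := (pS hB).
Local Notation "x ∙ y" := (pmul hB x y) (at level 39, left associativity).
Local Notation e1 := (pone hB).
Let ST := cS_linvK hBP S_bij.
Let TS := linv_cSK hBP S_bij.
Let braidBB t : braid B B t = swap B B t.
Proof. exact: (mild_braid_l antipode_bij B_triv (trivH_mild B_triv)). Qed.

Section OneTwist.
Variable al : {linear B -> B}.

Lemma twist_act b x : bact (b_twist al) (tens b x) = \∑(b1, b2 <- Δ b) al b2 ∙ x ∙ T b1.
Proof.
rewrite [LHS]lcompE 3!lcompE tmapE ascE (ho_D hBP).
rewrite (sw_lin (T ⊠ _)) (sw_lin (braid B B)) (sw_lin (cmul B)); apply: eq_sw => b1 b2.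
by rewrite tmapE lcompE tmapE braidBB swapE !(ho_mul hBP).
Qed.

Lemma twist_coact x : bcoact (b_twist al) x = \∑(a, b <- Δ x) tens (S b) a.
Proof.
rewrite [LHS]lcompE lcompE (braidV_swap braidBB) (ho_D hBP) -[Δ x in LHS]sw_id (sw_lin (swap B B)) (sw_lin (_ ⊠ _)).
by apply: eq_sw => a b; rewrite swapE tmapE (ho_S hBP).
Qed.

Hypothesis al_mor : hopf_mor hB al.

(** The coaction of b_1·x carries S(al(b_12)) at the end of its leg in B, and the factor al(b_2) of
    the twisted condition cancels it; this is where the twist originates. *)
Lemma twist_ydmod : ydmod hB al (curry (bact (b_twist al))) (bcoact (b_twist al)).
Proof.
have actE b x : (curry (bact (b_twist al)) b : {linear B -> B}) x = \∑(b1, b2 <- Δ b) al b2 ∙ x ∙ T b1.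
  exact: twist_act.
have sw_co (X : lmodType k) (F : B -> B -> X) x : bilin F ->
    \∑(y, x' <- bcoact (b_twist al) x) F y x' = \∑(a, b <- Δ x) F (S b) a.
  by move=> hF; rewrite twist_coact sw_sw //; apply: eq_sw => a b; rewrite sw_tens.
split.
- move=> m; rewrite actE (pD1 hB) sw_tens //.
  by rewrite (hm1 al_mor) (ai1 ST) pmul1l pmul1r.
- move=> x y m; rewrite !actE (comul_pmul hB (F := fun b1 b2 => al b2 ∙ m ∙ T b1)) //.
  apply: eq_sw => x1 x2; rewrite (sw_linear (fun z => al x2 ∙ z ∙ T x1)) //.
  by apply: eq_sw => y1 y2; rewrite (hmM al_mor) (aiM ST TS) !pmulA.
- move=> X F m hF; rewrite !sw_co //.
  transitivity (\∑(a, b <- Δ m) \∑(c, d <- Δ b) F (S d) (S c) a).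
    by apply: eq_sw => a b; rewrite comul_antip.
  rewrite -(coassoc hB (fun a c d => F (S d) (S c) a)) //.
  by apply: eq_sw => a b; rewrite sw_co.
- move=> m; rewrite sw_co //.
  rewrite -[RHS](counr hB m (f := fun z => z)) //.
  by apply: eq_sw => a b; rewrite (eps_antip hB).
- move=> X F b m hF.
  transitivity (\∑(b1, b2 <- Δ b) \∑(c1, c2 <- Δ b1) \∑(m1, m2 <- Δ m) \∑(p1, p2 <- Δ c1) \∑(q1, q2 <- Δ c2)
     F (p1 ∙ S m2 ∙ S (al q2) ∙ al b2) (al q1 ∙ m1 ∙ T p2)).
    apply: eq_sw => b1 b2; rewrite actE sw_co //.
    rewrite (sw_linear (fun z => \∑(a, c <- Δ z) F (S c ∙ al b2) a)) //.
    apply: eq_sw => c1 c2.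
    rewrite (comul_pmul hB (F := fun a c => F (S c ∙ al b2) a)) //.
    rewrite (comul_pmul hB (F := fun a' c' => \∑(a, c <- Δ (T c1)) F (S (c' ∙ c) ∙ al b2) (a' ∙ a))) //.
    rewrite (hm_comul al_mor (F := fun a b0 => \∑(c, d <- Δ m) \∑(a', c' <- Δ (T c1)) F (S (b0 ∙ d ∙ c') ∙ al b2) (a ∙ c ∙ a'))) //.
    rewrite sw_exch; apply: eq_sw => m1 m2; rewrite sw_exch.
    rewrite (comul_ai ST TS (F := fun a' c' => \∑(q1, q2 <- Δ c2) F (S (al q2 ∙ m2 ∙ c') ∙ al b2) (al q1 ∙ m1 ∙ a'))) //.
    apply: eq_sw => p1 p2; apply: eq_sw => q1 q2.
    by rewrite !(antipM hB) TS !pmulA.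
  transitivity (\∑(b1, b2 <- Δ b) \∑(m1, m2 <- Δ m) \∑(p2, q1 <- Δ b2) F (b1 ∙ S m2) (al q1 ∙ m1 ∙ T p2)); last first.
    apply: eq_sw => b1 b2; rewrite sw_co //.
    by apply: eq_sw => m1 m2; rewrite actE (sw_linear (fun z => F (b1 ∙ S m2) z)).
  rewrite (coassoc hB (fun c1 c2 b2 => \∑(m1, m2 <- Δ m) \∑(p1, p2 <- Δ c1) \∑(q1, q2 <- Δ c2)
     F (p1 ∙ S m2 ∙ S (al q2) ∙ al b2) (al q1 ∙ m1 ∙ T p2))) //.
  transitivity (\∑(b1, b2 <- Δ b) \∑(m1, m2 <- Δ m) \∑(p1, p2 <- Δ b1) F (p1 ∙ S m2) (al b2 ∙ m1 ∙ T p2)).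
    apply: eq_sw => b1 b2; rewrite sw_exch; apply: eq_sw => m1 m2; rewrite sw_exch.
    apply: eq_sw => p1 p2.
    rewrite (coassoc hB (fun q1 q2 b3 => F (p1 ∙ S m2 ∙ S (al q2) ∙ al b3) (al q1 ∙ m1 ∙ T p2))) //.
    transitivity (\∑(q1, q <- Δ b2) (ε q : k) *: F (p1 ∙ S m2) (al q1 ∙ m1 ∙ T p2)).
      apply: eq_sw => q1 q.
      transitivity (\∑(q2, q3 <- Δ q) F (p1 ∙ S m2 ∙ al (S q2 ∙ q3)) (al q1 ∙ m1 ∙ T p2)).
        by apply: eq_sw => q2 q3; rewrite (hmM al_mor) (hm_antip _ al_mor) pmulA.
      by rewrite (antl hB _ (f := fun z => F (p1 ∙ S m2 ∙ al z) (al q1 ∙ m1 ∙ T p2))) // (hm1 al_mor) pmul1r.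
    by rewrite (counr hB _ (f := fun q1 => F (p1 ∙ S m2) (al q1 ∙ m1 ∙ T p2))).
  rewrite sw_exch [RHS]sw_exch; apply: eq_sw => m1 m2.
  by rewrite (coassoc hB (fun p1 p2 b2 => F (p1 ∙ S m2) (al b2 ∙ m1 ∙ T p2))).
Qed.
End OneTwist.

Lemma dual_basis_index (U : lmodType k) n (e : 'I_n -> U) (c : 'I_n -> {linear U -> k^o}) :
  dual_basis e c -> nonzero U -> inhabited 'I_n.
Proof.
move=> ec [u]; rewrite (ec.1 u); case: n e c ec => [|n] e c ec; last by split; exact: ord0.
by rewrite big_ord0 eqxx.
Qed.

Lemma nonzero_tens (U W : lmodType k) : fin_dim U -> fin_dim W -> nonzero U -> nonzero W -> nonzero (U ⊗ W).
Proof.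
move=> /fin_dim_dual_basis[n [e [c ec]]] /fin_dim_dual_basis[m [f [d fd]]].
move=> /(dual_basis_index ec)[i] /(dual_basis_index fd)[j].
exists (tens (e i) (f j)); apply/eqP => E.
have := congr1 (lun _ \o (c i ⊠ d j)) E; rewrite linear0 /= tmapE lunE ec.2 fd.2 !eqxx scale1r => /eqP.
by rewrite oner_eq0.
Qed.

Lemma pend_sandwich (M : lmodType k) : fin_dim M -> sandwich_alg (pend M).
Proof.
move=> /fin_dim_dual_basis[n [e [c ec]]]; exists (sandwich M); first exact: (sandwich_bij ec).
exact: sandwichE.
Qed.

Lemma end_fin_dim (M : lmodType k) : fin_dim M -> fin_dim (LHom M M).
Proof. by move=> fM; have [n [e [c ec]]] := fin_dim_dual_basis fM; exact: (fin_dim_LHom ec fM). Qed.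

Lemma end_nonzero (M : lmodType k) : nonzero M -> nonzero (LHom M M).
Proof.
move=> [m m0]; exists (lid M); apply: contraNneq m0 => E.
by have := congr1 (fun f : LHom M M => (f : {linear M -> M}) m) E => /= ->.
Qed.

Hypothesis B_fin : fin_dim B.

Lemma B_nonzero : nonzero B.
Proof.
exists e1; apply/eqP => E; have := pe1 hB; rewrite E linear0 => /eqP.
by rewrite eq_sym oner_eq0.
Qed.

Variables (n : nat) (e : 'I_n -> B) (c : 'I_n -> {linear B -> k^o}).
Hypothesis ec : dual_basis e c.

Local Notation E_ al := (balg_end (b_twist al)).
Local Notation th_ al := (curry (bact (b_twist al))).
Local Notation U_ al := (umod e c (bcoact (b_twist al))).

Lemma via_twist (al : {linear B -> B}) : via hB (X := E_ al) (pend B) (lid (LHom B B)) (th_ al) (U_ al).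
Proof. exact: (via_end antipode_bij B_triv hBP (M := b_twist al) (trivH_mild B_triv) ec). Qed.

Lemma datum_twist (al : {linear B -> B}) : hopf_mor hB al -> datum hB (pend B) al (th_ al) (U_ al).
Proof. by move=> al_mor; exact: (datum_of_module ec (twist_ydmod al_mor)). Qed.

Lemma trivH_twist_end (al : {linear B -> B}) : trivH (E_ al).
Proof. exact: (trivH_yd_hom antipode_bij B_fin B_triv B_triv). Qed.

Lemma twist_azumaya (al al' : {linear B -> B}) : hopf_mor hB al -> cancel al al' -> cancel al' al -> azumaya (E_ al).
Proof.
move=> al_mor alK al'K.
apply: (via_azumaya antipode_bij B_triv hBP S_bij _ _ _ al_mor (hopf_mor_inv al_mor alK al'K) alK al'K
          (via_twist al) (datum_twist al_mor)).
- exact: trivH_twist_end.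
- exact: end_fin_dim.
- exact: (end_nonzero B_nonzero).
- exact: pend_sandwich.
Qed.

(** Serves two purposes: N an object over B, with [be] the identity, so that the twist does not
    change; and N = B_beta, which computes the product of two classes. *)
Lemma via_tens_end (X : balg B) (M : lmodType k) (N : bdata B) (be : {linear B -> B})
    (ph : {linear X -> LHom M M}) (al : {linear B -> B}) (th : {linear B -> LHom M M}) (U : B ⊗ LHom M M)
    m (f : 'I_m -> N) (d : 'I_m -> {linear N -> k^o}) (fd : dual_basis f d) :
  hopf_mor hB al -> fin_dim M -> trivH X -> mild N ->
  via hB (pend M) ph th U -> datum hB (pend M) al th U ->
  ydmod hB be (curry (bact N)) (bcoact N) ->
  let th' := thC hB (pend (M ⊗ N)) al th (curry (bact N)) (endl M N) (endr M N) in
  let U' := UC hB (pend (M ⊗ N)) U (umod f d (bcoact N)) (endl M N) (endr M N) in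
  (exists ph' : {linear balg_tens X (balg_end N) -> LHom (M ⊗ N) (M ⊗ N)},
    via hB (pend (M ⊗ N)) ph' th' U') /\
  datum hB (pend (M ⊗ N)) (be \o al) th' U'.
Proof.
move=> al_mor fM tX mN v dM yN /=.
have [r [g [b gb]]] := fin_dim_dual_basis fM.
have fN : fin_dim N by exists m, f => u; exists (fun i => d i u : k); exact: fd.1.
have dN := datum_of_module fd yN.
have vN := via_end antipode_bij B_triv hBP mN fd.
split.
  apply: (via_tens antipode_bij B_triv hBP S_bij al_mor dM dN _ _ _ _ _ _ tX _ v vN).
  - exact: endl1.
  - exact: endlM.
  - exact: endr1.
  - exact: endrM.
  - exact: endlr.
  - exact: (endlr_bij gb fd).
  - exact: mild_end.
apply: (datum_tensor al_mor dM dN).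
- exact: endl1.
- exact: endlM.
- exact: endr1.
- exact: endrM.
- exact: endlr.
Qed.

(** M and N have identity twists, so the two sides of the isomorphism have twists [al] and [be]. The
    space B ⊗ N is nonzero and finite-dimensional, which supplies the trivial center and the
    functional that uniqueness requires. *)
Lemma twist_inj (al be : {linear B -> B}) :
  (forall g, Δ g = tens g g -> ε g = 1 :> k -> forall x, g ∙ x = x ∙ g) ->
  (forall chi : {linear B -> k^o}, chi e1 = 1 :> k ->
    (forall x y, chi (x ∙ y) = (chi x : k) * chi y :> k) ->
    forall x, \∑(a, b <- Δ x) (chi a : k) *: b = \∑(a, b <- Δ x) (chi b : k) *: a) ->
  hopf_mor hB al -> hopf_mor hB be -> brauer_equiv (E_ al) (E_ be) -> al =1 be.
Proof.
move=> gB gD al_mor be_mor [M [N [[bM fM nM] [bN fN nN] iso]]].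
have [m [eM [cM ecM]]] := fin_dim_dual_basis fM.
have [m' [eN [cN ecN]]] := fin_dim_dual_basis fN.
have mM : mild M by apply: is_yd_mild; case: bM.
have mN : mild N by apply: is_yd_mild; case: bN.
have [[ph v] d] := via_tens_end ecM al_mor B_fin (trivH_twist_end al) mM (via_twist al)
  (datum_twist al_mor) (byd_ydmod antipode_bij B_triv hBP bM).
have [[ph' v'] d'] := via_tens_end ecN be_mor B_fin (trivH_twist_end be) mN (via_twist be)
  (datum_twist be_mor) (byd_ydmod antipode_bij B_triv hBP bN).
have fBN : fin_dim (B ⊗ N) by exact: (fin_dim_tens ec fN).
have [q [f [b fb]]] := fin_dim_dual_basis fBN.
have [i0] := dual_basis_index fb (nonzero_tens B_fin fN B_nonzero nN).
have [phi phi1] := pend_functional fb i0.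
exact: (via_uniq hBP S_bij v v' d d' iso (fun Y t => pend_central fb i0 (t := t)) phi1 gB gD).
Qed.

Lemma unit_act b (a : k^o) : bact (byd_unit B) (tens b a) = (ε b : k) *: a.
Proof. by rewrite [LHS]lcompE tmapE lunE (ho_e hBP). Qed.
Lemma unit_coact (a : k^o) : bcoact (byd_unit B) a = tens e1 a.
Proof. by rewrite [LHS]lcompE [LHS]tmapE (ho_one hBP) scale1r. Qed.

Lemma unit_byd : is_byd (byd_unit B).
Proof.
apply: (ydmod_byd antipode_bij B_triv hBP); first exact: trivH_unit.
have actE b a : (curry (bact (byd_unit B)) b : {linear k^o -> k^o}) a = (ε b : k) *: a by exact: unit_act.
split.
- by move=> a; rewrite actE (pe1 hB) scale1r.
- by move=> x y a; rewrite !actE (peM hB) scalerA.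
- move=> X F a hF; rewrite unit_coact !sw_tens //.
  by rewrite (pD1 hB) unit_coact !sw_tens.
- by move=> a; rewrite unit_coact sw_tens ?(pe1 hB) ?scale1r.
- move=> X F b a hF; transitivity (F b a).
    rewrite -[RHS](counl hB b (f := fun b => F b a)) //.
    apply: eq_sw => b1 b2; rewrite actE unit_coact sw_tens //.
    by rewrite pmul1l (linZ (F b2)).
  rewrite -[LHS](counr hB b (f := fun b => F b a)) //.
  apply: eq_sw => b1 b2; rewrite unit_coact sw_tens //.
  by rewrite actE pmul1r (linZ (F b1)).
Qed.

Lemma unit_fin_dim : fin_dim (byd_unit B).
Proof. by exists 1%N, (fun _ => 1 : k) => u; exists (fun _ => u : k); rewrite big_ord1; exact: esym (mulr1 _). Qed.
Lemma unit_nonzero : nonzero (byd_unit B).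
Proof. by exists (1 : k); rewrite oner_eq0. Qed.

End Twist.

(** * The commutative and cocommutative case *)

Section CommutativeHopf.
Variables (k : fieldType) (V : lmodType k) (h : phopf V) (T : {linear V -> V}).
Hypotheses (ST : cancel (pS h) T) (TS : cancel T (pS h)).
Local Notation Δ := (pD h).
Local Notation ε := (pe h).
Local Notation S := (pS h).
Local Notation "x ∙ y" := (pmul h x y) (at level 39, left associativity).
Local Notation e1 := (pone h).
Hypotheses (mulC : forall x y, x ∙ y = y ∙ x) (comulC : forall x, swap V V (Δ x) = Δ x).

Lemma sw_comulC (X : lmodType k) (F : V -> V -> X) x : bilin F ->
  \∑(a, b <- Δ x) F a b = \∑(a, b <- Δ x) F b a.
Proof.
move=> hF; rewrite -[in LHS]comulC (lin_sw (swap V V)) sw_sw //.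
by apply: eq_sw => a b; rewrite swapE sw_tens.
Qed.

(** By cocommutativity [T] is a convolution inverse of the identity as well. *)
Lemma antip_invol x : T x = S x.
Proof.
move: x; apply: (conv_uniq (h := h) (A := h) (p := lid V)); [mlin|mlin|mlin| |] => x.
  by rewrite sw_comulC // (ail ST TS _ (f := fun z => z)).
exact: pSr.
Qed.

(** The convolution T * al. For commutative B the action on B_alpha is multiplication by it, see
    [twist_psi]. *)
Definition psi (al : {linear V -> V}) b := \∑(b1, b2 <- Δ b) T b1 ∙ al b2.
Lemma psi_lin al : linear (psi al). Proof. by rewrite /psi; mlin. Qed.

(** The legs of b occur in the order 2, 3 | 1, 4 instead of 1, 2 | 3, 4; cocommutativity among the
    first three identifies them. *)
Lemma psi_comul al (X : lmodType k) (F : V -> V -> X) b : hopf_mor h al -> bilin F ->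
  \∑(x, y <- Δ (psi al b)) F x y = \∑(b1, b2 <- Δ b) F (psi al b1) (psi al b2).
Proof.
move=> al_mor hF.
pose G u v w z := F (T u ∙ al v) (T w ∙ al z).
transitivity (\∑(b1, b2 <- Δ b) \∑(u, v <- Δ b1) \∑(w, z <- Δ b2) G v w u z).
  rewrite /psi (sw_linear (fun t => \∑(x, y <- Δ t) F x y)) //.
  apply: eq_sw => b1 b2; rewrite comul_pmul //.
  rewrite (comul_ai ST TS (F := fun a b => \∑(x, d <- Δ (al b2)) F (a ∙ x) (b ∙ d))) //.
  apply: eq_sw => u v; rewrite (hm_comul al_mor (F := fun x d => F (T v ∙ x) (T u ∙ d))); last by mlin.
  by [].
transitivity (\∑(b1, b2 <- Δ b) \∑(u, v <- Δ b1) \∑(w, z <- Δ b2) G u v w z); last first.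
  rewrite /psi; apply: eq_sw => b1 b2.
  rewrite [RHS](sw_linear (fun t => F t (\∑(w, z <- Δ b2) T w ∙ al z))); last by mlin.
  by apply: eq_sw => u v; rewrite [RHS](sw_linear (F (T u ∙ al v))).
transitivity (\∑(b1, z <- Δ b) \∑(x, w <- Δ b1) \∑(u, v <- Δ x) G v w u z).
  rewrite (coassoc h (fun x w z => \∑(u, v <- Δ x) G v w u z)); last by rewrite /G; mlin.
  by apply: eq_sw => b1 b2; rewrite sw_exch.
transitivity (\∑(b1, z <- Δ b) \∑(x, w <- Δ b1) \∑(u, v <- Δ x) G u v w z); last first.
  rewrite (coassoc h (fun x w z => \∑(u, v <- Δ x) G u v w z)); last by rewrite /G; mlin.
  by apply: eq_sw => b1 b2; rewrite sw_exch.
apply: eq_sw => b1 z.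
rewrite (coassoc h (fun u v w => G v w u z)); last by rewrite /G; mlin.
by rewrite sw_comulC //; rewrite /G; mlin.
Qed.

(** The product is T * al * (T ∘ al) * (be ∘ al), whose two middle factors are mutually inverse. *)
Lemma psi_conv (al be : {linear V -> V}) b : hopf_mor h al ->
  \∑(b1, b2 <- Δ b) psi al b1 ∙ psi be (al b2) = psi (be \o al) b.
Proof.
move=> al_mor.
transitivity (\∑(b1, b2 <- Δ b) \∑(u, v <- Δ b1) \∑(w, z <- Δ b2) T u ∙ al (v ∙ S w) ∙ be (al z)).
  apply: eq_sw => b1 b2; rewrite /psi (hm_comul al_mor (F := fun w z => T w ∙ be z)) //.
  rewrite (sw_linear (fun t => t ∙ _)) //.
  apply: eq_sw => u v; rewrite (sw_linear (pmul h _)) //.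
  by apply: eq_sw => w z; rewrite (hmM al_mor) (hm_antip _ al_mor) !antip_invol !pmulA.
rewrite (coassoc h (fun u v b2 => \∑(w, z <- Δ b2) T u ∙ al (v ∙ S w) ∙ be (al z))) //.
rewrite /psi; apply: eq_sw => u b2.
rewrite -(coassoc h (fun v w z => T u ∙ al (v ∙ S w) ∙ be (al z))) //.
transitivity (\∑(x, z <- Δ b2) (ε x : k) *: (T u ∙ be (al z))).
  apply: eq_sw => x z; rewrite (antr h _ (f := fun t => T u ∙ al t ∙ be (al z))) //.
  by rewrite (hm1 al_mor) pmul1r.
by rewrite (counl h _ (f := fun z => T u ∙ be (al z))).
Qed.

(** The convolution id * (S ∘ bb), meant for [bb] inverse to [be]. After shearing, the second factor
    is multiplied by psi be (al b), whereas [thC] for the twist be ∘ al supplies be(al(b)); [nu_psi]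
    reconciles the two. *)
Definition nu (bb : {linear V -> V}) b := \∑(b1, b2 <- Δ b) b1 ∙ S (bb b2).
Lemma nu_lin bb : linear (nu bb). Proof. by rewrite /nu; mlin. Qed.

Lemma nu_psi (be bb : {linear V -> V}) b : hopf_mor h be -> cancel be bb -> nu bb (be b) = psi be b.
Proof.
move=> be_mor beK; rewrite /nu (hm_comul be_mor (F := fun x y => x ∙ S (bb y))) //.
rewrite sw_comulC //.
by apply: eq_sw => b1 b2; rewrite beK antip_invol mulC.
Qed.

Lemma nuM (bb : {linear V -> V}) x y : hopf_mor h bb -> nu bb (x ∙ y) = nu bb x ∙ nu bb y.
Proof.
move=> bb_mor; rewrite /nu comul_pmul //.
rewrite (sw_linear (fun t => t ∙ _)) //.
apply: eq_sw => x1 x2; rewrite (sw_linear (pmul h _)) //.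
apply: eq_sw => y1 y2; rewrite (hmM bb_mor) antipM.
by rewrite -!pmulA; congr (_ ∙ _); rewrite [RHS]mulC !pmulA.
Qed.

Lemma nu1 (bb : {linear V -> V}) : hopf_mor h bb -> nu bb e1 = e1.
Proof.
move=> bb_mor; rewrite /nu (pD1 h) sw_tens //.
by rewrite (hm1 bb_mor) antip1 pmul1r.
Qed.

Definition shear (t : V ⊗ V) : V ⊗ V := \∑(x, y <- t) \∑(y1, y2 <- Δ y) tens (x ∙ y1) y2.
Definition unshear (t : V ⊗ V) : V ⊗ V := \∑(x, y <- t) \∑(y1, y2 <- Δ y) tens (x ∙ S y1) y2.
Lemma shear_lin : linear shear. Proof. by rewrite /shear; mlin. Qed.
Lemma unshear_lin : linear unshear. Proof. by rewrite /unshear; mlin. Qed.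
Lemma shear_tens x y : shear (tens x y) = \∑(y1, y2 <- Δ y) tens (x ∙ y1) y2.
Proof. by rewrite /shear sw_tens //. Qed.
Lemma unshear_tens x y : unshear (tens x y) = \∑(y1, y2 <- Δ y) tens (x ∙ S y1) y2.
Proof. by rewrite /unshear sw_tens //. Qed.

Lemma shearK : cancel shear unshear.
Proof.
have hs := shear_lin; have hu := unshear_lin.
apply: tens_lin_ext => // x y.
rewrite shear_tens (sw_linear _ hu).
under eq_sw => y1 y2 do rewrite unshear_tens.
rewrite -(coassoc h (fun a b c => tens (x ∙ a ∙ S b) c)) //.
transitivity (\∑(a, b <- Δ y) (ε a : k) *: tens x b).
  apply: eq_sw => a b; under eq_sw do rewrite -pmulA.
  by rewrite (antr h _ (f := fun z => tens (x ∙ z) b)) ?pmul1r.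
by rewrite (counl h _ (f := tens x)).
Qed.

Lemma unshearK : cancel unshear shear.
Proof.
have hs := shear_lin; have hu := unshear_lin.
apply: tens_lin_ext => // x y.
rewrite unshear_tens (sw_linear _ hs).
under eq_sw => y1 y2 do rewrite shear_tens.
rewrite -(coassoc h (fun a b c => tens (x ∙ S a ∙ b) c)) //.
transitivity (\∑(a, b <- Δ y) (ε a : k) *: tens x b).
  apply: eq_sw => a b; under eq_sw do rewrite -pmulA.
  by rewrite (antl h _ (f := fun z => tens (x ∙ z) b)) ?pmul1r.
by rewrite (counl h _ (f := tens x)).
Qed.

(** [psi_comul] splits the action on the second factor; its first part merges with the action on the
    first factor by [psi_conv], and the rest is rewritten by [nu_psi]. *)
Lemma shear_act (al be bb : {linear V -> V}) b x y : hopf_mor h al -> hopf_mor h be -> cancel be bb ->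
  shear (\∑(b1, b2 <- Δ b) tens (psi al b1 ∙ x) (psi be (al b2) ∙ y)) =
  \∑(y1, y2 <- Δ y) \∑(b1, b2 <- Δ b) tens (psi (be \o al) b1 ∙ (x ∙ y1)) (nu bb (be (al b2)) ∙ y2).
Proof.
move=> al_mor be_mor beK; have hs := shear_lin.
have ha := psi_lin al; have hb := psi_lin be.
rewrite (sw_linear _ hs).
transitivity (\∑(b1, b2 <- Δ b) \∑(c1, c2 <- Δ b2) \∑(y1, y2 <- Δ y)
    tens (psi al b1 ∙ psi be (al c1) ∙ (x ∙ y1)) (psi be (al c2) ∙ y2)).
  apply: eq_sw => b1 b2; rewrite shear_tens comul_pmul //.
  rewrite (psi_comul (F := fun p q => \∑(y1, y2 <- Δ y) tens (psi al b1 ∙ x ∙ (p ∙ y1)) (q ∙ y2))) //.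
  rewrite (hm_comul al_mor (F := fun c1 c2 => \∑(y1, y2 <- Δ y)
    tens (psi al b1 ∙ x ∙ (psi be c1 ∙ y1)) (psi be c2 ∙ y2))) //.
  do 2 (apply: eq_sw => ? ?); congr (tens _ _); rewrite -!pmulA; congr (_ ∙ _).
  by rewrite !pmulA [x ∙ _]mulC.
rewrite -(coassoc h (fun b1 c1 c2 => \∑(y1, y2 <- Δ y)
    tens (psi al b1 ∙ psi be (al c1) ∙ (x ∙ y1)) (psi be (al c2) ∙ y2))) //.
rewrite [RHS]sw_exch; apply: eq_sw => b1 b2; rewrite sw_exch; apply: eq_sw => y1 y2.
rewrite -psi_conv // nu_psi // (sw_linear (fun t => tens (t ∙ _) _)) //.
Qed.

(** Only the last two of three legs of y are interchanged, which cocommutativity permits. *)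
Lemma shear_coact x y :
  \∑(x1, x2 <- Δ x) \∑(y1, y2 <- Δ y) tens (S x2 ∙ S y2) (shear (tens x1 y1)) =
  \∑(y1, y2 <- Δ y) \∑(z1, z2 <- Δ (x ∙ y1)) tens (S z2) (tens z1 y2).
Proof.
transitivity (\∑(x1, x2 <- Δ x) \∑(y1, y2 <- Δ y) \∑(c, d <- Δ y1) tens (S x2 ∙ S y2) (tens (x1 ∙ c) d)).
  apply: eq_sw => x1 x2; apply: eq_sw => y1 y2; rewrite shear_tens.
  by rewrite (sw_linear (tens (S x2 ∙ S y2))).
transitivity (\∑(y1, y2 <- Δ y) \∑(x1, x2 <- Δ x) \∑(c, d <- Δ y1) tens (S x2 ∙ S d) (tens (x1 ∙ c) y2)); last first.
  apply: eq_sw => y1 y2; rewrite comul_pmul //.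
  by do 2 (apply: eq_sw => ? ?); rewrite antipM mulC.
rewrite [RHS]sw_exch; apply: eq_sw => x1 x2.
rewrite (coassoc h (fun c d y2 => tens (S x2 ∙ S y2) (tens (x1 ∙ c) d))) //.
rewrite (coassoc h (fun c d y2 => tens (S x2 ∙ S d) (tens (x1 ∙ c) y2))) //.
by apply: eq_sw => c z; rewrite sw_comulC.
Qed.
End CommutativeHopf.

Section Product.
Variables (k : fieldType) (H : hopfAlg k).
Hypothesis antipode_bij : bijective (antipode H).
Variables (B : chopf H) (hB : phopf B).
Hypotheses (B_triv : trivH B) (hBP : hopf_of hB) (S_bij : bijective (pS hB)).
Local Notation T := (linv (cS B)).
Local Notation Δ := (pD hB).
Local Notation ε := (pe hB).
Local Notation S := (pS hB).
Local Notation "x ∙ y" := (pmul hB x y) (at level 39, left associativity).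
Local Notation e1 := (pone hB).
Let ST := cS_linvK hBP S_bij.
Let TS := linv_cSK hBP S_bij.
Hypotheses (mulC : forall x y, x ∙ y = y ∙ x) (comulC : forall x, swap B B (Δ x) = Δ x).
Hypothesis B_fin : fin_dim B.
Local Notation E_ al := (balg_end (b_twist al)).
Local Notation th_ al := (curry (bact (b_twist al))).

Variables (al al' be be' : {linear B -> B}).
Hypotheses (al_mor : hopf_mor hB al) (be_mor : hopf_mor hB be).
Hypotheses (alK : cancel al al') (al'K : cancel al' al) (beK : cancel be be') (be'K : cancel be' be).

Fact tact_bilin : bilin (fun b y : B => nu hB be' b ∙ y).
Proof. by have hn := nu_lin hB be'; mlin. Qed.

(* The Yetter-Drinfel'd module [N] for which
   [E_(be ∘ al) ⊗ End(N) ≅ (E_al ⊗ E_be) ⊗ End(k)]. *)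
Definition tmod : bdata B := @BData k H B (calg_yd B) (tlift tact_bilin) (mk_lin (@tensr k B B e1)).

Lemma tmod_act b y : bact tmod (tens b y) = nu hB be' b ∙ y.
Proof. exact: tliftE. Qed.
Lemma tmod_coact y : bcoact tmod y = tens e1 y.
Proof. by []. Qed.

(** With a trivial coaction, the compatibility reduces to cocommutativity of B. *)
Lemma tmod_ydmod : ydmod hB (lid B) (curry (bact tmod)) (bcoact tmod).
Proof.
have be'_mor := hopf_mor_inv be_mor beK be'K.
have hn := nu_lin hB be'.
have actE b y : (curry (bact tmod) b : {linear B -> B}) y = nu hB be' b ∙ y by exact: tmod_act.
split.
- by move=> m; rewrite actE nu1 // pmul1l.
- by move=> x y m; rewrite !actE nuM // pmulA.
- move=> X F m hF; rewrite tmod_coact sw_tens //.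
  by rewrite (pD1 hB) sw_tens // [RHS]sw_tens // tmod_coact sw_tens.
- by move=> m; rewrite tmod_coact sw_tens ?(pe1 hB) ?scale1r.
- move=> X F b m hF.
  transitivity (\∑(b1, b2 <- Δ b) F b2 (nu hB be' b1 ∙ m)).
    apply: eq_sw => b1 b2; rewrite tmod_coact actE sw_tens //.
    by rewrite pmul1l.
  rewrite (sw_comulC comulC (F := fun b1 b2 => F b2 (nu hB be' b1 ∙ m))) //.
  apply: eq_sw => b1 b2; rewrite tmod_coact sw_tens //.
  by rewrite actE pmul1r.
Qed.

Lemma tmod_byd : is_byd tmod.
Proof. exact: (ydmod_byd antipode_bij B_triv hBP (M := tmod) B_triv tmod_ydmod). Qed.

Lemma twist_psi (ga : {linear B -> B}) b x : bact (b_twist ga) (tens b x) = psi hB T ga b ∙ x.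
Proof.
rewrite (twist_act antipode_bij B_triv hBP) /psi (sw_linear (fun t => t ∙ x)) //.
by apply: eq_sw => b1 b2; rewrite mulC pmulA.
Qed.

Lemma twist_tens_azumaya : azumaya (balg_tens (E_ al) (E_ be)).
Proof.
have [n [e [c ec]]] := fin_dim_dual_basis B_fin.
have [[ph v] d] := via_tens_end antipode_bij B_triv hBP S_bij (N := b_twist be) ec al_mor B_fin
  (trivH_twist_end antipode_bij B_triv B_fin al) (trivH_mild B_triv)
  (via_twist antipode_bij B_triv hBP ec al) (datum_twist antipode_bij B_triv hBP S_bij ec al_mor)
  (twist_ydmod antipode_bij B_triv hBP S_bij be_mor).
have ga_mor := hopf_mor_comp al_mor be_mor.
have gaK : cancel (be \o al) (al' \o be') by move=> x; rewrite /= beK alK.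
have ga'K : cancel (al' \o be') (be \o al) by move=> x; rewrite /= al'K be'K.
have BB_fin : fin_dim (B ⊗ B) by exact: (fin_dim_tens ec B_fin).
have E_fin := end_fin_dim B_fin; have E_nz := end_nonzero (B_nonzero hB).
apply: (via_azumaya antipode_bij B_triv hBP S_bij _ _ _ ga_mor (hopf_mor_inv ga_mor gaK ga'K) gaK ga'K v d).
- by apply: trivH_tens; exact: trivH_twist_end.
- have [q [f [b fb]]] := fin_dim_dual_basis E_fin; exact: (fin_dim_tens fb E_fin).
- exact: nonzero_tens.
- exact: pend_sandwich.
Qed.

Section Shear.
Variables (n : nat) (e : 'I_n -> B) (c : 'I_n -> {linear B -> k^o}).
Hypothesis ec : dual_basis e c.
Local Notation U_ al := (umod e c (bcoact (b_twist al))).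
Local Notation thP := (thC hB (pend (B ⊗ B)) al (th_ al) (th_ be) (endl B B) (endr B B)).
Local Notation UP := (UC hB (pend (B ⊗ B)) (U_ al) (U_ be) (endl B B) (endr B B)).
Local Notation thN := (thC hB (pend (B ⊗ B)) (be \o al) (th_ (be \o al)) (curry (bact tmod)) (endl B B) (endr B B)).
Local Notation UN := (UC hB (pend (B ⊗ B)) (U_ (be \o al)) (umod e c (bcoact tmod)) (endl B B) (endr B B)).

Lemma tact_shear b t : shear hB ((thP b : {linear B ⊗ B -> B ⊗ B}) t) = (thN b : {linear B ⊗ B -> B ⊗ B}) (shear hB t).
Proof.
have hs := shear_lin hB.
move: t; apply: tens_lin_ext => // x y.
rewrite thC_end.
transitivity (shear hB (\∑(b1, b2 <- Δ b) tens (psi hB T al b1 ∙ x) (psi hB T be (al b2) ∙ y))).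
  by congr (shear hB _); apply: eq_sw => b1 b2; rewrite !curryE !twist_psi.
rewrite (shear_act ST TS mulC comulC b x y al_mor be_mor beK) shear_tens (sw_lin (thN b)).
apply: eq_sw => y1 y2; rewrite thC_end; apply: eq_sw => b1 b2.
by rewrite !curryE twist_psi tmod_act.
Qed.

Lemma tcoact_shear t : (lid B ⊠ mk_lin (shear_lin hB)) (tev UP t) = tev UN (shear hB t).
Proof.
have hs := shear_lin hB.
have tl (V : B ⊗ LHom (B ⊗ B) (B ⊗ B)) := tev_lin2 V.
move: t; apply: tens_lin_ext => // x y.
have tU (ga : {linear B -> B}) z : tev (U_ ga) z = \∑(a, b <- Δ z) tens (S b) a.
  rewrite /umod (htensK ec) //.
  exact: (twist_coact antipode_bij B_triv hBP).
have tN z : tev (umod e c (bcoact tmod)) z = tens e1 z.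
  by rewrite /umod (htensK ec).
rewrite tev_UC_end !tU shear_tens (sw_linear _ (tl _)).
transitivity (\∑(y1, y2 <- Δ y) \∑(z1, z2 <- Δ (x ∙ y1)) tens (S z2) (tens z1 y2)); last first.
  apply: eq_sw => y1 y2; rewrite tev_UC_end tU tN sw_sw //.
  apply: eq_sw => z1 z2; rewrite sw_tens //.
  by rewrite sw_tens ?pmul1r.
rewrite -(shear_coact mulC comulC) sw_sw // (sw_lin (lid B ⊠ _)); apply: eq_sw => x1 x2; rewrite sw_tens //.
rewrite sw_sw // (sw_lin (lid B ⊠ _)); apply: eq_sw => y1 y2; rewrite sw_tens //.
by rewrite tmapE.
Qed.
End Shear.

(** By [via_tens_end] the two algebras are endomorphism algebras of B ⊗ B and of (B ⊗ B) ⊗ k with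
    inner structures, so by [via_iso] an isomorphism of these spaces that intertwines the structures
    is enough; the shear is one. *)
Lemma twist_tens_equiv : brauer_equiv (E_ (be \o al)) (balg_tens (E_ al) (E_ be)).
Proof.
have [n [e [c ec]]] := fin_dim_dual_basis B_fin.
have ga_mor := hopf_mor_comp al_mor be_mor.
have I_byd := unit_byd antipode_bij B_triv hBP.
have I_mild : mild (byd_unit B) by apply: trivH_mild; exact: trivH_unit.
have [r [f [b fb]]] := fin_dim_dual_basis (unit_fin_dim B).
have trivE ga := trivH_twist_end antipode_bij B_triv B_fin ga.
exists tmod, (byd_unit B); split.
- split=> //; [exact: tmod_byd|exact: (B_nonzero hB)].
- split=> //; [exact: unit_fin_dim|exact: unit_nonzero].
have [[ph v] _] := via_tens_end antipode_bij B_triv hBP S_bij (N := tmod) ec ga_mor B_fin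
  (trivE _) (trivH_mild B_triv) (via_twist antipode_bij B_triv hBP ec _)
  (datum_twist antipode_bij B_triv hBP S_bij ec ga_mor) tmod_ydmod.
have [[ph1 v1] d1] := via_tens_end antipode_bij B_triv hBP S_bij (N := b_twist be) ec al_mor B_fin
  (trivE al) (trivH_mild B_triv)
  (via_twist antipode_bij B_triv hBP ec al) (datum_twist antipode_bij B_triv hBP S_bij ec al_mor)
  (twist_ydmod antipode_bij B_triv hBP S_bij be_mor).
have BB_fin : fin_dim (B ⊗ B) by exact: (fin_dim_tens ec B_fin).
have [[ph2 v2] _] := via_tens_end antipode_bij B_triv hBP S_bij (X := balg_tens (E_ al) (E_ be)) (N := byd_unit B) fb ga_mor BB_fin
  (trivH_tens (trivE al) (trivE be)) I_mild v1 d1 (byd_ydmod antipode_bij B_triv hBP I_byd).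
have tE (ga : {linear B -> B}) : trivH (E_ ga) by exact: trivE.
(* The source belongs to the twist be ∘ al and N, so this direction uses the inverse of the
   shear. *)
pose G : {linear B ⊗ B -> (B ⊗ B) ⊗ k^o} := runV (B ⊗ B) \o mk_lin (unshear_lin hB).
pose GV : {linear (B ⊗ B) ⊗ k^o -> B ⊗ B} := mk_lin (shear_lin hB) \o run (B ⊗ B).
apply: (via_iso (g := G) (gV := GV) _ _ v v2).
- by apply: trivH_tens; [exact: trivE|exact: (trivH_yd_hom antipode_bij (M := tmod) B_fin B_triv B_triv)].
- apply: trivH_tens; first by apply: trivH_tens; exact: trivE.
  by apply: (trivH_yd_hom antipode_bij (unit_fin_dim B)); exact: trivH_unit.
- move=> t; transitivity (shear hB (run (B ⊗ B) (runV (B ⊗ B) (unshear hB t)))) => //.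
  by rewrite runVE runE scale1r unshearK.
- apply: tens_lin_ext => // t a.
  transitivity (runV (B ⊗ B) (unshear hB (shear hB (run (B ⊗ B) (tens t a))))) => //.
  rewrite shearK runE runVE (linZ (fun t => tens t (1 : k^o))) //.
  by rewrite -(linZ (tens t)) ?[X in tens _ X]mulr1.
- have [q [g [p gp]]] := fin_dim_dual_basis BB_fin; exact: (fin_dim_tens gp (unit_fin_dim B)).
- have GVE (t : B ⊗ B) (a : k^o) : GV (tens t a) = (a : k) *: shear hB t.
    transitivity (shear hB (run (B ⊗ B) (tens t a))) => //.
    by rewrite runE (linZ (shear hB)) //; exact: shear_lin.
  move=> x; apply: tens_lin_ext => // t a.
  pose thP := thC hB (pend (B ⊗ B)) al (th_ al) (th_ be) (endl B B) (endr B B).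
  rewrite GVE thC_end linearZ -tact_shear (sw_lin GV).
  transitivity ((a : k) *: shear hB ((thP x : {linear B ⊗ B -> B ⊗ B}) t)) => //.
  rewrite -(counr hB x (f := fun x => (a : k) *: shear hB ((thP x : {linear B ⊗ B -> B ⊗ B}) t))); last first.
    by have hs := shear_lin hB; mlin.
  (* The unit object is acted on by be(al(x_2)), whose counit is ε(x_2). *)
  apply: eq_sw => x1 x2; rewrite GVE curryE (unit_act hBP) (hm_eps ga_mor).
  by rewrite scalerA.
- have GVE (t : B ⊗ B) (a : k^o) : GV (tens t a) = (a : k) *: shear hB t.
    transitivity (shear hB (run (B ⊗ B) (tens t a))) => //.
    by rewrite runE (linZ (shear hB)) //; exact: shear_lin.
  have hs := shear_lin hB.
  apply: tens_lin_ext; [by rewrite /tev; mlin|by rewrite /tev; mlin|] => t a.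
  pose UP := UC hB (pend (B ⊗ B)) (umod e c (bcoact (b_twist al))) (umod e c (bcoact (b_twist be)))
    (endl B B) (endr B B).
  transitivity ((a : k) *: (lid B ⊠ mk_lin (shear_lin hB)) (tev UP t)); last first.
    by rewrite (tcoact_shear ec) GVE (linZ _ (tev_lin2 _)).
  rewrite tev_UC_end [in RHS]tmap_swE swZ (sw_lin (lid B ⊠ GV)).
  apply: eq_sw => x t'.
  have -> : tev (umod f b (bcoact (byd_unit B))) a = tens e1 a.
    rewrite /umod (htensK fb); first exact: unit_coact.
    by mlin.
  by rewrite sw_tens // pmul1r tmapE GVE (linZ (tens (lid B x))).
Qed.
End Product.

(** * Hopf algebra automorphisms *)

Section Automorphisms.
Variables (k : fieldType) (H : hopfAlg k) (B : chopf H).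

Lemma balg_iso_refl (A : balg B) : balg_iso A A.
Proof.
have lid_tens (U W : lmodType k) : lid U ⊠ lid W = lid (U ⊗ W).
  by apply: tensor_lin_ext => u w; rewrite tmapE.
have lid_mor (W X : lmodType k) (f : {linear W -> X}) : lid X ∘ f = f ∘ lid W by exact: lin_ext.
exists (lid A); split; first by exists id.
- by split; [split|..]; rewrite lid_tens ?lid_mor.
- by rewrite lid_tens lid_mor.
- by rewrite lid_mor; exact: lin_ext.
Qed.

Lemma hopf_aut_mor (hB : phopf B) (al : hopf_aut B) : hopf_of hB -> hopf_mor hB al.
Proof.
move=> hBP; split.
- move=> x y; have := lin_eqE (aut_mul al) (tens x y).
  by rewrite 2!lcompE tmapE !(ho_mul hBP).
- have := lin_eqE (aut_one al) (1 : k^o).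
  by rewrite lcompE (ho_one hBP) scale1r.
- move=> X F x hF; have := lin_eqE (aut_comul al) x.
  rewrite 2!lcompE (ho_D hBP) => ->.
  by rewrite sw_tmap.
- by move=> x; have := lin_eqE (aut_counit al) x; rewrite lcompE (ho_e hBP).
Qed.

Lemma hopf_aut_eq (al be : hopf_aut B) : aut_fun al =1 aut_fun be -> al = be.
Proof.
case: al be => [f a1 a2 a3 a4 a5 a6] [g b1 b2 b3 b4 b5 b6] /= /lin_ext fg.
case: _ / fg in b1 b2 b3 b4 b5 b6 *.
by congr HopfAut; exact: Prop_irrelevance.
Qed.

(** Inversion reverses composition, and so does the passage from twists [al], [be] to the twist be ∘
    al of a product. The two reversals cancel, which makes alpha -> [End(B_(alpha^-1))]
    multiplicative. *)
Lemma linv_aut_comp (al be : hopf_aut B) : linv (aut_comp al be) = linv be \o linv al.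
Proof.
have [alK al'K] := linvP (aut_bij al); have [beK be'K] := linvP (aut_bij be).
by apply: linvE => x /=; rewrite ?alK ?beK // be'K al'K.
Qed.
End Automorphisms.

Theorem corollary5p4 (k : fieldType) (H : hopfAlg k) (B : chopf H) (sB sD : side)
  (antipode_bij : bijective (antipode H))
  (B_hopf : is_chopf B) (B_fin : fin_dim B)
  (B_sym : forall M : ydata H, is_yd M -> braid B M = braidV M B)
  (GB_central : grouplikes_in_center sB B)
  (GD_central : grouplikes_in_center sD (cdual B)) :
  (exists Pi : hopf_aut B -> BQ B,
     (forall alpha : hopf_aut B,
        exists E_azumaya : azumaya (balg_end (b_twist (linv alpha))),
          Pi alpha = BQ_class E_azumaya) /\
     injective Pi) /\
  (forall (B_comm : ccommutative B) (B_cocomm : ccocommutative B),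
     exists iota : hopf_aut B -> BD B_comm B_cocomm,
       injective iota /\
       forall alpha beta : hopf_aut B,
         BQ_prod (iota alpha) (iota beta) (iota (aut_comp alpha beta))).
Proof.
have B_yd : is_yd B by case: B_hopf => -[].
have B_triv : trivH B.
  split; [exact: (sym_act antipode_bij B_yd B_sym)|exact: (sym_coact antipode_bij B_yd B_sym)].
have [hB hBP] := hopf_of_exists antipode_bij B_hopf B_triv.
have [n [e [c ec]]] := fin_dim_dual_basis B_fin.
(* The structures over B are written with [linv (cS B)]; this makes it a genuine inverse. *)
have S_bij : bijective (pS hB) by exact: (antip_bij hB ec).
have gB g : pD hB g = tens g g -> pe hB g = 1 :> k -> forall x, pmul hB g x = pmul hB x g.
  move=> gD ge x; rewrite -!(ho_mul hBP).
  by apply: (grouplikes_commute antipode_bij B_triv GB_central); rewrite ?(ho_D hBP) ?(ho_e hBP).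
have one1 : cone B (1 : k^o) = pone hB by rewrite (ho_one hBP) scale1r.
have gD (chi : {linear B -> k^o}) : chi (pone hB) = 1 :> k ->
    (forall x y, chi (pmul hB x y) = (chi x : k) * chi y :> k) ->
    forall x, \∑(a, b <- pD hB x) (chi a : k) *: b = \∑(a, b <- pD hB x) (chi b : k) *: a.
  move=> chi1 chiM x; rewrite -(ho_D hBP).
  apply: (characters_commute antipode_bij B_fin B_triv GD_central); first by rewrite one1.
  by move=> y z; rewrite (ho_mul hBP).
have aut_mor (al : hopf_aut B) : hopf_mor hB (linv al).
  have [alK al'K] := linvP (aut_bij al).
  exact: (hopf_mor_inv (hopf_aut_mor al hBP) alK al'K).
have Eaz (al : hopf_aut B) : azumaya (balg_end (b_twist (linv al))).
  have [alK al'K] := linvP (aut_bij al).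
  exact: (twist_azumaya antipode_bij B_triv hBP S_bij B_fin ec (aut_mor al) al'K alK).
pose I := byd_unit B.
have equiv_refl (A : balg B) : brauer_equiv A A.
  have I_ok : [/\ is_byd I, fin_dim I & nonzero I].
    by split; [exact: (unit_byd antipode_bij B_triv hBP)|exact: unit_fin_dim|exact: unit_nonzero].
  by exists I, I; split=> //; exact: balg_iso_refl.
pose Pi al : BQ B := BQ_class (Eaz al).
have Pi_inj : injective Pi.
  (* Equal classes are equal predicates; they are evaluated at the second representative, which lies
     in its own class. *)
  move=> al be /(congr1 (fun X => sval X (balg_end (b_twist (linv be))))) /= E.
  have [_ eqv] : brauer_class (balg_end (b_twist (linv al))) (balg_end (b_twist (linv be))).
    by rewrite E; split; [exact: Eaz|exact: equiv_refl].
  have {E}E := twist_inj antipode_bij B_triv hBP S_bij B_fin ec gB gD (aut_mor al) (aut_mor be) eqv.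
  have [alK al'K] := linvP (aut_bij al); have [beK be'K] := linvP (aut_bij be).
  by apply: hopf_aut_eq => x; rewrite -[RHS]al'K E beK.
split; first by exists Pi; split=> // al; exists (Eaz al).
move=> B_comm B_cocomm; exists Pi; split=> // al be.
have braidBB t : braid B B t = swap B B t.
  exact: (mild_braid_l antipode_bij B_triv (trivH_mild B_triv)).
have mulC x y : pmul hB x y = pmul hB y x.
  have := lin_eqE B_comm (tens x y).
  by rewrite lcompE braidBB swapE !(ho_mul hBP).
have comulC x : swap B B (pD hB x) = pD hB x.
  by have := lin_eqE B_cocomm x; rewrite lcompE braidBB (ho_D hBP).
have [alK al'K] := linvP (aut_bij al); have [beK be'K] := linvP (aut_bij be).
exists (balg_end (b_twist (linv al))), (balg_end (b_twist (linv be))); split.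
- by split; [exact: Eaz|exact: equiv_refl].
- by split; [exact: Eaz|exact: equiv_refl].
split.
  exact: (twist_tens_azumaya antipode_bij B_triv hBP S_bij B_fin (aut_mor al) (aut_mor be) al'K alK be'K beK).
(* The composite twist beta^-1 ∘ alpha^-1 is the inverse of alpha ∘ beta. *)
have := twist_tens_equiv antipode_bij B_triv hBP S_bij mulC comulC B_fin (aut_mor al) (aut_mor be) be'K beK.
by rewrite -linv_aut_comp.
Qed.
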